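(* Consider the principal–agent game described in the context, under the standing assumptions (A1) and (A2). Let $$\bar\sigma=1-\exp\Big\{-\int_0^{\tau_P}\frac{\mu(1-\theta)H_R(s)-\rho\theta}{\theta-\mu}\,ds\Big\}.$$ An equilibrium with beneficial search exists if and only if $\sigma<\bar\sigma$. In such an equilibrium the players' faking and stopping strategies are $$F_A(t)=\frac1\sigma\Big(1-\exp\Big\{-\int_{\tau_M}^{t}\frac{\mu(1-\theta)H_R(s)-\rho\theta}{\theta-\mu}\,ds\Big\}\Big)\quad\text{for } t\in[\tau_M,\tau_P],$$ $$F_P(t)=1-\exp\Big\{-\int_{\tau_M}^{t}\frac{\beta(1-\mu)H_R(s)-\rho\mu}{\mu-\beta}\,ds\Big\}\quad\text{for } t\in[\tau_M,\tau_P),\qquad F_P(\tau_P)=1,$$ both supported on $[\tau_M,\tau_P]$, where $\tau_M$ is the unique value for which $$1-\exp\Big\{-\int_{\tau_M}^{\tau_P}\frac{\mu(1-\theta)H_R(s)-\rho\theta}{\theta-\mu}\,ds\Big\}=\sigma .$$ The equilibrium payoff of player $i\in\{A,P\}$ is $u_i^{FB}(\tau_M)$. No other equilibrium with beneficial search exists.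
   Context: Parameters and primitives. $\theta\in(0,1)$, $\beta\in(0,\theta)$, $\beta<\mu<\theta$, $\rho>0$, $\sigma\in(0,1)$. $G$ is the CDF of a probability distribution on $[0,\infty)$ with continuous density $g$, $G(t)<1$ for all $t<\infty$, and strictly decreasing hazard rate $H_R(t)=g(t)/(1-G(t))$; $H_R(\infty)=\lim_{t\to\infty}H_R(t)$. Let $\phi_P=\frac{\rho\theta}{\mu(1-\theta)}$, $\phi_A=\frac{\rho\mu}{\beta(1-\mu)}$. Standing assumptions: (A1) $H_R(0)>\phi_P>H_R(\infty)$; (A2) $\phi_P>\phi_A$. $\tau_P\in(0,\infty)$ is the unique solution of $H_R(\tau_P)=\phi_P$. The value $\tau_M$ is sought in $(0,\tau_P)$. First-best payoffs. $u_P^{FB}(t)=\int_0^t e^{-\rho x}g(x)(\mu+(1-\mu)\theta)dx+e^{-\rho t}(1-G(t))\theta$ and $u_A^{FB}(t)=\int_0^t e^{-\rho x}g(x)(\mu+(1-\mu)\beta)dx+e^{-\rho t}(1-G(t))\mu$. Interpretation. The risky action pays both players $\omega\in\{0,1\}$ with $\Pr(\omega=1)=\mu$; the safe action pays the principal $\theta$ and the agent $\beta$. Real news, revealing $\omega$ (''type-$\omega$ news''), arrives at a time with CDF $G$ independent of $\omega$. With probability $\sigma$ the agent is manipulative and can fake type-1 news at a time of his choice. The principal stops and chooses safe at a chosen time if no news has arrived; she chooses safe after type-0 news and, after type-1 news at time $t$, chooses risky with probability $a(t)$. Strategies. For $i\in\{A,P\}$, the agent's faking time ($i=A$) and the principal's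 stopping time ($i=P$) are drawn from a probability measure on $[0,\infty]$ with $F_i(t)=\int_0^t f_i^*(s)\,ds+\sum_{m:\,t_m\le t}f_m$ for $t<\infty$, where $f_i^*\ge0$ is a density, $\{t_m\}$ is a countable set of atoms with probabilities $f_m>0$, and the remaining mass sits at $\infty$ (never). Write $f_i=f_i^*+\sum_m f_m\delta_{t_m}$; integrals over $[0,t]$ include atoms at the endpoints $0$ and $t$, and differences such as $u_i(t')-u_i(t)$ accordingly involve $(t,t']$. ''$f_i(t)>0$'' means $f_i^*(t)>0$ or $t$ is an atom (an atom at $\infty$ included); ''$f_i(t)=0$'' is its negation. The principal also chooses a measurable $a:[0,\infty)\to[0,1]$. Strategy profiles $(a,F_P,F_A)$ are identified through $a$ and the CDFs. Principal's payoff. $w_0^P(s)=(1-\mu)g(s)(1-\sigma F_A(s))$, $w_1^P(s)=\mu g(s)(1-\sigma F_A(s))+\sigma f_A(s)(1-G(s))$, $W^P_\phi(t)=(1-G(t))(1-\sigma F_A(t))$, and $$\mu_1(s)=\frac{\mu g(s)(1-\sigma F_A(s))+\mu\sigma f_A(s)(1-G(s))}{\mu g(s)(1-\sigma F_A(s))+\sigma f_A(s)(1-G(s))},$$ with $\mu_1(s)=\mu$ at an atom $s$ of $F_A$. Then $$u_P(t)=\int_0^t e^{-\rho s}\{w_0^P(s)\theta+w_1^P(s)((1-a(s))\theta+a(s)\mu_1(s))\}ds+e^{-\rho t}W^P_\phi(t)\theta .$$ Agent's payoff. $w_0^A(s)=(1-\mu)g(s)(1-F_P(s))$, $w_1^A(s)=\mu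 g(s)(1-F_P(s))$, $w_S^A(s)=f_P(s)(1-G(s))$, $W^A_\phi(t)=(1-G(t))(1-F_P(t))$, and $$u_A(t)=\int_0^t e^{-\rho s}\{w_0^A(s)\beta+w_1^A(s)((1-a(s))\beta+a(s))+w_S^A(s)\beta\}ds+e^{-\rho t}W^A_\phi(t)((1-a(t))\beta+\mu a(t)).$$ At $t=\infty$ the last term of $u_P$ and $u_A$ is $0$. Equilibrium. $(a,F_P,F_A)$ is an equilibrium iff: (AIC) $f_A(t)>0\Rightarrow u_A(t)\ge u_A(t')$ for all $t,t'\in[0,\infty]$; (PICa) for all $t\ge0$, $a(t)=1$ if $\mu_1(t)>\theta$, $a(t)\in[0,1]$ if $\mu_1(t)=\theta$, $a(t)=0$ if $\mu_1(t)<\theta$; (PICt) $f_P(t)>0\Rightarrow u_P(t)\ge u_P(t')$ for all $t,t'\in[0,\infty]$. The equilibrium payoff of player $i$ is the expectation of $u_i$ under $F_i$ (for $i=A$: the manipulative agent). An equilibrium has beneficial search if the principal's equilibrium payoff is strictly greater than $\theta$. *)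

(* Defs.v *)
From HB Require Import structures.
From mathcomp Require Import all_boot all_order all_algebra.
From mathcomp Require Import all_classical all_reals all_analysis.

Set Implicit Arguments.
Unset Strict Implicit.
Unset Printing Implicit Defensive.

Import Order.TTheory GRing.Theory Num.Theory.
Import numFieldNormedType.Exports.

Local Open Scope classical_set_scope.
Local Open Scope ring_scope.

(* MathComp-Analysis.  Calendar time is a real t >= 0; the values of g, of the
   acceptance rule and of densities and atoms at negative reals are never used.
   Stopping and faking times live in [0, +oo], a subset of \bar R, where +oo
   means "never".  All payoffs are integrals and sums of nonnegative terms, so
   they are well defined in \bar R without any integrability condition. *)

Record game (R : realType) := Game {
  theta : R;  (* principal's payoff from the safe action *)
  beta : R;   (* agent's payoff from the safe action *)
  mu : R;     (* prior probability that the risky action pays 1 *)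
  rho : R;    (* discount rate *)
  sigma : R;  (* probability that the agent is manipulative *)
  g : R -> R  (* density of the arrival time of real news *)
}.

Definition timeline (R : realType) : set R := `[0, +oo[.

Definition upto (R : realType) (t : \bar R) : set R :=
  [set s | 0 <= s /\ (s%:E <= t)%E].

Section Primitives.
Context (R : realType) (E : game R).

Definition G (t : R) : R :=
  \int[@lebesgue_measure R]_(s in `[0, t]) g E s.

Definition HR (t : R) : R := g E t / (1 - G t).

Definition HR_oo : R := lim (HR t @[t --> +oo]).

Definition phiP : R := rho E * theta E / (mu E * (1 - theta E)).

Definition phiA : R := rho E * mu E / (beta E * (1 - mu E)).

Definition uFB_P (t : R) : R :=
  \int[@lebesgue_measure R]_(x in `[0, t])
     (expR (- (rho E * x)) * g E x * (mu E + (1 - mu E) * theta E))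
  + expR (- (rho E * t)) * (1 - G t) * theta E.

Definition uFB_A (t : R) : R :=
  \int[@lebesgue_measure R]_(x in `[0, t])
     (expR (- (rho E * x)) * g E x * (mu E + (1 - mu E) * beta E))
  + expR (- (rho E * t)) * (1 - G t) * mu E.

Definition fake_rate (s : R) : R :=
  (mu E * (1 - theta E) * HR s - rho E * theta E) / (theta E - mu E).

Definition stop_rate (s : R) : R :=
  (beta E * (1 - mu E) * HR s - rho E * mu E) / (mu E - beta E).

Definition cum_fake_rate (s t : R) : R :=
  \int[@lebesgue_measure R]_(x in `[s, t]) fake_rate x.

Definition cum_stop_rate (s t : R) : R :=
  \int[@lebesgue_measure R]_(x in `[s, t]) stop_rate x.

Definition sigma_bar (tauP : R) : R := 1 - expR (- cum_fake_rate 0 tauP).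

End Primitives.

(* A mixed strategy over times in [0, +oo]: a density, countably many atoms
   (atom t is the probability of t, 0 if t is not an atom), and the remaining
   mass at +oo.  The density is a function, not a class up to null sets: the
   equilibrium conditions refer to its pointwise values. *)
Record strategy (R : realType) := Strategy {
  dens : R -> R;
  atom : R -> R;
  dens_ge0 : forall t, 0 <= t -> 0 <= dens t;
  dens_measurable : measurable_fun (@timeline R) dens;
  atom_ge0 : forall t, 0 <= t -> 0 <= atom t;
  atom_countable : countable [set t | 0 <= t /\ 0 < atom t];
  mass_le1 : (\int[@lebesgue_measure R]_(t in @timeline R) (dens t)%:E
              + \esum_(t in @timeline R) (atom t)%:E <= 1)%E
}.

Section Strategies.
Context (R : realType) (S : strategy R).

(* Probability of D, for D included in [0, +oo[ *)
Definition mass (D : set R) : \bar R :=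
  (\int[@lebesgue_measure R]_(t in D) (dens S t)%:E
   + \esum_(t in D) (atom S t)%:E)%E.

Definition strat_cdf (t : R) : R := fine (mass `[0, t]).

Definition mass_never : R := 1 - fine (mass (@timeline R)).

Definition law (U : set (\bar R)) : \bar R :=
  (mass (@timeline R `&` [set t | U t%:E]) + (\1_U +oo%E * mass_never)%:E)%E.

Definition strat_support : set (\bar R) :=
  [set t | forall U : set (\bar R), open_nbhs t U -> (0 < law U)%E].

(* The condition f(t) > 0 *)
Definition active (t : \bar R) : Prop :=
  match t with
  | EFin r => 0 < dens S r \/ 0 < atom S r
  | +oo%E => 0 < mass_never
  | -oo%E => False
  end.

Definition expectation_of (u : \bar R -> \bar R) : \bar R :=
  (\int[@lebesgue_measure R]_(t in @timeline R) (u t%:E * (dens S t)%:E)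
   + \esum_(t in @timeline R) (u t%:E * (atom S t)%:E)
   + u +oo * mass_never%:E)%E.

End Strategies.

Record profile (R : realType) := Profile {
  accept : R -> R;  (* probability of the risky action after type-1 news *)
  stop : strategy R;
  fake : strategy R;
  accept01 : forall t, 0 <= t -> 0 <= accept t <= 1;
  accept_measurable : measurable_fun (@timeline R) accept
}.

Section Payoffs.
Context (R : realType) (E : game R) (p : profile R).

Let FA := strat_cdf (fake p).
Let FP := strat_cdf (stop p).

(* f_A and f_P occur in the arrival rates as measures; a suffix _d marks the
   density part and a suffix _m the point masses. *)
Definition w0P (s : R) : R := (1 - mu E) * g E s * (1 - sigma E * FA s).

Definition w1P_d (s : R) : R :=
  mu E * g E s * (1 - sigma E * FA s)
  + sigma E * dens (fake p) s * (1 - G E s).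

Definition w1P_m (s : R) : R := sigma E * atom (fake p) s * (1 - G E s).

Definition WP (t : R) : R := (1 - G E t) * (1 - sigma E * FA t).

(* Posterior that omega = 1 after type-1 news at time s; at an atom of F_A the
   news is real with probability 0. *)
Definition mu1 (s : R) : R :=
  if 0 < atom (fake p) s then mu E
  else (mu E * g E s * (1 - sigma E * FA s)
        + mu E * sigma E * dens (fake p) s * (1 - G E s)) / w1P_d s.

Definition newsP (s : R) : R :=
  (1 - accept p s) * theta E + accept p s * mu1 s.

Definition uP (t : \bar R) : \bar R :=
  (\int[@lebesgue_measure R]_(s in upto t)
      (expR (- (rho E * s)) * (w0P s * theta E + w1P_d s * newsP s))%:E
   + \esum_(s in upto t) (expR (- (rho E * s)) * (w1P_m s * newsP s))%:E
   + match t with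
     | EFin r => (expR (- (rho E * r)) * WP r * theta E)%:E
     | _ => 0
     end)%E.

Definition w0A (s : R) : R := (1 - mu E) * g E s * (1 - FP s).

Definition w1A (s : R) : R := mu E * g E s * (1 - FP s).

Definition wSA_d (s : R) : R := dens (stop p) s * (1 - G E s).

Definition wSA_m (s : R) : R := atom (stop p) s * (1 - G E s).

Definition WA (t : R) : R := (1 - G E t) * (1 - FP t).

Definition uA (t : \bar R) : \bar R :=
  (\int[@lebesgue_measure R]_(s in upto t)
      (expR (- (rho E * s)) *
       (w0A s * beta E
        + w1A s * ((1 - accept p s) * beta E + accept p s)
        + wSA_d s * beta E))%:E
   + \esum_(s in upto t) (expR (- (rho E * s)) * (wSA_m s * beta E))%:E
   + match t with
     | EFin r => (expR (- (rho E * r)) * WA r *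
                  ((1 - accept p r) * beta E + mu E * accept p r))%:E
     | _ => 0
     end)%E.

Definition AIC : Prop :=
  forall t t' : \bar R, (0 <= t)%E -> (0 <= t')%E ->
    active (fake p) t -> (uA t' <= uA t)%E.

(* When mu1 t = theta, any value in [0, 1] is allowed, see accept01. *)
Definition PICa : Prop :=
  forall t : R, 0 <= t ->
    (theta E < mu1 t -> accept p t = 1) /\ (mu1 t < theta E -> accept p t = 0).

Definition PICt : Prop :=
  forall t t' : \bar R, (0 <= t)%E -> (0 <= t')%E ->
    active (stop p) t -> (uP t' <= uP t)%E.

Definition equilibrium : Prop := [/\ AIC, PICa & PICt].

Definition payoffP : \bar R := expectation_of (stop p) uP.

Definition payoffA : \bar R := expectation_of (fake p) uA.

Definition beneficial_equilibrium : Prop :=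
  equilibrium /\ ((theta E)%:E < payoffP)%E.

End Payoffs.

(* Profiles are identified through the acceptance rule and the two cdfs. *)
Definition same_profile (R : realType) (p q : profile R) : Prop :=
  forall t : R, 0 <= t ->
    [/\ accept p t = accept q t,
        strat_cdf (stop p) t = strat_cdf (stop q) t &
        strat_cdf (fake p) t = strat_cdf (fake q) t].

(* Main.v *)
(* Write X = 1 - sigma F_A and Y = 1 - F_P.  Integrating the terminal payoffs by
   parts removes the atoms:
     u_P(t) = theta + int_0^t e^{-rho s} (a N - rho theta (1 - G) X) ds,
     u_A(t) = K(t) + e^{-rho t} (1 - G) Y (mu - beta) a(t),  K an integral,
   where N is the principal's gain from accepting type-1 news.  Let
   B = K + e^{-rho t} (1 - G) Y (mu - beta) be the agent's payoff from a fake
   that is surely accepted.  If news is rejected with positive probability at t,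
   then f_A(t) > 0, so the agent is indifferent at t and B(t) > max u_A.

   While the principal does not stop before tau_P, B increases wherever it is
   below a level slightly above max u_A.  So if B once exceeded max u_A it would
   do so until she stops again; news would be rejected and u_P would fall up to
   a maximiser of u_P, which is absurd.  Hence in such a gap news is accepted,
   nobody fakes, and u_P strictly increases.  Consequently the maximisers of u_P
   form an interval [tau_M, T].  There u_P' = 0 almost everywhere, which gives
   the hazard rate of F_A and makes the agent indifferent; the indifference
   B = max u_A is a linear differential equation for max u_A - K, which gives
   Y and leaves an atom of F_P at T.  The atom makes faking from T on
   suboptimal, so F_A(T) = 1, and T < tau_P would let u_P increase after T.
   Conversely, the strategies with these hazard rates are optimal. *)
Require Import Defs.
From HB Require Import structures.
From mathcomp Require Import all_boot all_order all_algebra.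
From mathcomp Require Import all_classical all_reals all_analysis.
From mathcomp Require Import measurable_realfun ring lra.

Set Implicit Arguments.
Unset Strict Implicit.
Unset Printing Implicit Defensive.

Import Order.TTheory GRing.Theory Num.Theory.
Import numFieldNormedType.Exports.

Local Open Scope classical_set_scope.
Local Open Scope ring_scope.

(** * Interval integrals and differential equations *)

(** Where the level slightly above max u_A comes from: while the principal does not stop, B has
    derivative e^{-rho s} (1 - G) Y times (beta (1 - mu) H_R - rho mu) - mu (1 - beta) H_R (1 - a).
    By (A2) the first term is at least the positive [agent_margin E] up to tau_P. Indifference makes
    B - max u_A proportional to 1 - a, so a small excess means rare rejection, too rare to reverse
    the sign. From a larger excess B may fall, but not through the level.

    The obstacle is regularity. The incentive conditions speak of pointwise values of densities,
    u_P' = 0 is known only almost everywhere, and Y may jump. Hence everything that is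
    differentiated or passed to a limit is a continuous function agreeing with the discontinuous one
    where needed: B with Y frozen at a constant, max u_A - K, and 1 - sigma F_A computed from the
    density alone.

    Atoms of F_A are harmless for u_P because the posterior there is mu < theta: such news is
    rejected, so its value to the principal is theta whatever the posterior. *)

Section IntervalIntegrals.
Context {R : realType}.
Local Notation leb := (@lebesgue_measure R).
Implicit Types (f : R -> R) (a b c t : R).

Definition loc_integrable f :=
  forall b, leb.-integrable `[0, b] (EFin \o f).

Lemma loc_integrableW f a b : 0 <= a -> loc_integrable f ->
  leb.-integrable `[a, b] (EFin \o f).
Proof.
move=> a0 /(_ b); apply: integrableS => //.
by move=> x /=; rewrite !in_itv/= => /andP[/(le_trans a0)-> ->].
Qed.

Lemma Rintegral_itv_cat f a b c : a <= b -> b <= c ->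
  leb.-integrable `[a, c] (EFin \o f) ->
  \int[leb]_(x in `[a, c]) f x =
  \int[leb]_(x in `[a, b]) f x + \int[leb]_(x in `[b, c]) f x.
Proof.
move=> ab bc intf.
rewrite -(@Rintegral_itv_obnd_cbnd R b); last first.
  apply: integrableS intf => //; apply: subset_itvr; rewrite bnd_simp.
  by rewrite ab.
by rewrite -(@Rintegral_itvB _ _ (BLeft a) (BRight c) b)//; ring.
Qed.

Lemma Rintegral0_itv_cat f a b : 0 <= a -> a <= b -> loc_integrable f ->
  \int[leb]_(x in `[0, b]) f x =
  \int[leb]_(x in `[0, a]) f x + \int[leb]_(x in `[a, b]) f x.
Proof. by move=> *; exact: Rintegral_itv_cat. Qed.

Lemma continuous_Rintegral0 f : loc_integrable f ->
  continuous (fun t => \int[leb]_(x in `[0, t]) f x).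
Proof.
move=> lf t.
(* Extension by 0 lets the integral start at some a < 0, so that every t, also t <= 0, is interior
   to [[a, b]]. *)
pose f0 : R -> R := f \_ `[0, +oo[.
pose a := Num.min 0 t - 1; pose b := Num.max 0 t + 1.
have a0 : a < 0 by rewrite /a; case: (lerP 0 t) => h; lra.
have at_ : a < t by rewrite /a; case: (lerP 0 t) => h; lra.
have tb : t < b by rewrite /b; case: (lerP 0 t) => h; lra.
have E x : \int[leb]_(y in `[0, x]) f y = \int[leb]_(y in `[a, x]) f0 y.
  rewrite /f0 -Rintegral_mkcondr; congr (Rintegral _ _ _).
  apply/seteqP; split => y /=; rewrite !in_itv/= ?andbT.
    by move=> /andP[y0 ->]; rewrite y0 (le_trans (ltW a0) y0).
  by move=> [/andP[_ ->] ->].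
under [X in continuous_at _ X]eq_fun do rewrite E.
have intf0 : leb.-integrable `[a, b] (EFin \o f0).
  rewrite /f0 -restrict_EFin; apply/integrable_restrict => //.
  apply: integrableS (lf b) => //; first exact: measurableI.
  by move=> y /= [] /=; rewrite !in_itv/= andbT => /andP[_ ->] ->.
have ab : a <= b by rewrite (ltW (lt_trans at_ tb)).
have /continuous_within_itvP := parameterized_integral_continuous ab intf0.
move=> /(_ (lt_trans at_ tb))[+ _ _]; apply.
by rewrite in_itv/= at_ tb.
Qed.

(** A zero integral would make f vanish almost everywhere on []a, b[], an interval of positive
    length. *)
Lemma Rintegral_itv_gt0 f a b : a < b ->
  leb.-integrable `[a, b] (EFin \o f) ->
  (forall x, a < x < b -> 0 < f x) -> 0 < \int[leb]_(x in `[a, b]) f x.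
Proof.
move=> ab intf f0.
have intfo : leb.-integrable `]a, b[ (EFin \o f).
  by apply: integrableS intf => //; exact: subset_itv_oo_cc.
have -> : \int[leb]_(x in `[a, b]) f x = \int[leb]_(x in `]a, b[) f x.
  rewrite -Rintegral_itv_obnd_cbnd ?Rintegral_itv_bndo_bndc//.
  by apply: integrableS intf => //; apply: subset_itvr; rewrite bnd_simp.
have ge0 : 0 <= \int[leb]_(x in `]a, b[) f x.
  by apply: Rintegral_ge0 => x /=; rewrite in_itv/= => /f0/ltW.
rewrite lt0r ge0 andbT; apply/eqP => I0.
have /integrableP[mf _] := intfo.
have : (\int[leb]_(x in `]a, b[) `|(f x)%:E| = 0)%E.
  rewrite -[0%E]/(0%R%:E) -I0 fineK ?integrable_fin_num//.
  apply: eq_integral => x /[!inE]/=; rewrite in_itv/= => /f0/ltW fx.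
  by rewrite ger0_norm.
move/(ae_eq_integral_abs leb) => /(_ (measurable_itv _) mf) [N [mN N0 sN]].
have : (leb `]a, b[ <= leb N)%E.
  apply: le_measure => //; rewrite ?inE//.
  move=> x /= xab; apply: sN => /= /(_ xab) /eqP.
  by move: xab; rewrite in_itv/= => /f0; rewrite eqe => /gt_eqF->.
by rewrite N0 lebesgue_measure_itv/= lte_fin ab -EFinD lee_fin subr_le0 leNgt ab.
Qed.

Lemma ae_in_itv (P : R -> Prop) a b : a < b -> {ae leb, forall x, P x} ->
  exists2 x, a < x < b & P x.
Proof.
move=> ab [N [mN N0 sN]]; apply: contrapT => nP.
have : (leb `]a, b[ <= leb N)%E.
  apply: le_measure => //; rewrite ?inE//.
  move=> x /=; rewrite in_itv/= => xab; apply: sN => /= Px.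
  by apply: nP; exists x.
by rewrite N0 lebesgue_measure_itv/= lte_fin ab -EFinD lee_fin subr_le0 leNgt ab.
Qed.

Lemma ae_eq_Rintegral f1 f2 a b :
  leb.-integrable `[a, b] (EFin \o f1) -> measurable_fun `[a, b] f2 ->
  {ae leb, forall x, a < x < b -> f1 x = f2 x} ->
  \int[leb]_(x in `[a, b]) f1 x = \int[leb]_(x in `[a, b]) f2 x.
Proof.
move=> /integrableP[/measurable_EFinP m1 _] m2 ae12.
have mS f (A : set R) : measurable A -> A `<=` `[a, b] ->
    measurable_fun `[a, b] f -> measurable_fun A (EFin \o f).
  by move=> mA sA mf; apply/measurable_EFinP; exact: measurable_funS mf.
have sub1 : `]a, b] `<=` `[a, b]%classic by apply: subset_itvr; rewrite bnd_simp.
have sub2 : `]a, b[ `<=` `[a, b]%classic by exact: subset_itv_oo_cc.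
rewrite /Rintegral -!(integral_itv_obnd_cbnd (r := a)) -?integral_itv_bndo_bndc//.
- congr fine; apply: ae_eq_integral => //; [exact: mS|exact: mS|].
  move: ae12; apply: filterS; first exact: (ae_filter_ringOfSetsType leb).
  by move=> x + xab; rewrite /= in_itv/= in xab; move=> /(_ xab)->.
- exact: mS.
- exact: mS.
- exact: mS.
- exact: mS.
Qed.

(** Lebesgue differentiation: f is almost everywhere the derivative of its integral, which is
    locally constant here. *)
Lemma const_Rintegral_ae0 f a b c : 0 <= a -> loc_integrable f ->
  (forall t, a < t < b -> \int[leb]_(x in `[0, t]) f x = c) ->
  {ae leb, forall x, a < x < b -> f x = 0}.
Proof.
move=> a0 lf cst.
pose f0 : R -> R := f \_ `[0, b].
have intf0 A : measurable A -> leb.-integrable A (EFin \o f0).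
  move=> mA; rewrite /f0 -restrict_EFin.
  apply/integrable_restrict => //; apply: integrableS (lf b) => //.
  exact: measurableI.
have := @FTC1 R f0 (BLeft 0) (fun y => intf0 _ (measurable_itv _))
  (integrable_locally (measurable_itv _) (lf b)).
apply: filterS; first exact: (ae_filter_ringOfSetsType leb).
move=> x H /andP[ax xb].
have [|_] := H; first by rewrite /= lte_fin (le_lt_trans a0).
rewrite /f0 patchE mem_set/=; last first.
  by rewrite in_itv/= (le_trans a0 (ltW ax)) (ltW xb).
move=> <-; rewrite derive1E.
rewrite (@near_eq_derive _ _ _ _ (fun=> c)) ?derive_cst ?oner_neq0//.
near=> y.
have yab : a < y < b.
  by apply/andP; split; near: y; [exact: lt_nbhsr|exact: lt_nbhsl].
rewrite -(cst y)//; apply: eq_Rintegral => z; rewrite inE/= in_itv/= => /andP[z0 zy].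
rewrite patchE mem_set//= in_itv/= z0 (le_trans zy)//.
by case/andP: yab => _ /ltW.
Unshelve. all: by end_near. Qed.

End IntervalIntegrals.

(** * Extremal times of continuous functions and linear differential equations *)

Section OrdinaryAnalysis.
Context {R : realType}.
Local Notation leb := (@lebesgue_measure R).
Implicit Types (f c q : R -> R) (a b t m : R).

(** By continuity the supremum of the times where f is at least m is itself such a time. Together
    with [first_ge] this delimits maximal intervals on which f stays below m. *)
Lemma last_ge f a b m : a <= b -> continuous f -> m <= f a -> f b < m ->
  exists s, [/\ a <= s < b, m <= f s & forall x, s < x <= b -> f x < m].
Proof.
move=> ab cf fa fb.
pose S := [set x | a <= x <= b /\ m <= f x].
have Sa : S a by split => //; rewrite lexx ab.
have hU : has_ubound S by exists b => x [/andP[]].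
have hS : has_sup S by split => //; exists a.
pose s := sup S.
have as_ : a <= s by exact: ub_le_sup.
have sb : s <= b by apply: ge_sup; [exists a|move=> x [/andP[]]].
have fs : m <= f s.
  rewrite leNgt; apply/negP => fsm.
  have /nbhs_ballP[d /= d0 Hd] : \forall x \near s, f x < m.
    exact: (cvgr_lt (f s) (cf s) _ fsm).
  have [x [/andP[ax xb] mx] sx] := sup_adherent d0 hS.
  have xs : x <= s by apply: ub_le_sup => //; split => //; rewrite ax xb.
  have /Hd : ball s d x.
    by rewrite /ball/= ger0_norm ?subr_ge0// ltrBlDr -ltrBlDl.
  by rewrite ltNge mx.
exists s; split => //.
  rewrite as_/= lt_neqAle sb andbT; apply: contraTneq fb => <-.
  by rewrite -leNgt.
move=> x /andP[sx xb]; rewrite ltNge; apply/negP => mx.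
have : x <= s by apply: ub_le_sup => //; split => //; rewrite xb (ltW (le_lt_trans as_ sx)).
by rewrite leNgt sx.
Qed.

Lemma first_ge f a b m : a <= b -> continuous f -> f a < m -> m <= f b ->
  exists s, [/\ a < s <= b, m <= f s & forall x, a <= x < s -> f x < m].
Proof.
move=> ab cf fa fb.
have cf' : continuous (fun x => f (- x)).
  by move=> x; apply: continuous_comp; [exact: opp_continuous|exact: cf].
have [|||s [/andP[bs sa] ms H]] := @last_ge (fun x => f (- x)) (- b) (- a) m _ cf'.
- by rewrite lerN2.
- by rewrite opprK.
- by rewrite opprK.
exists (- s); split => //; first by rewrite ltrNr sa/= lerNl.
by move=> x /andP[ax xs]; rewrite -(opprK x); apply: H; rewrite ltrNr xs lerN2.
Qed.

Lemma within_continuousM (A : set R) f q : {within A, continuous f} ->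
  {within A, continuous q} -> {within A, continuous (fun x => f x * q x)}.
Proof. by move=> cf cq x; exact: cvgM (cf x) (cq x). Qed.

Lemma within_continuousV (A : set R) f : (forall x, A x -> f x != 0) ->
  {within A, continuous f} -> {within A, continuous (fun x => (f x)^-1)}.
Proof.
move=> f0 /subspace_continuousP cf; apply/subspace_continuousP => x Ax.
by apply: cvgV; [exact: f0|exact: cf].
Qed.

Lemma within_continuous_gt0 f t : {within `[0, +oo[, continuous f} -> 0 < t ->
  {for t, continuous f}.
Proof.
by move=> /continuous_within_itvcyP[+ _] t0; apply; rewrite in_itv/= t0.
Qed.

Lemma within_continuous_integrable f a b : 0 <= a ->
  {within `[0, +oo[, continuous f} -> leb.-integrable `[a, b] (EFin \o f).
Proof.
move=> a0 cf; apply: continuous_compact_integrable; first exact: segment_compact.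
apply: continuous_subspaceW cf => x /=; rewrite !in_itv/= andbT => /andP[+ _].
exact: le_trans.
Qed.

Lemma within_continuous_loc_integrable f :
  {within `[0, +oo[, continuous f} -> loc_integrable f.
Proof. by move=> cf b; exact: within_continuous_integrable. Qed.

Lemma is_derive_Rintegral0 f t : {within `[0, +oo[, continuous f} -> 0 < t ->
  is_derive t 1 (fun x => \int[leb]_(y in `[0, x]) f y) (f t).
Proof.
move=> cf t0.
have [dF F'] := @continuous_FTC1_closed R f 0 t (t + 1) (ltr_pwDr ltr01 (lexx t))
  (within_continuous_integrable _ (lexx 0) cf) t0 (within_continuous_gt0 cf t0).
by split; [exact: dF|rewrite -derive1E].
Qed.

Lemma is_derive0_const f a b : a <= b -> continuous f ->
  (forall t, a < t < b -> is_derive t 1 f 0) -> f b = f a.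
Proof.
move=> ab cf df; apply/eqP; rewrite -subr_eq0; apply/eqP.
have df' x : x \in `]a, b[ -> is_derive x 1 f 0 by rewrite in_itv/= => /df.
have [x _ ->] := MVT_segment ab df' (continuous_subspaceT cf).
by rewrite mul0r.
Qed.

(** Integrating factor: q times the exponential of a primitive of c has derivative 0. Only an
    integral equation is assumed, since the solutions arise as integrals of measurable drifts; the
    equation itself makes q differentiable. *)
Lemma linear_ode c q a b : 0 <= a -> {within `[0, +oo[, continuous c} ->
  continuous q ->
  (forall t, a <= t <= b -> q t = q a - \int[leb]_(x in `[a, t]) (c x * q x)) ->
  forall t, a <= t <= b -> q t = q a * expR (- \int[leb]_(x in `[a, t]) c x).
Proof.
move=> a0 cc cq qE t /andP[at_ tb].
have ccq : {within `[0, +oo[, continuous (fun x => c x * q x)}.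
  exact: within_continuousM cc (continuous_subspaceT cq).
have lc := within_continuous_loc_integrable cc.
have lcq := within_continuous_loc_integrable ccq.
pose C s := \int[leb]_(x in `[0, s]) c x.
pose Q s := \int[leb]_(x in `[0, s]) (c x * q x).
have -> : \int[leb]_(x in `[a, t]) c x = C t - C a.
  by rewrite /C (Rintegral0_itv_cat a0 at_ lc) addrAC subrr add0r.
suff : q t * expR (C t) = q a * expR (C a).
  move=> e; rewrite opprB expRD mulrA -e -mulrA -expRD subrr expR0 mulr1 //.
apply: (@is_derive0_const (fun s => q s * expR (C s))) => //.
  move=> x; apply: cvgM; first exact: cq.
  apply: (@continuous_comp _ _ _ C expR); last exact: continuous_expR.
  exact: continuous_Rintegral0.
move=> s /andP[as_ st].
have s0 : 0 < s by exact: le_lt_trans as_.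
have dC : is_derive s 1 C (c s) := is_derive_Rintegral0 cc s0.
have dQ : is_derive s 1 Q (c s * q s) := is_derive_Rintegral0 ccq s0.
have dq : is_derive s 1 q (- (c s * q s)).
  have near_q : \forall y \near s, (q a + Q a) - Q y = q y.
    near=> y.
    have /andP[ay yb] : a < y < t.
      by apply/andP; split; near: y; [exact: lt_nbhsr|exact: lt_nbhsl].
    rewrite (qE y) ?(ltW ay)/= ?(le_trans (ltW yb) tb)//.
    by rewrite /Q (Rintegral0_itv_cat a0 (ltW ay) lcq); ring.
  apply: (near_eq_is_derive near_q).
  have := is_deriveB (is_derive_cst (q a + Q a) s 1) dQ.
  by rewrite sub0r.
have dE : is_derive s 1 (fun y => expR (C y)) (expR (C s) * c s).
  exact: is_derive1_comp.
apply: (is_derive_eq (is_deriveM dq dE)).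
by rewrite /GRing.scale/=; ring.
Unshelve. all: by end_near. Qed.

(** The integrand is minus the derivative of the exponential. This evaluates both the mass of a
    strategy with hazard rate c and the payoff that the agent accumulates against it. *)
Lemma one_sub_expR_Rintegral c a t : 0 <= a -> a <= t ->
  {within `[0, +oo[, continuous c} ->
  \int[leb]_(x in `[a, t]) (c x * expR (- \int[leb]_(y in `[a, x]) c y)) =
  1 - expR (- \int[leb]_(x in `[a, t]) c x).
Proof.
move=> a0 at_ cc.
have lc := within_continuous_loc_integrable cc.
pose C s := \int[leb]_(x in `[0, s]) c x.
have cC : continuous C by exact: continuous_Rintegral0.
have CE x : a <= x -> \int[leb]_(y in `[a, x]) c y = C x - C a.
  by move=> ax; rewrite /C (Rintegral0_itv_cat a0 ax lc) addrAC subrr add0r.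
pose e x := expR (C a - C x).
have ce : continuous e.
  move=> x; apply: (@continuous_comp _ _ _ (fun x => C a - C x) expR); last exact: continuous_expR.
  by apply: cvgB; [exact: cvg_cst|exact: cC].
rewrite (_ : Rintegral _ _ _ = \int[leb]_(x in `[a, t]) (c x * e x)); last first.
  apply: eq_Rintegral => x; rewrite inE/= in_itv/= => /andP[ax _].
  by rewrite /e CE// opprB.
rewrite CE// opprB -/(e t).
have cce : {within `[0, +oo[, continuous (fun x => c x * e x)}.
  exact: within_continuousM cc (continuous_subspaceT ce).
pose Q s := \int[leb]_(x in `[0, s]) (c x * e x).
have lce := within_continuous_loc_integrable cce.
have -> : \int[leb]_(x in `[a, t]) (c x * e x) = Q t - Q a.
  by rewrite /Q (Rintegral0_itv_cat a0 at_ lce) addrAC subrr add0r.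
have ea : e a = 1 by rewrite /e subrr expR0.
suff : Q t + e t = Q a + e a by rewrite ea => /(canRL (addrK _))->; ring.
apply: (@is_derive0_const (fun s => Q s + e s)) => //.
  by move=> x; apply: cvgD; [exact: continuous_Rintegral0|exact: ce].
move=> s /andP[as_ _].
have s0 : 0 < s by exact: le_lt_trans as_.
have dC : is_derive s 1 C (c s) := is_derive_Rintegral0 cc s0.
have dQ : is_derive s 1 Q (c s * e s) := is_derive_Rintegral0 cce s0.
have dd : is_derive s 1 (fun y => C a - C y) (- c s).
  by have := is_deriveB (is_derive_cst (C a) s 1) dC; rewrite sub0r.
have dE : is_derive s 1 e (e s * - c s).
  exact: is_derive1_comp.
by apply: (is_derive_eq (is_deriveD dQ dE)); ring.
Qed.

End OrdinaryAnalysis.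

(** * Interchange of sums and integrals *)

Section Tonelli.
Context {R : realType}.
Local Notation leb := (@lebesgue_measure R).

(** Enumerating the countable set P turns the sum into a series, to which monotone convergence
    applies. *)
Lemma esum_integral_interchange (P D : set R) (phi : R -> R -> \bar R) :
  countable P -> measurable D ->
  (forall s, P s -> measurable_fun D (phi s)) ->
  (forall s x, P s -> D x -> (0 <= phi s x)%E) ->
  (\esum_(s in P) \int[leb]_(x in D) phi s x =
   \int[leb]_(x in D) \esum_(s in P) phi s x)%E.
Proof.
move=> /countable_bijP[B]; rewrite card_eq_sym => /card_set_bijP[e eB].
move=> mD mphi phi0.
have eP n : B n -> P (e n) by have [eF _ _] := eB; exact: eF.
rewrite (reindex_esum B P e)// esum_mkcond.
rewrite -nneseries_esumT; last first.
  move=> n; case: ifPn => // /[!inE] /eP Pn.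
  by apply: integral_ge0 => x; exact: phi0.
pose psi n x := if n \in B then phi (e n) x else 0%E.
transitivity (\sum_(n <oo) \int[leb]_(x in D) psi n x)%E.
  apply: eq_eseriesr => n _; rewrite /psi; case: ifPn => // _.
  by rewrite integral0.
rewrite -integral_nneseries//.
- apply: eq_integral => x /[!inE] Dx.
  have -> := reindex_esum B P e (phi ^~ x) eB.
  rewrite esum_mkcond (@nneseries_esumT R (psi ^~ x)) => [|n]; last first.
    by rewrite /psi; case: ifPn => // /[!inE] /eP Pn; exact: phi0.
  by apply: eq_esum => n _; rewrite /psi; case: ifPn.
- move=> n; rewrite /psi; case: (boolP (n \in B)) => [/[!inE] /eP Pn|_].
    exact: mphi.
  exact: measurable_cst.
- move=> n x Dx; rewrite /psi; case: ifPn => // /[!inE] /eP Pn.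
  exact: phi0.
Qed.

Lemma le_indic_integral (k : R -> R) (s t : R) : 0 <= s ->
  (\int[leb]_(x in `[0%R, t]) (k x * (s <= x)%R%:R)%:E =
   \int[leb]_(x in `[s, t]) (k x)%:E)%E.
Proof.
move=> s0; rewrite [RHS]integral_mkcond [LHS]integral_mkcond.
apply: eq_integral => x _; rewrite !patchE.
have -> : (x \in `[s, t]%classic) = (s <= x) && (x \in `[0, t]%classic).
  by rewrite !mem_setE !in_itv/=; case: (leP s x) => //= /(le_trans s0)->.
by case: (s <= x); case: (_ \in _); rewrite ?mulr1 ?mulr0.
Qed.

Lemma le_indic_integralr (d : R -> R) (x t : R) : x <= t ->
  (\int[leb]_(s in `[0%R, t]) (d s * (s <= x)%R%:R)%:E =
   \int[leb]_(s in `[0%R, x]) (d s)%:E)%E.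
Proof.
move=> xt; rewrite [RHS]integral_mkcond [LHS]integral_mkcond.
apply: eq_integral => s _; rewrite !patchE.
have -> : (s \in `[0, x]%classic) = (s <= x) && (s \in `[0, t]%classic).
  rewrite !mem_setE !in_itv/=; case: (leP s x) => //= [sx|]; last by rewrite andbF.
  by rewrite (le_trans sx xt).
by case: (s <= x); case: (_ \in _); rewrite ?mulr1 ?mulr0.
Qed.

Lemma measurable_le_indic d (T : measurableType d) (u v : T -> R) :
  measurable_fun setT u -> measurable_fun setT v ->
  measurable_fun setT (fun z => (u z <= v z)%R%:R : R).
Proof.
move=> mu mv; rewrite [X in measurable_fun _ X](_ : _ =
  fun z => if u z <= v z then 1 else 0 : R); last first.
  by apply/funext => z; case: (u z <= v z).
apply: measurable_fun_ifT; [exact: measurable_fun_ler|exact: measurable_cst|].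
exact: measurable_cst.
Qed.

(** Both sides integrate d(s) k(x) over the triangle 0 <= s <= x <= t. Cutting d and k off outside
    [[0, t]] gives a nonnegative measurable function on the whole plane. *)
Lemma tonelli_triangle (d k : R -> R) (t : R) :
  measurable_fun `[0, t] d -> measurable_fun `[0, t] k ->
  (forall s, 0 <= s <= t -> 0 <= d s) -> (forall s, 0 <= s <= t -> 0 <= k s) ->
  (\int[leb]_(s in `[0%R, t]) ((d s)%:E * \int[leb]_(x in `[s, t]) (k x)%:E) =
   \int[leb]_(x in `[0%R, t]) ((k x)%:E * \int[leb]_(s in `[0%R, x]) (d s)%:E))%E.
Proof.
move=> md mk d0 k0.
pose d1 : R -> R := d \_ `[0, t]; pose k1 : R -> R := k \_ `[0, t].
have d10 s : 0 <= d1 s.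
  by rewrite /d1 patchE; case: ifPn => // sI; apply: d0; rewrite mem_setE in_itv in sI.
have k10 s : 0 <= k1 s.
  by rewrite /k1 patchE; case: ifPn => // sI; apply: k0; rewrite mem_setE in_itv in sI.
have md1 : measurable_fun setT d1 by apply/(measurable_restrictT _ _).1.
have mk1 : measurable_fun setT k1 by apply/(measurable_restrictT _ _).1.
pose f (z : R * R) : \bar R := (d1 z.1 * k1 z.2 * (z.1 <= z.2)%R%:R)%:E.
have mf : measurable_fun setT f.
  apply/measurable_EFinP; apply: measurable_funM; first apply: measurable_funM.
  - exact: measurableT_comp.
  - exact: measurableT_comp.
  - exact: measurable_le_indic.
have f0 z : (0 <= f z)%E by rewrite lee_fin !mulr_ge0.
have := fubini_tonelli (m1 := leb) (m2 := leb) f mf f0.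
have -> : (\int[leb]_x \int[leb]_y f (x, y) =
    \int[leb]_(s in `[0%R, t]) ((d s)%:E * \int[leb]_(x in `[s, t]) (k x)%:E))%E.
  rewrite [RHS]integral_mkcond; apply: eq_integral => s _; rewrite patchE.
  case: ifPn => [|sI]; last first.
    by rewrite integral0_eq// => x _; rewrite /f /d1 patchE/= (negbTE sI) !mul0r.
  rewrite mem_setE in_itv/= => /andP[s0 st].
  rewrite -le_indic_integral// -ge0_integralZl//.
  - rewrite [RHS]integral_mkcond; apply: eq_integral => x _.
    have sI : s \in `[0, t]%classic by rewrite mem_setE in_itv/= s0.
    rewrite /f /d1 /k1/= !patchE sI.
    by case: ifPn => _; rewrite ?mulr0 ?mul0r// -EFinM mulrA.
  - apply/measurable_EFinP; apply: measurable_funM => //.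
    apply: (@measurable_funS _ _ _ _ setT) => //.
    by apply: measurable_le_indic => //; exact: measurable_cst.
  - by move=> x /= /[!in_itv]/= xI; rewrite lee_fin mulr_ge0// k0.
  - by rewrite lee_fin d0// s0.
have -> : (\int[leb]_y \int[leb]_x f (x, y) =
    \int[leb]_(x in `[0%R, t]) ((k x)%:E * \int[leb]_(s in `[0%R, x]) (d s)%:E))%E.
  rewrite [RHS]integral_mkcond; apply: eq_integral => x _; rewrite patchE.
  case: ifPn => [|sI]; last first.
    by rewrite integral0_eq// => s _; rewrite /f /k1 patchE/= (negbTE sI) mulr0 mul0r.
  rewrite mem_setE in_itv/= => /andP[x0 xt].
  rewrite -(le_indic_integralr _ xt)// -ge0_integralZl//.
  - rewrite [RHS]integral_mkcond; apply: eq_integral => s _.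
    have xI : x \in `[0, t]%classic by rewrite mem_setE in_itv/= x0.
    rewrite /f /d1 /k1/= !patchE xI.
    by case: ifPn => _; rewrite ?mulr0 ?mul0r// -EFinM; congr EFin; ring.
  - apply/measurable_EFinP; apply: measurable_funM => //.
    apply: (@measurable_funS _ _ _ _ setT) => //.
    by apply: measurable_le_indic => //; exact: measurable_cst.
  - by move=> s /= /[!in_itv]/= sI; rewrite lee_fin mulr_ge0// d0.
  - by rewrite lee_fin k0// x0.
by [].
Qed.

End Tonelli.

(** * Sums over arbitrary index sets *)

Section Esum.
Context {R : realType}.

Lemma ge0_esumZl (I : set R) (a : R -> \bar R) (c : R) : 0 <= c ->
  (forall i, I i -> 0 <= a i)%E ->
  (\esum_(i in I) (c%:E * a i) = c%:E * \esum_(i in I) a i)%E.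
Proof.
move=> c0 a0; rewrite esum_mkcond [in RHS]esum_mkcond.
pose b i := if i \in I then a i else 0%E.
have b0 i : (0 <= b i)%E by rewrite /b; case: ifPn => // /[!inE]; exact: a0.
rewrite (@eq_esum _ _ _ _ (fun i => c%:E * b i)%E); last first.
  by move=> i _; rewrite /b; case: ifPn => //; rewrite mule0.
(* This inequality, applied to the inverse of c and the family c * b, also yields the converse
   one. *)
have le (c' : R) (a' : R -> \bar R) : 0 <= c' -> (forall i, 0 <= a' i)%E ->
    (\esum_(i in setT) (c'%:E * a' i) <= c'%:E * \esum_(i in setT) a' i)%E.
  move=> c'0 a'0; apply: ge_ereal_sup => _ [X [finX XI] <-].
  rewrite -ge0_mule_fsumr// lee_wpmul2l//.
  by apply: ereal_sup_ubound; exists X.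
apply/eqP; rewrite eq_le le//=.
have [->|cn0] := eqVneq c 0.
  by rewrite mul0e esum_ge0// => i _; rewrite mul0e.
have {cn0}c0 : 0 < c by rewrite lt0r cn0.
have [ci0 cb0] : 0 <= c^-1 /\ forall i, (0 <= c%:E * b i)%E.
  by split; [rewrite invr_ge0 ltW|move=> i; rewrite mule_ge0// lee_fin ltW].
have := le c^-1 (fun i => c%:E * b i)%E ci0 cb0.
rewrite (@eq_esum _ _ _ _ b) => [|i _]; last first.
  by rewrite muleA -EFinM mulVf ?gt_eqF// mul1e.
move=> /(lee_wpmul2l (ltW c0 : (0 <= c%:E)%E)).
by rewrite [X in (_ <= X)%E]muleA -EFinM mulfV ?gt_eqF// mul1e.
Qed.

Lemma esum_restrict (I P : set R) (a : R -> \bar R) :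
  (forall i, I i -> ~ P i -> a i = 0%E) ->
  (\esum_(i in I) a i = \esum_(i in I `&` P) a i)%E.
Proof.
move=> a0; rewrite esum_mkcondr; apply: eq_esum => i Ii.
by case: ifPn => //; rewrite notin_setE => /(a0 _ Ii).
Qed.

Lemma le_esum_subset (I J : set R) (a : R -> \bar R) : I `<=` J ->
  (\esum_(i in I) a i <= \esum_(i in J) a i)%E.
Proof.
move=> IJ; apply: ge_ereal_sup => _ [X [finX XI] <-].
by apply: ereal_sup_ubound; exists X => //; split => // x /XI /IJ.
Qed.

End Esum.

(** * Mixed strategies *)

Section Strategies.
Context {R : realType}.
Local Notation leb := (@lebesgue_measure R).
Implicit Types (S : strategy R) (D : set R) (a b t : R).

Lemma timelineE t : timeline t = (0 <= t).
Proof. by rewrite /timeline/= in_itv/= andbT. Qed.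

Lemma itv_timeline a b : 0 <= a -> `[a, b]%classic `<=` @timeline R.
Proof.
by move=> a0 x /=; rewrite timelineE in_itv/= => /andP[/(le_trans a0)].
Qed.

Lemma measurable_timeline : measurable (@timeline R).
Proof. exact: measurable_itv. Qed.

Lemma dens_EFin_measurable S D : measurable D -> D `<=` @timeline R ->
  measurable_fun D (EFin \o dens S).
Proof.
move=> mD sD; apply/measurable_EFinP.
exact: measurable_funS measurable_timeline sD (@dens_measurable _ S).
Qed.

Lemma mass_ge0 S D : D `<=` @timeline R -> (0 <= mass S D)%E.
Proof.
move=> sD; apply: adde_ge0.
  by apply: integral_ge0 => t /sD; rewrite timelineE lee_fin => /dens_ge0.
by apply: esum_ge0 => t /sD; rewrite timelineE lee_fin => /atom_ge0.
Qed.

Lemma le_mass S D1 D2 : measurable D1 -> measurable D2 -> D1 `<=` D2 ->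
  D2 `<=` @timeline R -> (mass S D1 <= mass S D2)%E.
Proof.
move=> m1 m2 s12 s2; apply: leeD; last exact: le_esum_subset.
apply: ge0_subset_integral => //; first exact: dens_EFin_measurable.
by move=> t /s2; rewrite timelineE lee_fin => /dens_ge0.
Qed.

Lemma mass_le1_sub S D : measurable D -> D `<=` @timeline R ->
  (mass S D <= 1)%E.
Proof.
move=> mD sD; apply: le_trans (mass_le1 S).
exact: le_mass _ mD measurable_timeline sD (@subset_refl _ _).
Qed.

Lemma mass_fin_num S D : measurable D -> D `<=` @timeline R ->
  mass S D \is a fin_num.
Proof.
move=> mD sD; rewrite ge0_fin_numE ?mass_ge0//.
by apply: le_lt_trans (mass_le1_sub _ mD sD) _; rewrite ltry.
Qed.

Lemma massU S D1 D2 : measurable D1 -> measurable D2 ->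
  D1 `<=` @timeline R -> D2 `<=` @timeline R -> [disjoint D1 & D2] ->
  mass S (D1 `|` D2) = (mass S D1 + mass S D2)%E.
Proof.
move=> m1 m2 s1 s2 d12.
have s12 : D1 `|` D2 `<=` @timeline R by move=> x [/s1|/s2].
rewrite /mass ge0_integral_setU//; last 2 first.
- by apply: dens_EFin_measurable => //; exact: measurableU.
- by move=> t /s12; rewrite timelineE lee_fin => /dens_ge0.
rewrite (esumID D1 (D1 `|` D2)); last first.
  by move=> t /s12; rewrite timelineE lee_fin => /atom_ge0.
have -> : (D1 `|` D2) `&` D1 = D1 by apply/seteqP; split => x; [case|move=> ?; split; [left|]].
have -> : (D1 `|` D2) `&` ~` D1 = D2.
  move/disj_setPS : d12 => d12.
  apply/seteqP; split => x; first by move=> [[]].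
  by move=> D2x; split; [right|move=> D1x; exact: (d12 x)].
by rewrite addeACA.
Qed.

Lemma strat_cdfE S t : (strat_cdf S t)%:E = mass S `[0, t].
Proof. by rewrite fineK//; apply: mass_fin_num => //; exact: itv_timeline. Qed.

Lemma strat_cdf_ge0 S t : 0 <= strat_cdf S t.
Proof. by rewrite -lee_fin strat_cdfE mass_ge0//; exact: itv_timeline. Qed.

Lemma strat_cdf_le1 S t : strat_cdf S t <= 1.
Proof. by rewrite -lee_fin strat_cdfE mass_le1_sub//; exact: itv_timeline. Qed.

Lemma strat_cdf_nondecreasing S : {homo strat_cdf S : a b / a <= b}.
Proof.
move=> a b ab; rewrite -lee_fin !strat_cdfE le_mass//; last exact: itv_timeline.
by apply: subset_itvl; rewrite bnd_simp.
Qed.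

Lemma strat_cdf_measurable S D : measurable D -> measurable_fun D (strat_cdf S).
Proof. by move=> mD; apply: nondecreasing_measurable => //; exact: strat_cdf_nondecreasing. Qed.

Lemma dens_loc_integrable S : loc_integrable (dens S).
Proof.
move=> b; apply/integrableP; split.
  by apply: dens_EFin_measurable => //; exact: itv_timeline.
rewrite [X in (X < _)%E](_ : _ =
    \int[leb]_(t in `[0%R, b]) (dens S t)%:E)%E; last first.
  apply: eq_integral => t; rewrite inE/= in_itv/= => /andP[t0 _].
  by rewrite ger0_norm ?dens_ge0.
have : (mass S `[0%R, b] < +oo)%E.
  by rewrite -ge0_fin_numE ?mass_ge0// ?mass_fin_num//; exact: itv_timeline.
apply: le_lt_trans; rewrite /mass leeDl// esum_ge0// => t /=.
by rewrite in_itv/= lee_fin => /andP[/atom_ge0].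
Qed.

Lemma mass_inactive0 S D : D `<=` @timeline R ->
  (forall t, D t -> ~ active S t%:E) -> mass S D = 0%E.
Proof.
move=> sD na; rewrite /mass integral0_eq ?esum1 ?adde0// => t Dt; congr EFin.
- have t0 : 0 <= t by rewrite -timelineE; exact: sD.
  apply/eqP; rewrite eq_le atom_ge0// andbT leNgt; apply/negP => at0.
  by apply: (na t Dt); right.
- have t0 : 0 <= t by rewrite -timelineE; exact: sD.
  apply/eqP; rewrite eq_le dens_ge0// andbT leNgt; apply/negP => at0.
  by apply: (na t Dt); left.
Qed.

Lemma strat_cdfB S a b : 0 <= a -> a <= b ->
  (strat_cdf S b)%:E = ((strat_cdf S a)%:E + mass S `]a, b])%E.
Proof.
move=> a0 ab; rewrite !strat_cdfE.
have sub : `]a, b]%classic `<=` @timeline R.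
  move=> x /=; rewrite in_itv/= timelineE => /andP[/ltW + _].
  exact: le_trans.
rewrite -massU//; last 2 first.
- exact: itv_timeline.
- apply/disj_setPS => x [] /=; rewrite !in_itv/= => /andP[_ xa] /andP[].
  by rewrite ltNge xa.
congr mass; rewrite -itv_bndbnd_setU//= bnd_simp//.
Qed.

Lemma strat_cdf_inactive S a b : 0 <= a -> a <= b ->
  (forall t, a < t <= b -> ~ active S t%:E) -> strat_cdf S b = strat_cdf S a.
Proof.
move=> a0 ab na; apply: EFin_inj.
rewrite (strat_cdfB _ a0 ab) mass_inactive0 ?adde0// => t /=; rewrite in_itv/=.
  by move=> /andP[/ltW + _]; rewrite timelineE; exact: le_trans.
Qed.

Lemma strat_cdf_inactive0 S b :
  (forall t, 0 <= t <= b -> ~ active S t%:E) -> strat_cdf S b = 0.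
Proof.
move=> na; apply: EFin_inj.
rewrite strat_cdfE mass_inactive0//; first exact: itv_timeline.
Qed.

Lemma mass_timelineE S : (mass S (@timeline R) = (1 - mass_never S)%:E)%E.
Proof.
rewrite /mass_never subKr fineK//; apply: mass_fin_num => //.
exact: measurable_timeline.
Qed.

Lemma mass_never_ge0 S : 0 <= mass_never S.
Proof.
rewrite /mass_never subr_ge0 -lee_fin fineK.
  exact: mass_le1_sub _ measurable_timeline (@subset_refl _ _).
exact: mass_fin_num _ measurable_timeline (@subset_refl _ _).
Qed.

(** The quantifier ranges over extended times, so mass at [+oo] is excluded as well. *)
Lemma strat_cdf_inactive1 S a : 0 <= a ->
  (forall t : \bar R, (a%:E < t)%E -> ~ active S t) -> strat_cdf S a = 1.
Proof.
move=> a0 na; apply: EFin_inj.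
have n0 : mass_never S = 0.
  apply/eqP; rewrite eq_le mass_never_ge0 andbT leNgt; apply/negP => n0.
  exact: (na +oo%E (ltry _) n0).
have := mass_timelineE S; rewrite n0 subr0 => <-.
have -> : @timeline R = `[0, a] `|` `]a, +oo[.
  by rewrite /timeline (@itv_bndbnd_setU _ _ (BLeft 0) (BRight a) +oo%O)//= bnd_simp.
rewrite massU//.
- have -> : mass S `]a, +oo[ = 0%E.
    apply: mass_inactive0 => t /=; rewrite in_itv/= andbT.
      by rewrite timelineE => /ltW; exact: le_trans.
    by move=> at_; apply: (na t%:E); rewrite lte_fin.
  by rewrite adde0 strat_cdfE.
- exact: itv_timeline.
- by move=> t /=; rewrite in_itv/= timelineE andbT => /ltW; exact: le_trans.
- apply/disj_setPS => x [] /=; rewrite !in_itv/= andbT => /andP[_ xa].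
  by rewrite ltNge xa.
Qed.

Lemma strat_cdf1_never S t : 0 <= t -> strat_cdf S t = 1 -> mass_never S = 0.
Proof.
move=> t0 F1; apply/eqP; rewrite eq_le mass_never_ge0 andbT.
have : (mass S `[0%R, t] <= mass S (@timeline R))%E.
  by apply: le_mass => //; [exact: measurable_timeline|exact: itv_timeline].
by rewrite -strat_cdfE F1 mass_timelineE lee_fin lerBrDr gerDl.
Qed.

(** Without an active time the timeline has mass 0, and then [mass_never S] is 1, which makes [+oo]
    active. In equilibrium an active time supplies a maximiser of the payoff. *)
Lemma exists_active S : exists2 t : \bar R, (0 <= t)%E & active S t.
Proof.
apply: contrapT => na.
have [n0|n0] := ltP 0 (mass_never S); first by apply: na; exists +oo%E.
have := mass_timelineE S.
rewrite mass_inactive0//; last first.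
  by move=> t; rewrite timelineE => t0 at_; apply: na; exists t%:E.
case=> e; move: n0; rewrite (_ : mass_never S = 1) ?ler10//.
by rewrite -(subKr 1 (mass_never S)) -e subr0.
Qed.

Lemma strat_cdf_no_atom S t : (forall s, 0 <= s <= t -> atom S s = 0) ->
  strat_cdf S t = \int[leb]_(s in `[0, t]) dens S s.
Proof.
move=> na; rewrite /strat_cdf /mass esum1 ?adde0// => s /=; rewrite in_itv/=.
by move=> /na->.
Qed.

(** A time that is not active has zero weight pointwise, so u may be replaced by v everywhere and
    the total mass 1 factors out. *)
Lemma expectation_active_value S (u : \bar R -> \bar R) (v : R) : 0 <= v ->
  (forall t : \bar R, (0 <= t)%E -> active S t -> u t = v%:E) ->
  expectation_of S u = v%:E.
Proof.
move=> v0 uv; rewrite /expectation_of.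
rewrite (_ : (\int[leb]_(t in @timeline R) _ =
    \int[leb]_(t in @timeline R) (v%:E * (dens S t)%:E))%E); last first.
  apply: eq_integral => t; rewrite inE timelineE => t0.
  have := dens_ge0 S t0; rewrite le_eqVlt => /predU1P[<-|d0].
    by rewrite !mule0.
  by rewrite uv//; left.
rewrite (@eq_esum _ _ _ _ (fun t => v%:E * (atom S t)%:E)%E); last first.
  move=> t; rewrite timelineE => t0.
  have := atom_ge0 S t0; rewrite le_eqVlt => /predU1P[<-|d0].
    by rewrite !mule0.
  by rewrite uv//; right.
have dge0 t : timeline t -> (0 <= (dens S t)%:E)%E.
  by rewrite timelineE lee_fin => /dens_ge0.
have age0 t : timeline t -> (0 <= (atom S t)%:E)%E.
  by rewrite timelineE lee_fin => /atom_ge0.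
rewrite ge0_integralZl//; last 2 first.
- exact: measurable_timeline.
- exact: dens_EFin_measurable _ measurable_timeline (@subset_refl _ _).
rewrite ge0_esumZl// -ge0_muleDr; [|exact: integral_ge0|exact: esum_ge0].
rewrite -/(mass S (@timeline R)) mass_timelineE.
rewrite (_ : (u +oo * _)%E = (v * mass_never S)%:E).
  by rewrite -EFinM -EFinD; congr EFin; ring.
have := mass_never_ge0 S; rewrite le_eqVlt => /predU1P[<-|n0].
  by rewrite mulr0 mule0.
by rewrite uv.
Qed.

(** Stieltjes integration by parts for h with derivative -k: insert h(s) = h(t) + int_s^t k and
    exchange the order, by [tonelli_triangle] for the density and by [esum_integral_interchange] for
    the atoms. The two inner parts then add up to the cdf. *)
Lemma strat_cdf_by_parts S (h k : R -> R) t : 0 <= t ->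
  measurable_fun `[0, t] h ->
  leb.-integrable `[0, t] (EFin \o k) ->
  (forall s, 0 <= s <= t -> 0 <= k s) -> 0 <= h t ->
  (forall s, 0 <= s <= t -> h s = h t + \int[leb]_(x in `[s, t]) k x) ->
  (\int[leb]_(s in `[0%R, t]) (h s * dens S s)%:E
   + \esum_(s in `[0%R, t]) (h s * atom S s)%:E =
   (h t * strat_cdf S t + \int[leb]_(x in `[0, t]) (k x * strat_cdf S x))%:E)%E.
Proof.
move=> t0 mh ik k0 ht0 hE.
have sI : `[0, t]%classic `<=` @timeline R by exact: itv_timeline.
have /integrableP[/measurable_EFinP mk _] := ik.
have md : measurable_fun `[0, t] (dens S) by exact: measurable_funS measurable_timeline sI (@dens_measurable _ S).
have ikS s : 0 <= s -> leb.-integrable `[s, t] (EFin \o k).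
  move=> s0; apply: integrableS ik => // x /=; rewrite !in_itv/= => /andP[+ ->].
  by move=> /(le_trans s0)->.
have kap s : 0 <= s <= t -> (\int[leb]_(x in `[s, t]) (k x)%:E = (h s - h t)%:E)%E.
  move=> st; rewrite (hE s st) addrAC subrr add0r fineK//.
  by apply: integrable_fin_num => //; apply: ikS; case/andP: st.
have hh s : 0 <= s <= t -> 0 <= h s - h t.
  move=> /[dup] /andP[s0 st] /kap; rewrite -lee_fin => <-.
  apply: integral_ge0 => x /=; rewrite in_itv/= lee_fin => /andP[sx xt].
  by rewrite k0// (le_trans s0).
have It s : `[0, t]%classic s -> 0 <= s <= t by rewrite /= in_itv.
have d0 s : `[0, t]%classic s -> 0 <= dens S s.
  by move=> /It /andP[/dens_ge0].
have a0 s : `[0, t]%classic s -> 0 <= atom S s.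
  by move=> /It /andP[/atom_ge0].
have iF : leb.-integrable `[0, t] (EFin \o (fun x => k x * strat_cdf S x)).
  apply: (@eq_integrable _ _ _ leb _ _ ((EFin \o k) \* (EFin \o strat_cdf S))%E) => //.
  apply: integrableMl => //; first exact: strat_cdf_measurable.
  exists 1; split => // y y1 x _ /=; rewrite ger0_norm ?strat_cdf_ge0//.
  exact: le_trans (strat_cdf_le1 _ _) (ltW y1).
have dpart : (\int[leb]_(s in `[0%R, t]) (h s * dens S s)%:E =
    (h t)%:E * \int[leb]_(s in `[0%R, t]) (dens S s)%:E +
    \int[leb]_(x in `[0%R, t]) ((k x)%:E * \int[leb]_(s in `[0%R, x]) (dens S s)%:E))%E.
  rewrite -tonelli_triangle//.
  rewrite -ge0_integralZl//; last exact/measurable_EFinP.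
  rewrite -ge0_integralD//.
  - apply: eq_integral => s; rewrite inE => /It st.
    by rewrite (kap _ st) -!EFinM -EFinD; congr EFin; ring.
  - by move=> s /d0 ds; rewrite mule_ge0// lee_fin.
  - by apply/measurable_EFinP; exact: measurable_funM.
  - by move=> s /[dup] /d0 ds /It st; rewrite kap// mule_ge0// lee_fin// hh.
  - apply: (@eq_measurable_fun _ _ _ _ _ (fun s => (dens S s * (h s - h t))%:E)).
      by move=> s; rewrite inE => /It st; rewrite kap// EFinM.
    by apply/measurable_EFinP; apply: measurable_funM => //; exact: measurable_funB.
have fD x : 0 <= x ->
    (\int[leb]_(s in `[0%R, x]) (dens S s)%:E = (\int[leb]_(s in `[0, x]) dens S s)%:E)%E.
  by move=> x0; rewrite fineK//; apply: integrable_fin_num => //; exact: dens_loc_integrable.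
have fA x : 0 <= x -> (\esum_(s in `[0%R, x]) (atom S s)%:E =
    (strat_cdf S x - \int[leb]_(s in `[0, x]) dens S s)%:E)%E.
  by move=> x0; rewrite EFinB strat_cdfE /mass fD// addeAC subee// add0e.
have apart : (\esum_(s in `[0%R, t]) (h s * atom S s)%:E =
    (h t)%:E * (\esum_(s in `[0%R, t]) (atom S s)%:E) +
    \int[leb]_(x in `[0%R, t]) ((k x)%:E * (\esum_(s in `[0%R, x]) (atom S s)%:E)))%E.
  pose phi s x := (k x * (s <= x)%R%:R * atom S s)%:E.
  have phi0 s x : `[0, t]%classic s -> `[0, t]%classic x -> (0 <= phi s x)%E.
    by move=> /a0 as0 /It /k0 kx; rewrite lee_fin !mulr_ge0.
  have mks s : measurable_fun `[0, t] (fun x => k x * (s <= x)%R%:R).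
    apply: measurable_funM => //; apply: (@measurable_funS _ _ _ _ setT) => //.
    by apply: measurable_le_indic => //; exact: measurable_cst.
  rewrite (@eq_esum _ _ _ _ (fun s => (h t)%:E * (atom S s)%:E +
      \int[leb]_(x in `[0%R, t]) phi s x)%E); last first.
    move=> s /[dup] /[dup] /a0 as0 sI0 /It st.
    rewrite /phi; under eq_integral do rewrite EFinM muleC.
    rewrite ge0_integralZl//; last 2 first.
    - by apply/measurable_EFinP; exact: mks.
    - by move=> x /It /k0 kx; rewrite lee_fin mulr_ge0.
    rewrite le_indic_integral; last by case/andP: st.
    by rewrite kap// -!EFinM -EFinD; congr EFin; ring.
  rewrite esumD; last 2 first.
  - by move=> s /a0 as0; rewrite mule_ge0.
  - by move=> s sI0; apply: integral_ge0 => x; exact: phi0.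
  rewrite ge0_esumZl//; congr (_ + _)%E.
  (* Only countably many points carry an atom; restricted to them, the sum can be exchanged with the
     integral. *)
  pose P := [set s | 0 <= s /\ 0 < atom S s].
  have na s : `[0, t]%classic s -> ~ P s -> atom S s = 0.
    move=> /[dup] /a0 as0 /It /andP[s0 _] nP.
    by apply/eqP; rewrite eq_le as0 andbT leNgt; apply/negP => ?; exact: nP.
  rewrite (esum_restrict (P := P)); last first.
    by move=> s sI0 nPs; rewrite integral0_eq// => x _; rewrite /phi na// mulr0.
  rewrite esum_integral_interchange//.
  - apply: eq_integral => x; rewrite inE => /It /andP[x0 xt].
    rewrite -esum_restrict; last by move=> s sI0 nPs; rewrite /phi na// mulr0.
    rewrite -ge0_esumZl; last 2 first.
    + by rewrite k0// x0.
    + by move=> s; rewrite /= in_itv/= lee_fin => /andP[/atom_ge0].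
    have -> : `[0, x]%classic = `[0, t] `&` [set s | s <= x].
      apply/seteqP; split => s /=; rewrite !in_itv/=.
        by move=> /andP[-> sx]; rewrite (le_trans sx xt).
      by move=> [/andP[->]].
    rewrite esum_mkcondr; apply: eq_esum => s _; rewrite /phi.
    case: ifPn => [|]; rewrite ?notin_setE ?inE/=.
      by move=> ->; rewrite mulr1.
    by move/negP/negbTE => ->; rewrite mulr0 mul0r.
  - apply: sub_countable (atom_countable S); apply: subset_card_le.
    by move=> x [].
  - by move=> s [_ _]; apply/measurable_EFinP; exact: measurable_funM.
  - by move=> s x [sI0 _]; exact: phi0.
rewrite dpart apart addeACA -ge0_muleDr; last 2 first.
- by apply: integral_ge0 => s /d0; rewrite lee_fin.
- by apply: esum_ge0 => s /a0; rewrite lee_fin.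
rewrite -/(mass S `[0%R, t]) -strat_cdfE EFinD EFinM; congr (_ + _)%E.
pose Dt x := \int[leb]_(s in `[0, x]) dens S s.
have mDt : measurable_fun `[0, t] Dt.
  apply: (@measurable_funS _ _ _ _ setT) => //; apply: continuous_measurable_fun.
  exact: (continuous_Rintegral0 (@dens_loc_integrable S)).
rewrite -ge0_integralD//; last 4 first.
- move=> x /[dup] xI /It /k0 kx; rewrite mule_ge0// integral_ge0// => s /=.
  by rewrite in_itv/= lee_fin => /andP[/dens_ge0].
- apply: (@eq_measurable_fun _ _ _ _ _ (fun x => (k x * Dt x)%:E)).
    by move=> x; rewrite inE => /It /andP[x0 _]; rewrite fD.
  by apply/measurable_EFinP; exact: measurable_funM.
- move=> x /[dup] xI /It /k0 kx; rewrite mule_ge0// esum_ge0// => s /=.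
  by rewrite in_itv/= lee_fin => /andP[/atom_ge0].
- apply: (@eq_measurable_fun _ _ _ _ _ (fun x => (k x * (strat_cdf S x - Dt x))%:E)).
    by move=> x; rewrite inE => /It /andP[x0 _]; rewrite fA.
  apply/measurable_EFinP; apply: measurable_funM => //.
  by apply: measurable_funB => //; exact: strat_cdf_measurable.
rewrite fineK; last exact: integrable_fin_num.
apply: eq_integral => x; rewrite inE => /It /andP[x0 _].
by rewrite fD// fA// -!EFinM -EFinD; congr EFin; ring.
Qed.

End Strategies.

(** * Local integrability on the half line *)

Section LocIntegrable.
Context {R : realType}.
Local Notation leb := (@lebesgue_measure R).
Implicit Types f b : R -> R.

Lemma loc_integrable_measurable f (t : R) : loc_integrable f -> measurable_fun `[0, t] f.
Proof. by move=> /(_ t)/integrableP[/measurable_EFinP]. Qed.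

Lemma loc_integrableD f b : loc_integrable f -> loc_integrable b ->
  loc_integrable (fun x => f x + b x).
Proof. by move=> lf lb t; exact: (integrableD _ (lf t) (lb t)). Qed.

Lemma loc_integrableB f b : loc_integrable f -> loc_integrable b ->
  loc_integrable (fun x => f x - b x).
Proof. by move=> lf lb t; exact: (integrableB _ (lf t) (lb t)). Qed.

Lemma loc_integrableZ f (c : R) : loc_integrable f -> loc_integrable (fun x => c * f x).
Proof. by move=> lf t; exact: (integrableZl _ _ (lf t)). Qed.

Lemma loc_integrableM f b (M : R) : loc_integrable f ->
  measurable_fun (@timeline R) b -> (forall t, 0 <= t -> `|b t| <= M) ->
  loc_integrable (fun x => f x * b x).
Proof.
move=> lf mb bM t.
apply: (@eq_integrable _ _ _ leb _ _ ((EFin \o f) \* (EFin \o b))%E) => //.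
apply: integrableMl => //.
  apply: measurable_funS mb => //; first exact: measurable_timeline.
  exact: itv_timeline.
exists M; split; [exact: num_real|] => // y My x; rewrite /= in_itv/= => /andP[x0 _].
exact: le_trans (bM _ x0) (ltW My).
Qed.

End LocIntegrable.

(** * Payoffs in integral form *)

Record regular_game (R : realType) (E : game R) : Prop := RegularGame {
  rg_theta : 0 < theta E < 1;
  rg_beta : 0 < beta E < theta E;
  rg_mu : beta E < mu E < theta E;
  rg_rho : 0 < rho E;
  rg_sigma : 0 < sigma E < 1;
  rg_g_ge0 : forall t : R, 0 <= t -> 0 <= g E t;
  rg_g_continuous : {within `[0, +oo[, continuous (g E)};
  rg_G_lt1 : forall t : R, 0 <= t -> G E t < 1;
  rg_HR_decreasing : forall s t : R, 0 <= s -> s < t -> HR E t < HR E s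
}.

(** * Discounted probability that no real news has arrived *)

Section Primitives.
Context {R : realType} (E : game R) (EP : regular_game E).
Local Notation leb := (@lebesgue_measure R).

Let rho_gt0 := rg_rho EP.
Let g_ge0 := rg_g_ge0 EP.
Let g_continuous := rg_g_continuous EP.
Let G_lt1 := rg_G_lt1 EP.
Let HR_decreasing := rg_HR_decreasing EP.

Definition disc_surv (t : R) : R := expR (- (rho E * t)) * (1 - G E t).

(** Minus the derivative of [disc_surv], see [disc_survE]. *)
Definition disc_hazard (t : R) : R :=
  expR (- (rho E * t)) * (g E t + rho E * (1 - G E t)).

Lemma g_loc_integrable : loc_integrable (g E).
Proof. exact: within_continuous_loc_integrable. Qed.

Lemma G_continuous : continuous (G E).
Proof. exact: (continuous_Rintegral0 g_loc_integrable). Qed.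

Lemma G0 : G E 0 = 0.
Proof. by rewrite /G set_itv1 Rintegral_set1. Qed.

Lemma G_ge0 t : 0 <= G E t.
Proof.
by apply: Rintegral_ge0 => x /=; rewrite in_itv/= => /andP[/g_ge0].
Qed.

Lemma survival_gt0 t : 0 <= t -> 0 < 1 - G E t.
Proof. by move=> /G_lt1; rewrite subr_gt0. Qed.

(** Strict monotonicity puts [HR E t] above [HR E (t + 1)], which is a quotient of nonnegative
    numbers. *)
Lemma HR_gt0 t : 0 <= t -> 0 < HR E t.
Proof.
move=> t0; have t1 : 0 <= t + 1 by rewrite addr_ge0.
apply: le_lt_trans (HR_decreasing t0 (ltr_pwDr ltr01 (lexx t))).
by rewrite divr_ge0 ?g_ge0// ltW// survival_gt0.
Qed.

Lemma gE t : 0 <= t -> g E t = HR E t * (1 - G E t).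
Proof. by move=> t0; rewrite /HR divfK// gt_eqF// survival_gt0. Qed.

Lemma g_gt0 t : 0 <= t -> 0 < g E t.
Proof. by move=> t0; rewrite gE// mulr_gt0 ?HR_gt0 ?survival_gt0. Qed.

Lemma discount_continuous : continuous (fun t : R => expR (- (rho E * t))).
Proof.
move=> t; apply: (@continuous_comp _ _ _ (fun t => - (rho E * t)) expR).
  by apply: cvgN; apply: cvgM; [exact: cvg_cst|exact: cvg_id].
exact: continuous_expR.
Qed.

Lemma survival_continuous : continuous (fun t => 1 - G E t).
Proof. by move=> t; apply: cvgB; [exact: cvg_cst|exact: G_continuous]. Qed.

Lemma disc_surv_continuous : continuous disc_surv.
Proof.
by move=> t; apply: cvgM; [exact: discount_continuous|exact: survival_continuous].
Qed.

Lemma disc_surv_gt0 t : 0 <= t -> 0 < disc_surv t.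
Proof. by move=> t0; rewrite mulr_gt0 ?expR_gt0 ?survival_gt0. Qed.

Lemma disc_surv0 : disc_surv 0 = 1.
Proof. by rewrite /disc_surv G0 subr0 mulr1 mulr0 oppr0 expR0. Qed.

Lemma HR_continuous : {within `[0, +oo[, continuous (HR E)}.
Proof.
apply: within_continuousM => //; apply: within_continuousV.
  by move=> x; rewrite /= in_itv/= andbT => x0; rewrite gt_eqF// survival_gt0.
exact/continuous_subspaceT/survival_continuous.
Qed.

Lemma disc_hazard_continuous : {within `[0, +oo[, continuous disc_hazard}.
Proof.
apply: within_continuousM; first exact/continuous_subspaceT/discount_continuous.
have : {within `[0, +oo[, continuous (fun x => rho E * (1 - G E x))}.
  apply: continuous_subspaceT => x.
  by apply: cvgM; [exact: cvg_cst|exact: survival_continuous].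
by move=> c; exact: (within_continuousD g_continuous c).
Qed.

Lemma disc_hazard_ge0 t : 0 <= t -> 0 <= disc_hazard t.
Proof.
move=> t0; rewrite mulr_ge0 ?expR_ge0// addr_ge0 ?g_ge0//.
by rewrite mulr_ge0// ltW// survival_gt0.
Qed.

Lemma disc_hazard_loc_integrable : loc_integrable disc_hazard.
Proof. exact: within_continuous_loc_integrable disc_hazard_continuous. Qed.

Lemma disc_survE t : 0 <= t ->
  disc_surv t = 1 - \int[leb]_(x in `[0, t]) disc_hazard x.
Proof.
move=> t0; apply/eqP; rewrite eq_sym subr_eq; apply/eqP.
have -> : 1 = disc_surv 0 + \int[leb]_(x in `[0, 0]) disc_hazard x.
  by rewrite disc_surv0 set_itv1 Rintegral_set1 addr0.
apply/esym; apply: (@is_derive0_const _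
  (fun t => disc_surv t + \int[leb]_(x in `[0, t]) disc_hazard x)) => //.
  move=> s; apply: cvgD; first exact: disc_surv_continuous.
  exact: (continuous_Rintegral0 disc_hazard_loc_integrable).
move=> s /andP[s0 _].
have dK := is_derive_Rintegral0 disc_hazard_continuous s0.
have dG : is_derive s 1 (G E) (g E s) := is_derive_Rintegral0 g_continuous s0.
have dl : is_derive s 1 (fun t => - (rho E * t)) (- (rho E * 1)).
  by apply: is_deriveN; exact: (is_deriveZ (rho E) (is_derive_id s 1)).
have de : is_derive s 1 (fun t => expR (- (rho E * t)))
  (expR (- (rho E * s)) * - (rho E * 1)) by exact: is_derive1_comp.
have d1 : is_derive s 1 (fun t => 1 - G E t) (0 - g E s).
  by have := is_deriveB (is_derive_cst (1 : R) s 1) dG; rewrite !sub0r.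
apply: (is_derive_eq (is_deriveD (is_deriveM de d1) dK)).
by rewrite /disc_hazard /GRing.scale/=; ring.
Qed.

Lemma disc_survB s t : 0 <= s -> s <= t ->
  disc_surv s = disc_surv t + \int[leb]_(x in `[s, t]) disc_hazard x.
Proof.
move=> s0 st; rewrite !disc_survE ?(le_trans s0)//.
rewrite (Rintegral0_itv_cat s0 st disc_hazard_loc_integrable); ring.
Qed.

Lemma discount_le1 t : 0 <= t -> `|expR (- (rho E * t))| <= 1.
Proof.
by move=> t0; rewrite ger0_norm ?expR_ge0// expR_le1 oppr_le0 mulr_ge0// ltW.
Qed.

Lemma discount_measurable D : measurable D ->
  measurable_fun D (fun t : R => expR (- (rho E * t))).
Proof.
move=> mD; apply: (@measurable_funS _ _ _ _ setT) => //.
exact: continuous_measurable_fun discount_continuous.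
Qed.

Lemma survival_measurable D : measurable D -> measurable_fun D (fun t => 1 - G E t).
Proof.
move=> mD; apply: (@measurable_funS _ _ _ _ setT) => //.
exact: continuous_measurable_fun survival_continuous.
Qed.

Lemma survival_le1 t : 0 <= t -> `|1 - G E t| <= 1.
Proof.
move=> t0; rewrite ger0_norm; last by rewrite ltW// survival_gt0.
by rewrite gerBl G_ge0.
Qed.

Lemma disc_surv_measurable D : measurable D -> measurable_fun D disc_surv.
Proof.
move=> mD; apply: (@measurable_funS _ _ _ _ setT) => //.
exact: continuous_measurable_fun disc_surv_continuous.
Qed.

Lemma disc_surv_le1 t : 0 <= t -> `|disc_surv t| <= 1.
Proof.
by move=> t0; rewrite normrM mulr_ile1 ?discount_le1 ?survival_le1.
Qed.

Lemma dens_disc_by_parts S t : 0 <= t ->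
  (\int[leb]_(s in `[0%R, t]) (disc_surv s * dens S s)%:E
   + \esum_(s in `[0%R, t]) (disc_surv s * atom S s)%:E =
   (disc_surv t * strat_cdf S t
    + \int[leb]_(x in `[0, t]) (disc_hazard x * strat_cdf S x))%:E)%E.
Proof.
move=> t0; apply: strat_cdf_by_parts => //.
- exact: disc_surv_measurable.
- exact: disc_hazard_loc_integrable.
- by move=> s /andP[s0 _]; exact: disc_hazard_ge0.
- by rewrite ltW// disc_surv_gt0.
- by move=> s /andP[s0 st]; exact: disc_survB.
Qed.

Lemma affine_HR_continuous (u v w : R) :
  {within `[0, +oo[, continuous (fun x => (u * HR E x - v) / w)}.
Proof.
have cst (k : R) : {within `[0, +oo[, continuous ((fun=> k) : R -> R)}.
  by apply: continuous_subspaceT => x; exact: cvg_cst.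
apply: within_continuousM (cst _).
exact: (within_continuousB (within_continuousM (cst u) HR_continuous) (cst v)).
Qed.

Lemma hazard_rate_continuous : {within `[0, +oo[, continuous (fun x => rho E + HR E x)}.
Proof.
have cst : {within `[0, +oo[, continuous ((fun=> rho E) : R -> R)}.
  by apply: continuous_subspaceT => x; exact: cvg_cst.
exact: within_continuousD cst HR_continuous.
Qed.

(** In this form the rates of discounting, of real news and of stopping can be added and subtracted
    in one exponent. *)
Lemma disc_surv_expE s t : 0 <= s -> s <= t ->
  disc_surv t = disc_surv s * expR (- \int[leb]_(x in `[s, t]) (rho E + HR E x)).
Proof.
move=> s0 st.
apply: (linear_ode s0 hazard_rate_continuous disc_surv_continuous (b := t)); last by rewrite st lexx.
move=> u /andP[su _]; rewrite (disc_survB s0 su).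
rewrite (_ : \int[leb]_(x in `[s, u]) ((rho E + HR E x) * disc_surv x) =
  \int[leb]_(x in `[s, u]) disc_hazard x); first by rewrite addrK.
apply: eq_Rintegral => x; rewrite inE/= in_itv/= => /andP[sx _].
rewrite /disc_hazard (gE (le_trans s0 sx)) /disc_surv; ring.
Qed.

End Primitives.

(** * Drifts of the two payoffs and cancellation of the atoms *)

Section Payoffs.
Context {R : realType} (E : game R) (EP : regular_game E) (p : profile R).
Local Notation leb := (@lebesgue_measure R).
Implicit Types s t : R.

(** [survA] and [survP] are X and Y of the overview. *)
Definition survA t := 1 - sigma E * strat_cdf (fake p) t.
Definition survP t := 1 - strat_cdf (stop p) t.

(* [w1P_d * (mu1 - theta)] away from the atoms, see [mu1_no_atom] *)
Definition news_gain s :=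
  mu E * (1 - theta E) * g E s * survA s
  - (theta E - mu E) * sigma E * dens (fake p) s * (1 - G E s).

Definition drift_P s := expR (- (rho E * s)) *
  (accept p s * news_gain s - rho E * theta E * (1 - G E s) * survA s).

Definition value_P t := theta E + \int[leb]_(s in `[0, t]) drift_P s.

Definition drift_A s := expR (- (rho E * s)) *
  (mu E * (1 - beta E) * accept p s * g E s * survP s
   - rho E * beta E * (1 - G E s) * survP s).

(** K of the overview. *)
Definition value_A t := beta E + \int[leb]_(s in `[0, t]) drift_A s.

(** With positive probability the agent is not manipulative, so X stays positive even where F_A is
    1. *)
Lemma survA_gt0 t : 0 < survA t.
Proof.
have /andP[s0 s1] := rg_sigma EP.
rewrite subr_gt0 (le_lt_trans _ s1)// ler_piMr ?strat_cdf_le1//.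
exact: ltW.
Qed.

Lemma survA_le1 t : survA t <= 1.
Proof.
have /andP[/ltW s0 _] := rg_sigma EP.
by rewrite gerBl mulr_ge0// strat_cdf_ge0.
Qed.

Lemma survP_ge0 t : 0 <= survP t.
Proof. by rewrite subr_ge0 strat_cdf_le1. Qed.

Lemma survP_le1 t : survP t <= 1.
Proof. by rewrite gerBl strat_cdf_ge0. Qed.

Lemma survA_measurable D : measurable D -> measurable_fun D survA.
Proof.
move=> mD; apply: measurable_funB; first exact: measurable_cst.
by apply: measurable_funM; [exact: measurable_cst|exact: strat_cdf_measurable].
Qed.

Lemma survP_measurable D : measurable D -> measurable_fun D survP.
Proof.
by move=> mD; apply: measurable_funB; [exact: measurable_cst|exact: strat_cdf_measurable].
Qed.

Lemma survA_norm t : 0 <= t -> `|survA t| <= 1.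
Proof. by move=> _; rewrite ger0_norm ?survA_le1// ltW// survA_gt0. Qed.

Lemma survP_norm t : 0 <= t -> `|survP t| <= 1.
Proof. by move=> _; rewrite ger0_norm ?survP_le1 ?survP_ge0. Qed.

Lemma accept_norm t : 0 <= t -> `|accept p t| <= 1.
Proof. by move=> /(accept01 p)/andP[a0 a1]; rewrite ger0_norm. Qed.

Let disc_measurable := discount_measurable E measurable_timeline.
Let surv_measurable := survival_measurable EP measurable_timeline.

Lemma news_gain_loc_integrable : loc_integrable news_gain.
Proof.
apply: loc_integrableB.
  apply: (loc_integrableM (M := 1)) (survA_measurable measurable_timeline) survA_norm.
  exact/loc_integrableZ/(g_loc_integrable EP).
apply: (loc_integrableM (M := 1)) surv_measurable (survival_le1 EP).
exact/loc_integrableZ/dens_loc_integrable.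
Qed.

Lemma one_loc_integrable : loc_integrable (fun=> 1 : R).
Proof. by apply: within_continuous_loc_integrable => x; exact: cvg_cst. Qed.

Lemma drift_P_loc_integrable : loc_integrable drift_P.
Proof.
rewrite /drift_P; under eq_fun do rewrite mulrC.
apply: (loc_integrableM (M := 1)) disc_measurable (discount_le1 EP).
apply: loc_integrableB.
  under eq_fun do rewrite mulrC.
  exact: (loc_integrableM (M := 1)) news_gain_loc_integrable (@accept_measurable _ p) accept_norm.
apply: (loc_integrableM (M := 1)) (survA_measurable measurable_timeline) survA_norm.
apply: (loc_integrableM (M := 1)) surv_measurable (survival_le1 EP).
under eq_fun do rewrite -[_ * _]mulr1.
exact/loc_integrableZ/one_loc_integrable.
Qed.

Lemma drift_A_loc_integrable : loc_integrable drift_A.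
Proof.
rewrite /drift_A; under eq_fun do rewrite mulrC.
apply: (loc_integrableM (M := 1)) disc_measurable (discount_le1 EP).
apply: loc_integrableB.
  apply: (loc_integrableM (M := 1)) (survP_measurable measurable_timeline) survP_norm.
  under eq_fun do rewrite mulrAC.
  apply: (loc_integrableM (M := 1)) (@accept_measurable _ p) accept_norm.
  exact/loc_integrableZ/(g_loc_integrable EP).
apply: (loc_integrableM (M := 1)) (survP_measurable measurable_timeline) survP_norm.
apply: (loc_integrableM (M := 1)) surv_measurable (survival_le1 EP).
under eq_fun do rewrite -[_ * _]mulr1.
exact/loc_integrableZ/one_loc_integrable.
Qed.

Lemma value_P_continuous : continuous value_P.
Proof.
move=> t; apply: cvgD; first exact: cvg_cst.
exact: (continuous_Rintegral0 drift_P_loc_integrable).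
Qed.

Lemma value_A_continuous : continuous value_A.
Proof.
move=> t; apply: cvgD; first exact: cvg_cst.
exact: (continuous_Rintegral0 drift_A_loc_integrable).
Qed.

Lemma value_P0 : value_P 0 = theta E.
Proof. by rewrite /value_P set_itv1 Rintegral_set1 addr0. Qed.

Lemma value_A0 : value_A 0 = beta E.
Proof. by rewrite /value_A set_itv1 Rintegral_set1 addr0. Qed.

Lemma value_PB s t : 0 <= s -> s <= t ->
  value_P t = value_P s + \int[leb]_(x in `[s, t]) drift_P x.
Proof.
move=> s0 st; rewrite /value_P (Rintegral0_itv_cat s0 st drift_P_loc_integrable).
by rewrite addrA.
Qed.

Lemma value_AB s t : 0 <= s -> s <= t ->
  value_A t = value_A s + \int[leb]_(x in `[s, t]) drift_A x.
Proof.
move=> s0 st; rewrite /value_A (Rintegral0_itv_cat s0 st drift_A_loc_integrable).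
by rewrite addrA.
Qed.

Lemma hazard_cdf_loc_integrable S :
  loc_integrable (fun x => disc_hazard E x * strat_cdf S x).
Proof.
apply: (loc_integrableM (M := 1)) (strat_cdf_measurable _ measurable_timeline) _.
  exact: disc_hazard_loc_integrable.
by move=> t _; rewrite ger0_norm ?strat_cdf_le1 ?strat_cdf_ge0.
Qed.

Lemma disc_dens_loc_integrable S :
  loc_integrable (fun s => disc_surv E s * dens S s).
Proof.
under eq_fun do rewrite mulrC.
apply: (loc_integrableM (M := 1)) (disc_surv_measurable EP measurable_timeline) (disc_surv_le1 EP).
exact: dens_loc_integrable.
Qed.

(* The atoms of [S] cancel against the jumps of the terminal payoff. *)
Lemma stopped_payoff S (c m t : R) (u v : R -> R) : 0 <= t -> loc_integrable v ->
  0 <= m ->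
  (forall s, 0 <= s <= t -> u s = m * (disc_surv E s * dens S s) + v s) ->
  (\int[leb]_(s in `[0%R, t]) (u s)%:E
   + \esum_(s in `[0%R, t]) (m * (disc_surv E s * atom S s))%:E
   + (disc_surv E t * (c - m * strat_cdf S t))%:E =
   (c + \int[leb]_(s in `[0, t])
      (v s - disc_hazard E s * (c - m * strat_cdf S s)))%:E)%E.
Proof.
move=> t0 lv m0 uE.
have ld := @disc_dens_loc_integrable S.
have lF := @hazard_cdf_loc_integrable S.
have lk := disc_hazard_loc_integrable EP.
have lZd := loc_integrableZ m ld.
have lZk := loc_integrableZ c lk.
have lZF := loc_integrableZ m lF.
have lB := loc_integrableB lZk lZF.
have lD := loc_integrableD lZd lv.
have := dens_disc_by_parts EP S t0.
set I := (\int[leb]_(s in _) _)%E.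
have -> : I = (\int[leb]_(s in `[0, t]) (disc_surv E s * dens S s))%:E.
  by rewrite fineK//; apply: integrable_fin_num => //; exact: ld.
rewrite {I}; set A := (\esum_(s in _) _)%E.
set d := \int[leb]_(s in _) _; set F := \int[leb]_(s in _) _ => byp.
have {byp}AE : A = (disc_surv E t * strat_cdf S t + F - d)%:E.
  by rewrite EFinB -byp addeAC subee// add0e.
have -> : (\esum_(s in `[0%R, t]) (m * (disc_surv E s * atom S s))%:E)%E = (m%:E * A)%E.
  rewrite -ge0_esumZl// => s; rewrite /= in_itv/= => /andP[s0 _].
  by rewrite lee_fin mulr_ge0 ?atom_ge0// ltW// disc_surv_gt0.
have -> : (\int[leb]_(s in `[0%R, t]) (u s)%:E =
    (m * d + \int[leb]_(s in `[0, t]) v s)%:E)%E.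
  rewrite -RintegralZl// -RintegralD//.
  rewrite fineK; last by apply: integrable_fin_num => //; exact: lD.
  by apply: eq_integral => s; rewrite inE/= in_itv/= => /uE->.
rewrite AE -!EFinM -!EFinD; congr EFin.
have -> : \int[leb]_(s in `[0, t]) (v s - disc_hazard E s * (c - m * strat_cdf S s)) =
    \int[leb]_(s in `[0, t]) v s - (c * \int[leb]_(s in `[0, t]) disc_hazard E s - m * F).
  rewrite -RintegralZl// -RintegralZl// -RintegralB// -RintegralB//.
  by apply: eq_Rintegral => s _ /=; ring.
rewrite [disc_surv E t * (c - _)]mulrBr.
have -> : disc_surv E t * c = c - c * \int[leb]_(s in `[0, t]) disc_hazard E s.
  by rewrite disc_survE// ; ring.
ring.
Qed.

End Payoffs.

(** * Payoffs at finite and infinite times *)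

Section PayoffFormulas.
Context {R : realType} (E : game R) (EP : regular_game E) (p : profile R).
Local Notation leb := (@lebesgue_measure R).
Implicit Types s t : R.

Lemma upto_fin t : upto t%:E = `[0, t]%classic.
Proof.
by apply/seteqP; split => s; rewrite /upto/= in_itv/= lee_fin => /andP.
Qed.

Lemma upto_pinfty : upto (+oo%E : \bar R) = @timeline R.
Proof.
apply/seteqP; split => s; rewrite /upto/= timelineE; first by case.
by move=> s0; rewrite leey.
Qed.

Lemma w1P_d_gt0 s : 0 <= s -> 0 < w1P_d E p s.
Proof.
move=> s0; have /andP[b0 bt] := rg_beta EP; have /andP[bm _] := rg_mu EP.
have /andP[/ltW sg0 _] := rg_sigma EP.
have m0 := lt_trans b0 bm.
rewrite /w1P_d ltr_pwDl//; first by rewrite !mulr_gt0 ?g_gt0// (survA_gt0 EP p s).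
by rewrite !mulr_ge0 ?dens_ge0// ltW// survival_gt0.
Qed.

Lemma mu1_ge0 s : 0 <= s -> 0 <= mu1 E p s.
Proof.
move=> s0; have /andP[b0 bt] := rg_beta EP; have /andP[bm _] := rg_mu EP.
have /andP[/ltW sg0 _] := rg_sigma EP.
have /ltW m0 := lt_trans b0 bm.
rewrite /mu1; case: ifP => // _.
rewrite divr_ge0 ?(ltW (w1P_d_gt0 s0))// addr_ge0// !mulr_ge0 ?dens_ge0//.
- exact: rg_g_ge0.
- by rewrite ltW// (survA_gt0 EP p s).
- by rewrite ltW// survival_gt0.
Qed.

Lemma newsP_ge0 s : 0 <= s -> 0 <= newsP E p s.
Proof.
move=> s0; have /andP[/ltW t0 _] := rg_theta EP.
have /andP[a0 a1] := accept01 p s0.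
by rewrite addr_ge0 ?mulr_ge0 ?mu1_ge0// subr_ge0.
Qed.

Lemma mu1_no_atom s : 0 <= s -> atom (fake p) s <= 0 ->
  w1P_d E p s * (mu1 E p s - theta E) = news_gain E p s.
Proof.
move=> s0 as0; rewrite /mu1 ltNge as0/= mulrBr mulrC divfK ?gt_eqF ?w1P_d_gt0//.
by rewrite /news_gain /w1P_d /survA; ring.
Qed.

Definition flow_P s :=
  expR (- (rho E * s)) * (w0P E p s * theta E + w1P_d E p s * newsP E p s).

Definition flow_A s := expR (- (rho E * s)) *
  (w0A E p s * beta E
   + w1A E p s * ((1 - accept p s) * beta E + accept p s)
   + wSA_d E p s * beta E).

Lemma flow_P_ge0 s : 0 <= s -> 0 <= flow_P s.
Proof.
move=> s0; have /andP[/ltW t0 _] := rg_theta EP.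
have /andP[/ltW b0 bt] := rg_beta EP; have /andP[bm mt] := rg_mu EP.
have m1 : 0 <= 1 - mu E.
  by have /andP[_ t1] := rg_theta EP; rewrite subr_ge0 ltW// (lt_trans mt).
rewrite mulr_ge0 ?expR_ge0// addr_ge0// !mulr_ge0 ?newsP_ge0 ?(rg_g_ge0 EP)//.
  by rewrite ltW// (survA_gt0 EP p s).
by rewrite ltW// w1P_d_gt0.
Qed.

Lemma flow_A_ge0 s : 0 <= s -> 0 <= flow_A s.
Proof.
move=> s0.
have /andP[/ltW b0 bt] := rg_beta EP; have /andP[bm mt] := rg_mu EP.
have m1 : 0 <= 1 - mu E.
  by have /andP[_ t1] := rg_theta EP; rewrite subr_ge0 ltW// (lt_trans mt).
have m0 : 0 <= mu E by rewrite (le_trans b0)// ltW.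
have /andP[a0 a1] := accept01 p s0.
rewrite mulr_ge0 ?expR_ge0// !addr_ge0// !mulr_ge0 ?(rg_g_ge0 EP) ?dens_ge0//.
- exact: survP_ge0.
- exact: survP_ge0.
- by rewrite addr_ge0// mulr_ge0// subr_ge0.
- by rewrite ltW// survival_gt0.
Qed.

Let lk := disc_hazard_loc_integrable EP.

Lemma flow_AE s : 0 <= s -> flow_A s =
  beta E * (disc_surv E s * dens (stop p) s)
  + (drift_A E p s + (beta E * disc_hazard E s
     - beta E * (disc_hazard E s * strat_cdf (stop p) s))).
Proof.
move=> s0; rewrite /flow_A /drift_A /disc_hazard /disc_surv /w0A /w1A /wSA_d /survP.
ring.
Qed.

(** At an atom of F_A the posterior [mu1] is not the quotient of the density rates, so [news_gain]
    does not describe the flow there. Rejection removes the posterior from the payoff; in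
    equilibrium the condition is [atom_rejected]. *)
Lemma flow_PE s : 0 <= s ->
  (0 < atom (fake p) s -> accept p s = 0) -> flow_P s =
  (theta E * sigma E) * (disc_surv E s * dens (fake p) s)
  + (drift_P E p s + (theta E * disc_hazard E s
     - (theta E * sigma E) * (disc_hazard E s * strat_cdf (fake p) s))).
Proof.
move=> s0 aat.
have -> : flow_P s = expR (- (rho E * s)) *
    (w0P E p s * theta E + w1P_d E p s * theta E + accept p s * news_gain E p s).
  rewrite /flow_P /newsP; congr (_ * _).
  have [/aat a0|as0] := ltP 0 (atom (fake p) s); first by rewrite a0; ring.
  rewrite -mu1_no_atom//; ring.
rewrite /drift_P /news_gain /disc_hazard /disc_surv /w0P /w1P_d /survA.
ring.
Qed.

Lemma flow_A_loc_integrable t : leb.-integrable `[0, t] (EFin \o flow_A).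
Proof.
have lA := loc_integrableD (loc_integrableZ (beta E) (disc_dens_loc_integrable EP (stop p)))
  (loc_integrableD (drift_A_loc_integrable EP p)
    (loc_integrableB (loc_integrableZ (beta E) lk)
      (loc_integrableZ (beta E) (hazard_cdf_loc_integrable EP (stop p))))).
apply: eq_integrable (lA t) => // s; rewrite inE/= in_itv/= => /andP[s0 _].
by rewrite flow_AE.
Qed.

Lemma uA_fin t : 0 <= t -> uA E p t%:E =
  (value_A E p t
   + disc_surv E t * survP p t * (mu E - beta E) * accept p t)%:E.
Proof.
move=> t0; rewrite /uA upto_fin -/flow_A.
have b0 : 0 <= beta E by have /andP[/ltW] := rg_beta EP.
pose v s := drift_A E p s + (beta E * disc_hazard E s
     - beta E * (disc_hazard E s * strat_cdf (stop p) s)).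
have lv : loc_integrable v.
  apply: loc_integrableD; first exact: drift_A_loc_integrable.
  by apply: loc_integrableB; apply: loc_integrableZ => //; exact: hazard_cdf_loc_integrable.
have uE s : 0 <= s <= t ->
    flow_A s = beta E * (disc_surv E s * dens (stop p) s) + v s.
  by move=> /andP[s0 _]; exact: flow_AE.
have e := stopped_payoff EP (beta E) t0 lv b0 uE.
rewrite (@eq_esum _ _ _ _ (fun s => (beta E * (disc_surv E s * atom (stop p) s))%:E)); last first.
  by move=> s _; congr EFin; rewrite /wSA_m /disc_surv; ring.
rewrite [RHS]EFinD.
have -> : value_A E p t = beta E + \int[leb]_(s in `[0, t]) (v s - disc_hazard E s * (beta E - beta E * strat_cdf (stop p) s)).
  by congr (_ + _); apply: eq_Rintegral => s _; rewrite /v; ring.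
rewrite -e -[RHS]addeA -EFinD; congr (_ + _%:E)%E.
by rewrite /disc_surv /WA /survP; ring.
Qed.

Section Principal.
Hypothesis aat : forall s, 0 <= s -> 0 < atom (fake p) s -> accept p s = 0.

Lemma flow_P_loc_integrable t : leb.-integrable `[0, t] (EFin \o flow_P).
Proof.
have lA := loc_integrableD (loc_integrableZ (theta E * sigma E) (disc_dens_loc_integrable EP (fake p)))
  (loc_integrableD (drift_P_loc_integrable EP p)
    (loc_integrableB (loc_integrableZ (theta E) lk)
      (loc_integrableZ (theta E * sigma E) (hazard_cdf_loc_integrable EP (fake p))))).
apply: eq_integrable (lA t) => // s; rewrite inE/= in_itv/= => /andP[s0 _].
by rewrite flow_PE//; exact: aat.
Qed.

Lemma uP_fin t : 0 <= t -> uP E p t%:E = (value_P E p t)%:E.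
Proof.
move=> t0; rewrite /uP upto_fin -/flow_P.
have ts0 : 0 <= theta E * sigma E.
  have /andP[/ltW th0 _] := rg_theta EP; have /andP[/ltW sg0 _] := rg_sigma EP.
  exact: mulr_ge0.
pose v s := drift_P E p s + (theta E * disc_hazard E s
     - (theta E * sigma E) * (disc_hazard E s * strat_cdf (fake p) s)).
have lv : loc_integrable v.
  apply: loc_integrableD; first exact: drift_P_loc_integrable.
  by apply: loc_integrableB; apply: loc_integrableZ => //; exact: hazard_cdf_loc_integrable.
have uE s : 0 <= s <= t ->
    flow_P s = (theta E * sigma E) * (disc_surv E s * dens (fake p) s) + v s.
  by move=> /andP[s0 _]; apply: flow_PE => //; exact: aat.
have e := stopped_payoff EP (theta E) t0 lv ts0 uE.
rewrite (@eq_esum _ _ _ _ (fun s => (theta E * sigma E * (disc_surv E s * atom (fake p) s))%:E)); last first.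
  move=> s; rewrite /= in_itv/= => /andP[s0 _]; congr EFin.
  have := atom_ge0 (fake p) s0; rewrite le_eqVlt => /predU1P[a0|/(aat s0) a0].
    by rewrite /w1P_m -a0; ring.
  by rewrite /w1P_m /newsP a0 /disc_surv; ring.
have -> : value_P E p t = theta E + \int[leb]_(s in `[0, t]) (v s - disc_hazard E s * (theta E - theta E * sigma E * strat_cdf (fake p) s)).
  by congr (_ + _); apply: eq_Rintegral => s _; rewrite /v; ring.
rewrite -e; congr (_ + _%:E)%E.
by rewrite /disc_surv /WP; ring.
Qed.

End Principal.

Lemma finite_set_le_nat (X : set R) : finite_set X ->
  exists n : nat, forall x, X x -> x <= n%:R.
Proof.
move=> finX; exists (\max_(x <- finmap.enum_fset (fset_set X)) (Num.truncn x).+1)%N => x Xx.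
apply: le_trans (ltW (truncnS_gt x)) _; rewrite ler_nat.
by apply: (@leq_bigmax_seq _ _ _ (fun x => (Num.truncn x).+1)); rewrite ?in_fset_set ?inE.
Qed.

(** The integral is the monotone limit of integrals over [[0, n]], and every finite set of atoms
    lies in some [[0, n]]. The two suprema are taken one after the other. *)
Lemma integral_esum_timeline_le (f b : R -> R) (M : R) (n0 : nat) :
  (forall t, measurable_fun `[0, t] f) ->
  (forall s, 0 <= s -> 0 <= f s) -> (forall s, 0 <= s -> 0 <= b s) ->
  (forall n : nat, (n0 <= n)%N -> \int[leb]_(s in `[0%R, n%:R]) (f s)%:E
     + \esum_(s in `[0%R, n%:R]) (b s)%:E <= M%:E)%E ->
  (\int[leb]_(s in @timeline R) (f s)%:E + \esum_(s in @timeline R) (b s)%:E <= M%:E)%E.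
Proof.
move=> mf f0 b0 HM.
have tE : @timeline R = \bigcup_n `[0, n%:R]%classic.
  apply/seteqP; split => s.
    rewrite timelineE => s0; exists (Num.truncn s).+1 => //=.
    by rewrite in_itv/= s0 ltW// truncnS_gt.
  by move=> [n _] /=; rewrite timelineE in_itv/= => /andP[].
have sub (n : nat) : (`[0, n%:R]%classic : set R) `<=` `[0, n.+1%:R].
  by apply: subset_itvl; rewrite bnd_simp ler_nat.
have nd : nondecreasing_seq (fun n : nat => `[0, n%:R]%classic : set R).
  by apply/nondecreasing_seqP => n; rewrite subsetEset; exact: sub.
have fI0 n x : `[0, n%:R]%classic x -> (0 <= (f x)%:E)%E.
  by rewrite /= in_itv/= lee_fin => /andP[/f0].
have mE (n : nat) : measurable_fun (`[0, n%:R]%classic : set R) (EFin \o f).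
  by apply/measurable_EFinP.
have := ge0_nondecreasing_set_cvg_integral (mu := leb) nd (fun n => measurable_itv _) mE fI0.
rewrite -tE => cvI.
have bound (X : set R) : finite_set X -> X `<=` @timeline R ->
    (\int[leb]_(s in @timeline R) (f s)%:E + \sum_(s \in X) (b s)%:E <= M%:E)%E.
  move=> finX sX; have [n1 Xn1] := finite_set_le_nat finX.
  have Xfin : (\sum_(s \in X) (b s)%:E)%E \is a fin_num.
    by rewrite fsbig_finite//= sumEFin.
  rewrite -leeBrDr//; apply: (cvge_le _ cvI).
  near=> n; rewrite leeBrDr//; apply: le_trans (HM n _); last by near: n; exists n0.
  rewrite leeD2l//; apply: esum_ge; exists X => //; split => // x Xx.
  rewrite /= in_itv/=; apply/andP; split; first by rewrite -timelineE; exact: sX.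
  rewrite (le_trans (Xn1 _ Xx))// ler_nat.
  by near: n; exists n1.
have intfin : (\int[leb]_(s in @timeline R) (f s)%:E)%E \is a fin_num.
  rewrite ge0_fin_numE; last first.
    by apply: integral_ge0 => s; rewrite timelineE lee_fin => /f0.
  have := bound set0 (finite_set0 _) (@sub0set _ _).
  by rewrite fsbig_set0 adde0 => /le_lt_trans; apply; exact: ltry.
rewrite -leeBrDl//; apply: ge_ereal_sup => _ [X [finX sX] <-].
by rewrite leeBrDl//; exact: bound.
Unshelve. all: by end_near. Qed.

(** The payoff of never acting is the limit of the accumulated flows, and dropping the nonnegative
    terminal payoff only lowers the values at integers. It is thus bounded by any eventual bound on
    those values. *)
Lemma uA_pinfty_le (M : R) (n0 : nat) :
  (forall n : nat, (n0 <= n)%N -> uA E p n%:R%:E <= M%:E)%E ->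
  (uA E p +oo <= M%:E)%E.
Proof.
move=> HM; rewrite /uA adde0 upto_pinfty -/flow_A.
have b0 : 0 <= beta E by have /andP[/ltW] := rg_beta EP.
have [/ltW bm _] := andP (rg_mu EP).
apply: (@integral_esum_timeline_le _ _ _ n0).
- by move=> t; have /integrableP[/measurable_EFinP] := flow_A_loc_integrable t.
- exact: flow_A_ge0.
- move=> s s0; rewrite mulr_ge0 ?expR_ge0// mulr_ge0// mulr_ge0 ?atom_ge0//.
  by rewrite ltW// survival_gt0.
move=> n nn; apply: le_trans (HM n nn); rewrite /uA upto_fin leeDl// lee_fin.
have nR : 0 <= n%:R :> R by [].
have /andP[a0 a1] := accept01 p nR.
apply: mulr_ge0; last first.
  by rewrite addr_ge0// mulr_ge0 ?subr_ge0// (le_trans b0).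
rewrite mulr_ge0 ?expR_ge0// mulr_ge0 ?survP_ge0//.
by rewrite ltW// survival_gt0.
Qed.

Lemma uP_pinfty_le (M : R) (n0 : nat) :
  (forall s, 0 <= s -> 0 < atom (fake p) s -> accept p s = 0) ->
  (forall n : nat, (n0 <= n)%N -> uP E p n%:R%:E <= M%:E)%E -> (uP E p +oo <= M%:E)%E.
Proof.
move=> aat HM; rewrite /uP adde0 upto_pinfty -/flow_P.
have t0 : 0 <= theta E by have /andP[/ltW] := rg_theta EP.
have sg0 : 0 <= sigma E by have /andP[/ltW] := rg_sigma EP.
apply: (@integral_esum_timeline_le _ _ _ n0).
- by move=> t; have /integrableP[/measurable_EFinP] := flow_P_loc_integrable aat t.
- exact: flow_P_ge0.
- move=> s s0; rewrite mulr_ge0 ?expR_ge0// mulr_ge0 ?newsP_ge0//.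
  by rewrite !mulr_ge0 ?atom_ge0// ltW// survival_gt0.
move=> n nn; apply: le_trans (HM n nn); rewrite /uP upto_fin leeDl// lee_fin.
have nR : 0 <= n%:R :> R by [].
rewrite mulr_ge0// mulr_ge0 ?expR_ge0// mulr_ge0 ?(ltW (survA_gt0 EP p n%:R))//.
by rewrite ltW// survival_gt0.
Qed.

End PayoffFormulas.

(** * Necessity *)

Record regular_cutoff (R : realType) (E : game R) (tauP : R) : Prop :=
  RegularCutoff {
  rc_game :> regular_game E;
  rc_A2 : phiA E < phiP E;
  rc_gt0 : 0 < tauP;
  rc_HR : HR E tauP = phiP E
}.

(** * Signs of the margins on both sides of the cutoff *)

Section Cutoff.
Context {R : realType} (E : game R) (tauP : R) (CP : regular_cutoff E tauP).
Local Notation leb := (@lebesgue_measure R).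
Let EP := rc_game CP.

Lemma beta_gt0 : 0 < beta E.
Proof. by case/andP: (rg_beta EP). Qed.

Lemma mu_gt_beta : beta E < mu E.
Proof. by case/andP: (rg_mu EP). Qed.

Lemma mu_lt_theta : mu E < theta E.
Proof. by case/andP: (rg_mu EP). Qed.

Lemma theta_lt1 : theta E < 1.
Proof. by case/andP: (rg_theta EP). Qed.

Lemma mu_gt0 : 0 < mu E.
Proof. exact: lt_trans beta_gt0 mu_gt_beta. Qed.

Lemma theta_gt0 : 0 < theta E.
Proof. exact: lt_trans mu_gt0 mu_lt_theta. Qed.

Lemma mu_lt1 : mu E < 1.
Proof. exact: lt_trans mu_lt_theta theta_lt1. Qed.

Lemma HR_le s t : 0 <= s -> s <= t -> HR E t <= HR E s.
Proof.
move=> s0; rewrite le_eqVlt => /predU1P[->//|st].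
exact: ltW (rg_HR_decreasing EP s0 st).
Qed.

Lemma HR_gt_phiP s : 0 <= s -> s < tauP -> phiP E < HR E s.
Proof. by move=> s0 st; rewrite -(rc_HR CP); exact: (rg_HR_decreasing EP). Qed.

Lemma HR_lt_phiP s : tauP < s -> HR E s < phiP E.
Proof.
move=> st; rewrite -(rc_HR CP); apply: (rg_HR_decreasing EP) => //.
exact: ltW (rc_gt0 CP).
Qed.

Lemma phiPE : mu E * (1 - theta E) * phiP E = rho E * theta E.
Proof.
rewrite /phiP mulrCA divff ?mulr1// gt_eqF// mulr_gt0 ?mu_gt0//.
by rewrite subr_gt0 theta_lt1.
Qed.

Lemma phiAE : beta E * (1 - mu E) * phiA E = rho E * mu E.
Proof.
rewrite /phiA mulrCA divff ?mulr1// gt_eqF// mulr_gt0 ?beta_gt0//.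
by rewrite subr_gt0 mu_lt1.
Qed.

Lemma principal_margin_gt0 s : 0 <= s -> s < tauP ->
  0 < mu E * (1 - theta E) * HR E s - rho E * theta E.
Proof.
move=> s0 st; rewrite -phiPE -mulrBr mulr_gt0 ?subr_gt0 ?HR_gt_phiP//.
by rewrite mulr_gt0 ?mu_gt0// subr_gt0 theta_lt1.
Qed.

Lemma principal_margin_lt0 s : tauP < s ->
  mu E * (1 - theta E) * HR E s - rho E * theta E < 0.
Proof.
move=> st; rewrite -phiPE -mulrBr pmulr_rlt0 ?subr_lt0 ?HR_lt_phiP//.
by rewrite mulr_gt0 ?mu_gt0// subr_gt0 theta_lt1.
Qed.

(** The value at [tauP] of the net rate at which the agent gains by delaying a surely accepted fake.
    It is the minimum over [[0, tauP]], and (A2) says that it is positive. *)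
Definition agent_margin := beta E * (1 - mu E) * phiP E - rho E * mu E.

Lemma agent_margin_gt0 : 0 < agent_margin.
Proof.
rewrite /agent_margin -phiAE -mulrBr mulr_gt0 ?subr_gt0 ?(rc_A2 CP)//.
by rewrite mulr_gt0 ?beta_gt0// subr_gt0 mu_lt1.
Qed.

Lemma agent_margin_le s : 0 <= s -> s <= tauP ->
  agent_margin <= beta E * (1 - mu E) * HR E s - rho E * mu E.
Proof.
move=> s0 st; rewrite /agent_margin lerD2r ler_wpM2l//.
  by rewrite mulr_ge0 ?(ltW beta_gt0)// subr_ge0 ltW// mu_lt1.
by rewrite -(rc_HR CP) HR_le.
Qed.

Lemma disc_surv_nonincreasing s t : 0 <= s -> s <= t -> disc_surv E t <= disc_surv E s.
Proof.
move=> s0 st; rewrite (disc_survB EP s0 st) lerDl; apply: Rintegral_ge0 => x /=.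
by rewrite in_itv/= => /andP[sx _]; apply: (disc_hazard_ge0 EP); exact: le_trans sx.
Qed.

(** * Consequences of optimality in a given equilibrium *)

Section Equilibrium.
Variable p : profile R.
Hypothesis eqA : AIC E p.
Hypothesis eqa : PICa E p.
Hypothesis eqt : PICt E p.
Implicit Types s t x : R.

Lemma atom_rejected s : 0 <= s -> 0 < atom (fake p) s -> accept p s = 0.
Proof.
move=> s0 as0; have [_] := eqa s0; apply.
by rewrite /mu1 as0 mu_lt_theta.
Qed.

Let uPE t (t0 : 0 <= t) : uP E p t%:E = (value_P E p t)%:E :=
  uP_fin EP atom_rejected t0.

Lemma inactive_dens0 S t : 0 <= t -> ~ active S t%:E -> dens S t = 0 /\ atom S t = 0.
Proof.
move=> t0 na; split; apply/eqP; rewrite eq_le ?dens_ge0 ?atom_ge0// andbT leNgt.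
  by apply/negP => d0; apply: na; left.
by apply/negP => a0; apply: na; right.
Qed.

(** Where nobody fakes the posterior is 1, which exceeds [theta E]. *)
Lemma inactive_accept s : 0 <= s -> ~ active (fake p) s%:E -> accept p s = 1.
Proof.
move=> s0 /(inactive_dens0 s0)[d0 a0]; have [+ _] := eqa s0; apply.
rewrite /mu1 a0 ltxx d0 mulr0 mul0r addr0 /w1P_d d0 mulr0 mul0r addr0 divff ?theta_lt1//.
by rewrite gt_eqF// !mulr_gt0 ?mu_gt0 ?(g_gt0 EP)// (survA_gt0 EP p s).
Qed.

(** Away from atoms rejection requires a posterior of at most [theta E], so [news_gain] is
    nonpositive. At an atom [news_gain] may be positive, but there the factor [accept p s] is 0;
    hence the product in the statement. *)
Lemma rejected_gain s : 0 <= s -> accept p s < 1 -> accept p s * news_gain E p s <= 0.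
Proof.
move=> s0 a1; have /andP[a0 _] := accept01 p s0.
have m1 : mu1 E p s <= theta E.
  rewrite leNgt; apply/negP => /(eqa s0).1 a1'.
  by move: a1; rewrite a1' ltxx.
have [/(atom_rejected s0)->|as0] := ltP 0 (atom (fake p) s); first by rewrite mul0r.
rewrite -(mu1_no_atom EP s0 as0) mulr_ge0_le0// mulr_ge0_le0 ?subr_le0//.
exact: ltW (w1P_d_gt0 EP p s0).
Qed.

Lemma accept_gain_le s : 0 <= s ->
  accept p s * news_gain E p s <= mu E * (1 - theta E) * g E s * survA E p s.
Proof.
move=> s0; have /andP[a0 a1] := accept01 p s0.
have M0 : 0 <= mu E * (1 - theta E) * g E s * survA E p s.
  rewrite !mulr_ge0 ?(ltW mu_gt0) ?(rg_g_ge0 EP)//; last exact: ltW (survA_gt0 EP p s).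
  by rewrite subr_ge0 ltW// theta_lt1.
have N_le : news_gain E p s <= mu E * (1 - theta E) * g E s * survA E p s.
  rewrite /news_gain gerBl !mulr_ge0 ?dens_ge0//.
  - by rewrite subr_ge0 ltW// mu_lt_theta.
  - by case/andP: (rg_sigma EP) => /ltW.
  - by rewrite ltW// (survival_gt0 EP).
have [N0|N0] := leP 0 (news_gain E p s).
  by apply: le_trans N_le; rewrite ler_piMl.
by apply: le_trans M0; rewrite mulr_ge0_le0// ltW.
Qed.

(** Past [tauP] even news that is all real and accepted does not pay for the delay. *)
Lemma drift_P_lt0 s : tauP < s -> drift_P E p s < 0.
Proof.
move=> st; have s0 : 0 <= s by rewrite ltW// (lt_trans (rc_gt0 CP)).
rewrite /drift_P pmulr_rlt0 ?expR_gt0//.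
apply: le_lt_trans (lerB (accept_gain_le s0) (lexx _)) _.
rewrite (gE EP s0).
rewrite (_ : _ - _ = (mu E * (1 - theta E) * HR E s - rho E * theta E)
   * ((1 - G E s) * survA E p s)); last by ring.
rewrite pmulr_llt0 ?principal_margin_lt0// mulr_gt0 ?(survival_gt0 EP)//.
exact: survA_gt0.
Qed.

Lemma value_P_lt s t : 0 <= s -> s < t ->
  (forall x, s < x < t -> 0 < drift_P E p x) -> value_P E p s < value_P E p t.
Proof.
move=> s0 st d0; rewrite (value_PB EP p s0 (ltW st)) ltrDl.
apply: Rintegral_itv_gt0 => //.
exact: loc_integrableW (drift_P_loc_integrable EP p).
Qed.

Lemma value_P_gt s t : 0 <= s -> s < t ->
  (forall x, s < x < t -> drift_P E p x < 0) -> value_P E p t < value_P E p s.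
Proof.
move=> s0 st d0; rewrite (value_PB EP p s0 (ltW st)) gtrDl.
have ld := loc_integrableW t s0 (drift_P_loc_integrable EP p).
have ldN : leb.-integrable `[s, t] (EFin \o (fun x => -1 * drift_P E p x)).
  exact: loc_integrableW (loc_integrableZ (-1) (drift_P_loc_integrable EP p)).
rewrite -oppr_gt0 -mulN1r -RintegralZl//.
by apply: Rintegral_itv_gt0 => // x /d0; rewrite mulN1r oppr_gt0.
Qed.

Lemma value_P_after t : tauP < t -> value_P E p t < value_P E p tauP.
Proof.
move=> tt; apply: value_P_gt => //; first exact: ltW (rc_gt0 CP).
by move=> x /andP[+ _]; exact: drift_P_lt0.
Qed.

Lemma active_stop_le (t : \bar R) : (0 <= t)%E -> active (stop p) t ->
  exists2 r : R, t = r%:E & 0 <= r <= tauP.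
Proof.
have T0 := ltW (rc_gt0 CP).
case: t => [r|_ aoo|//].
  rewrite lee_fin => r0 at_.
  exists r => //; rewrite r0/= leNgt; apply/negP => rT.
  have := eqt (t := r%:E) (t' := tauP%:E); rewrite !lee_fin => /(_ r0 T0 at_).
  by rewrite !uPE// lee_fin leNgt value_P_after.
have := eqt (t := +oo%E) (t' := tauP%:E); rewrite lee_fin => /(_ (leey _) T0 aoo).
rewrite uPE// leNgt => /negP[].
have T1 : 0 <= tauP + 1 by rewrite addr_ge0.
(* The limit at infinity preserves only weak inequalities; the intermediate time [tauP + 1] provides
   the strict one. *)
apply: (@le_lt_trans _ _ (value_P E p (tauP + 1))%:E); last first.
  by rewrite lte_fin value_P_after// ltrDl.
apply: (uP_pinfty_le EP atom_rejected (n0 := (Num.truncn (tauP + 1)).+1)) => n nn.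
rewrite uPE// lee_fin.
have ltn : tauP + 1 < n%:R.
  by apply: lt_le_trans (truncnS_gt _) _; rewrite ler_nat.
apply/ltW/value_P_gt => // x /andP[+ _]; move=> /(lt_trans _) h.
by apply: drift_P_lt0; apply: h; rewrite ltrDl.
Qed.

Lemma exists_principal_value : exists VP : R,
  [/\ exists2 r, 0 <= r <= tauP & value_P E p r = VP,
      forall t, 0 <= t -> value_P E p t <= VP,
      forall t, 0 <= t -> active (stop p) t%:E -> value_P E p t = VP &
      payoffP E p = VP%:E].
Proof.
have [t0 t00 at0] := exists_active (stop p).
have [r t0E /andP[r0 rT]] := active_stop_le t00 at0.
rewrite {}t0E in t00 at0; exists (value_P E p r).
have le t : 0 <= t -> value_P E p t <= value_P E p r.
  move=> tge0; have := eqt (t := r%:E) (t' := t%:E).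
  by rewrite !lee_fin => /(_ r0 tge0 at0); rewrite !uPE// lee_fin.
have eq t : 0 <= t -> active (stop p) t%:E -> value_P E p t = value_P E p r.
  move=> tge0 at_; apply/eqP; rewrite eq_le le//=.
  have := eqt (t := t%:E) (t' := r%:E).
  by rewrite !lee_fin => /(_ tge0 r0 at_); rewrite !uPE// lee_fin.
split => //; first by exists r => //; rewrite r0.
apply: expectation_active_value.
  by apply: le_trans (le 0 (lexx 0)); rewrite value_P0 ltW// theta_gt0.
move=> t t_ge0 at_; have [x tE /andP[x0 _]] := active_stop_le t_ge0 at_.
by rewrite tE in at_ *; rewrite uPE// eq.
Qed.

Lemma survP_after t : tauP <= t -> survP p t = 0.
Proof.
move=> tt; have T0 := ltW (rc_gt0 CP).
rewrite /survP (@strat_cdf_inactive1 _ _ t) ?subrr//; first exact: le_trans tt.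
move=> s ts at_; have s0 : (0 <= s)%E.
  by apply: le_trans (ltW ts); rewrite lee_fin (le_trans T0).
have [r sE /andP[_ rT]] := active_stop_le s0 at_.
by move: ts; rewrite sE lte_fin ltNge (le_trans rT).
Qed.

Definition agent_payoff t := value_A E p t
   + disc_surv E t * survP p t * (mu E - beta E) * accept p t.

(** B of the overview. *)
Definition accepted_payoff t := value_A E p t
   + disc_surv E t * survP p t * (mu E - beta E).

Lemma value_A_const s t : 0 <= s -> s <= t ->
  (forall x, s < x < t -> survP p x = 0) -> value_A E p t = value_A E p s.
Proof.
move=> s0 st z; rewrite (value_AB EP p s0 st).
rewrite (@ae_eq_Rintegral _ _ (fun=> 0)); first by rewrite Rintegral_cst// mul0r addr0.
- exact: loc_integrableW (drift_A_loc_integrable EP p).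
- exact: measurable_cst.
- by apply: aeW => x /z z0; rewrite /drift_A z0 !mulr0 subr0 mulr0.
Qed.

Lemma uA_pinfty_value : (uA E p +oo <= (value_A E p tauP)%:E)%E.
Proof.
have T0 := ltW (rc_gt0 CP).
apply: (uA_pinfty_le EP (n0 := (Num.truncn tauP).+1)) => n nn.
have ltn : tauP <= n%:R.
  by apply/ltW; apply: lt_le_trans (truncnS_gt _) _; rewrite ler_nat.
rewrite (uA_fin EP)// survP_after// mulr0 !mul0r addr0.
rewrite (value_A_const T0 ltn) => // x /andP[/ltW xT _].
exact: survP_after.
Qed.

(** By [tauP] the principal has stopped, so faking then earns K(tauP), and never faking earns at
    most that. If never faking is optimal, the two payoffs coincide, which also shows that the
    payoff at [+oo] is finite. *)
Lemma exists_agent_value : exists VA : R,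
  [/\ forall t, 0 <= t -> agent_payoff t <= VA,
      forall t, 0 <= t -> active (fake p) t%:E -> agent_payoff t = VA,
      active (fake p) +oo%E -> VA = value_A E p tauP &
      payoffA E p = VA%:E].
Proof.
have T0 := ltW (rc_gt0 CP).
have uAE t : 0 <= t -> uA E p t%:E = (agent_payoff t)%:E by exact: uA_fin.
have uT : agent_payoff tauP = value_A E p tauP.
  by rewrite /agent_payoff survP_after// mulr0 !mul0r addr0.
have uoo : active (fake p) +oo%E -> uA E p +oo = (value_A E p tauP)%:E.
  move=> aoo; apply/eqP; rewrite eq_le uA_pinfty_value/= -uT -uAE//.
  exact: eqA.
have [t0 t00 at0] := exists_active (fake p).
have [VA VAE] : exists VA : R, uA E p t0 = VA%:E.
  case: t0 t00 at0 => [r|_ aoo|//].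
    by rewrite lee_fin => r0 _; rewrite uAE//; eexists.
  by rewrite uoo//; eexists.
exists VA.
have eq (t : \bar R) : (0 <= t)%E -> active (fake p) t -> uA E p t = VA%:E.
  by move=> tge0 at_; rewrite -VAE; apply/eqP; rewrite eq_le !eqA.
have le t : 0 <= t -> agent_payoff t <= VA.
  by move=> tge0; rewrite -lee_fin -uAE// -VAE eqA.
split => //.
- by move=> t tge0 at_; apply: EFin_inj; rewrite -uAE// eq.
- by move=> aoo; apply: EFin_inj; rewrite -uoo// eq.
- apply: expectation_active_value => //.
  apply: le_trans (le 0 (lexx 0)); rewrite /agent_payoff value_A0.
  have [a0 _] := andP (accept01 p (lexx 0)).
  rewrite addr_ge0 ?(ltW beta_gt0)// mulr_ge0// mulr_ge0//.
    by rewrite mulr_ge0 ?survP_ge0// (ltW (disc_surv_gt0 EP (lexx 0))).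
  by rewrite subr_ge0 ltW// mu_gt_beta.
Qed.

End Equilibrium.
End Cutoff.

(** * Intervals in which the principal does not stop *)

Section GapLemma.
Context {R : realType} (E : game R) (tauP : R) (CP : regular_cutoff E tauP).
Local Notation leb := (@lebesgue_measure R).
Let EP := rc_game CP.
Variable p : profile R.
Hypothesis eqa : PICa E p.
Variable VA : R.
Hypothesis VA_ge : forall t, 0 <= t -> agent_payoff E p t <= VA.
Hypothesis VA_eq : forall t, 0 <= t -> active (fake p) t%:E -> agent_payoff E p t = VA.
Implicit Types s t x c d : R.

Lemma rejected_active s : 0 <= s -> accept p s < 1 -> active (fake p) s%:E.
Proof.
move=> s0 a1; apply: contrapT => na.
by move: a1; rewrite (inactive_accept CP eqa s0 na) ltxx.
Qed.

Let weight_gt0 s : 0 <= s -> 0 < survP p s ->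
  0 < disc_surv E s * survP p s * (mu E - beta E).
Proof.
move=> s0 y0; rewrite mulr_gt0 ?subr_gt0 ?(mu_gt_beta CP)// mulr_gt0//.
exact: disc_surv_gt0.
Qed.

Lemma accepted_payoff_le s : 0 <= s -> accept p s = 1 -> accepted_payoff E p s <= VA.
Proof. by move=> s0 a1; have := VA_ge s0; rewrite /agent_payoff a1 mulr1. Qed.

(** Rejection implies that s is active for the agent, hence that faking at s earns exactly VA. The
    excess of B over VA therefore measures the rejection probability. *)
Lemma rejected_payoff s : 0 <= s -> accept p s < 1 ->
  accepted_payoff E p s - VA =
  disc_surv E s * survP p s * (mu E - beta E) * (1 - accept p s).
Proof.
move=> s0 a1; rewrite -(VA_eq s0 (rejected_active s0 a1)).
by rewrite /accepted_payoff /agent_payoff; ring.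
Qed.

Lemma accept_of_payoff_le s : 0 <= s -> 0 < survP p s ->
  accepted_payoff E p s <= VA -> accept p s = 1.
Proof.
move=> s0 y0 BV; have [_] := andP (accept01 p s0).
rewrite le_eqVlt => /predU1P[//|a1].
move: BV; rewrite -subr_le0 (rejected_payoff s0 a1) leNgt => /negP[].
by rewrite mulr_gt0 ?subr_gt0// weight_gt0.
Qed.

Lemma fake_inactive s : 0 <= s -> 0 < survP p s ->
  accepted_payoff E p s < VA -> ~ active (fake p) s%:E.
Proof.
move=> s0 y0 BV at_; move: (VA_eq s0 at_) (BV).
rewrite /agent_payoff (accept_of_payoff_le s0 y0 (ltW BV)) mulr1.
by rewrite /accepted_payoff => ->; rewrite ltxx.
Qed.

Lemma inactive_drift_P_gt0 s : 0 <= s -> s < tauP ->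
  ~ active (fake p) s%:E -> 0 < drift_P E p s.
Proof.
move=> s0 st na; rewrite /drift_P mulr_gt0 ?expR_gt0//.
rewrite (inactive_accept CP eqa s0 na) mul1r.
have [d0 _] := inactive_dens0 s0 na.
rewrite /news_gain d0 mulr0 mul0r subr0 (gE EP s0).
rewrite (_ : _ - _ = (mu E * (1 - theta E) * HR E s - rho E * theta E)
   * ((1 - G E s) * survA E p s)); last by ring.
rewrite mulr_gt0 ?(principal_margin_gt0 CP)// mulr_gt0 ?(survival_gt0 EP)//.
exact: survA_gt0.
Qed.

Section Gap.
Variables (c d y : R).
Hypotheses (c0 : 0 <= c) (cd : c < d) (dT : d <= tauP) (y0 : 0 < y)
  (Yc : forall x, c <= x < d -> survP p x = y)
  (dmax : forall x, c < x < d -> value_P E p x <= value_P E p d).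

(** The accepted payoff with Y frozen at y. Unlike [accepted_payoff] it is continuous at d, where
    F_P may jump; [psi] is its derivative. *)
Let B x := value_A E p x + disc_surv E x * (y * (mu E - beta E)).
Let psi x := drift_A E p x - (y * (mu E - beta E)) * disc_hazard E x.

Let B_continuous : continuous B.
Proof.
move=> x; apply: cvgD; first exact: value_A_continuous.
by apply: cvgM; [exact: disc_surv_continuous|exact: cvg_cst].
Qed.

Let B_E x : c <= x < d -> B x = accepted_payoff E p x.
Proof. by move=> xI; rewrite /accepted_payoff Yc// /B; ring. Qed.

Let psi_loc_integrable : loc_integrable psi.
Proof.
apply: loc_integrableB; first exact: drift_A_loc_integrable.
exact/loc_integrableZ/(disc_hazard_loc_integrable EP).
Qed.

Let BB s t : 0 <= s -> s <= t -> B t = B s + \int[leb]_(x in `[s, t]) psi x.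
Proof.
move=> s0 st.
have i1 := loc_integrableW t s0 (drift_A_loc_integrable EP p).
have i2 := loc_integrableW t s0 (disc_hazard_loc_integrable EP).
have i3 := loc_integrableW t s0
  (loc_integrableZ (y * (mu E - beta E)) (disc_hazard_loc_integrable EP)).
rewrite RintegralB// RintegralZl// /B (value_AB EP p s0 st) (disc_survB EP s0 st).
ring.
Qed.

Let psiE x : c <= x < d -> psi x = y * disc_surv E x *
  ((beta E * (1 - mu E) * HR E x - rho E * mu E)
   - mu E * (1 - beta E) * HR E x * (1 - accept p x)).
Proof.
move=> xI; have x0 : 0 <= x by case/andP: xI => cx _; exact: le_trans cx.
rewrite /psi /drift_A /disc_hazard /disc_surv Yc// (gE EP x0); ring.
Qed.

(** In [psiE] the first bracket is at least [agent_margin E] and the coefficient of [1 - accept p x]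
    is at most its value at time 0, so rejection with probability below [eta] leaves [psi]
    positive. *)
Let eta := agent_margin E / (mu E * (1 - beta E) * HR E 0).

Let H0_gt0 : 0 < mu E * (1 - beta E) * HR E 0.
Proof.
rewrite mulr_gt0 ?(HR_gt0 EP)// mulr_gt0 ?(mu_gt0 CP)// subr_gt0.
exact: lt_trans (mu_gt_beta CP) (mu_lt1 CP).
Qed.

Let eta_gt0 : 0 < eta.
Proof. by rewrite divr_gt0// (agent_margin_gt0 CP). Qed.

Let psi_gt0 x : c <= x < d -> 1 - accept p x < eta -> 0 < psi x.
Proof.
move=> /[dup] xI /andP[cx xd] ax; have x0 := le_trans c0 cx.
have [a0 a1] := andP (accept01 p x0).
rewrite psiE//; apply: mulr_gt0; first by rewrite mulr_gt0// (disc_surv_gt0 EP).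
rewrite subr_gt0.
apply: lt_le_trans (agent_margin_le CP x0 (ltW (lt_le_trans xd dT))).
apply: (@le_lt_trans _ _ (mu E * (1 - beta E) * HR E 0 * (1 - accept p x))).
  rewrite ler_wpM2r ?subr_ge0// ler_wpM2l ?(HR_le CP)//.
  rewrite mulr_ge0 ?(ltW (mu_gt0 CP))// subr_ge0 ltW//.
  exact: lt_trans (mu_gt_beta CP) (mu_lt1 CP).
by rewrite mulrC -ltr_pdivlMr.
Qed.

(** The level of the overview. By [rejected_payoff], B below [m0] forces a rejection probability
    below [eta]; the weight is taken at [tauP], where [disc_surv] is smallest. *)
Let m0 := VA + eta * (disc_surv E tauP * y * (mu E - beta E)).

Let m0_gt : VA < m0.
Proof.
rewrite ltrDl mulr_gt0// mulr_gt0 ?subr_gt0 ?(mu_gt_beta CP)//.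
by rewrite mulr_gt0// (disc_surv_gt0 EP)// ltW// (rc_gt0 CP).
Qed.

Let psi_gt0_below x : c <= x < d -> B x < m0 -> 0 < psi x.
Proof.
move=> /[dup] xI /andP[cx xd] Bx; have x0 := le_trans c0 cx.
apply: psi_gt0 => //; have [_] := andP (accept01 p x0).
rewrite le_eqVlt => /predU1P[->|a1]; first by rewrite subrr eta_gt0.
have W0 : 0 < disc_surv E x * y * (mu E - beta E).
  by rewrite -(Yc xI) weight_gt0// Yc.
rewrite -(ltr_pM2l W0) -[X in X * (1 - _)](congr1 (fun z => disc_surv E x * z * (mu E - beta E)) (Yc xI)).
rewrite -rejected_payoff// -B_E// ltrBlDl; apply: lt_le_trans Bx _.
rewrite lerD2l mulrC ler_wpM2r ?(ltW eta_gt0)//.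
rewrite ler_wpM2r ?subr_ge0 ?(ltW (mu_gt_beta CP))// ler_wpM2r ?(ltW y0)//.
by rewrite (disc_surv_nonincreasing CP)// ltW// (lt_le_trans xd).
Qed.

Let B_lt s t : c <= s -> s < t -> t <= d -> (forall x, s < x < t -> B x < m0) -> B s < B t.
Proof.
move=> cs st td Bx; have s0 := le_trans c0 cs.
rewrite (BB s0 (ltW st)) ltrDl; apply: Rintegral_itv_gt0 => //.
  exact: loc_integrableW s0 psi_loc_integrable.
move=> x /[dup] xI /andP[sx xt]; apply: psi_gt0_below; last exact: Bx.
by rewrite (le_trans cs (ltW sx)) (lt_le_trans xt).
Qed.

(* Once the accepted payoff exceeds VA it stays above VA until d, so news is
   rejected there and the principal's value falls, contradicting [dmax]. *)
Lemma gap_accepted_le x : c <= x < d -> B x <= VA.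
Proof.
move=> /andP[cx xd]; rewrite leNgt; apply/negP => BV.
(* The cap at [m0] ensures that B increases wherever it is below m. *)
pose m := Num.min (B x) m0.
have mV : VA < m by rewrite lt_min BV m0_gt.
(* If B were below m at t, then after its last time s at or above m it would stay below m, hence
   increase, and could not end lower than it was at s. *)
have stay t : x <= t < d -> m <= B t.
  move=> /andP[xt td]; rewrite leNgt; apply/negP => Bt.
  have mx : m <= B x by rewrite ge_min lexx.
  have [s [/andP[xs st] ms Hs]] := last_ge xt B_continuous mx Bt.
  have : B s < B t.
    apply: B_lt => //; [exact: le_trans xs|exact: ltW|].
    move=> z /andP[sz zt].
    have : B z < m by apply: Hs; rewrite sz ltW.
    by move=> /lt_le_trans; apply; rewrite ge_min lexx orbT.
  by rewrite ltNge (le_trans (ltW Bt)).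
have x0 := le_trans c0 cx.
(* [dmax] says nothing about c, and x may be c, so the fall of the value is measured from the
   interior point z. *)
pose z := (x + d) / 2.
have xz : x < z by rewrite /z; lra.
have zd : z < d by rewrite /z; lra.
have : value_P E p z <= value_P E p d.
  by apply: dmax; rewrite zd (le_lt_trans cx xz).
rewrite leNgt => /negP; apply.
apply: (value_P_gt CP) => //; first exact: le_trans (ltW xz).
move=> t /andP[zt td]; have xt := ltW (lt_trans xz zt).
have t0 := le_trans x0 xt.
have tI : c <= t < d by rewrite td (le_trans cx xt).
have a1 : accept p t < 1.
  have [_] := andP (accept01 p t0); rewrite le_eqVlt => /predU1P[a1|//].
  have := accepted_payoff_le t0 a1; rewrite -B_E// leNgt => /negP[].
  by apply: lt_le_trans mV _; apply: stay; rewrite xt.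
rewrite /drift_P pmulr_rlt0 ?expR_gt0//.
apply: le_lt_trans (lerB (rejected_gain CP eqa t0 a1) (lexx _)) _.
rewrite sub0r oppr_lt0 !mulr_gt0 ?(rg_rho EP) ?(theta_gt0 CP) ?(survival_gt0 EP)//.
exact: survA_gt0.
Qed.

(** The weak bound keeps B below [m0] throughout the gap, so B increases strictly and lies below its
    value at a later time z. *)
Lemma gap_accepted_lt x : c <= x < d -> accepted_payoff E p x < VA.
Proof.
move=> /[dup] xI /andP[cx xd]; rewrite -B_E//.
pose z := (x + d) / 2.
have xz : x < z by rewrite /z; lra.
have zd : z < d by rewrite /z; lra.
apply: (@lt_le_trans _ _ (B z)); last first.
  by apply: gap_accepted_le; rewrite zd (le_trans cx (ltW xz)).
apply: B_lt => //; first exact: ltW.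
move=> t /andP[xt tz]; apply: le_lt_trans m0_gt; apply: gap_accepted_le.
by rewrite (le_trans cx (ltW xt)) (lt_trans tz).
Qed.

Lemma gap_inactive x : c <= x < d -> ~ active (fake p) x%:E.
Proof.
move=> /[dup] xI /andP[cx xd]; apply: fake_inactive; first exact: le_trans cx.
  by rewrite Yc.
exact: gap_accepted_lt.
Qed.

Lemma gap_value_P_lt : value_P E p c < value_P E p d.
Proof.
apply: (value_P_lt CP) => // x /andP[cx xd].
apply: inactive_drift_P_gt0; first exact: le_trans (ltW cx).
  exact: lt_le_trans dT.
by apply: gap_inactive; rewrite xd ltW.
Qed.

End Gap.
End GapLemma.

Section Neighbourhoods.
Context {R : realType}.
Implicit Types (f : R -> R) (t v : R).

Lemma continuous_nbhd_lt f t v : continuous f -> f t < v ->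
  exists2 e, 0 < e & forall x, `|x - t| < e -> f x < v.
Proof.
move=> cf ftv.
have /nbhs_ballP[e /= e0 He] : \forall x \near t, f x < v.
  exact: (cvgr_lt (f t) (cf t) _ ftv).
by exists e => // x xt; apply: He; rewrite /ball/= distrC.
Qed.

Lemma continuous_nbhd_gt f t v : continuous f -> v < f t ->
  exists2 e, 0 < e & forall x, `|x - t| < e -> v < f x.
Proof.
move=> cf ftv.
have /nbhs_ballP[e /= e0 He] : \forall x \near t, v < f x.
  exact: (cvgr_gt (f t) (cf t) _ ftv).
by exists e => // x xt; apply: He; rewrite /ball/= distrC.
Qed.

Lemma continuous_le_left f a t v : continuous f -> a < t ->
  (forall x, a < x < t -> f x <= v) -> f t <= v.
Proof.
move=> cf at_ H; rewrite leNgt; apply/negP => /(continuous_nbhd_gt cf)[e e0 He].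
pose x := t - Num.min e (t - a) / 2.
have ta0 : 0 < t - a by rewrite subr_gt0.
have m0 : 0 < Num.min e (t - a) by rewrite lt_min e0.
have me : Num.min e (t - a) <= e by rewrite ge_min lexx.
have ma : Num.min e (t - a) <= t - a by rewrite ge_min lexx orbT.
have xt : x < t by rewrite /x; lra.
have ax : a < x by rewrite /x; lra.
have : v < f x by apply: He; rewrite distrC ger0_norm ?subr_ge0 ?(ltW xt)// /x; lra.
by rewrite ltNge H// ax.
Qed.

End Neighbourhoods.

(** Everything that the conclusions on cdfs, supports and uniqueness draw from an equilibrium. The
    four inactivity clauses are pointwise, so that [law] vanishes at once on sets that avoid the
    interval. *)
Record determined (R : realType) (E : game R) (tauP : R) (p : profile R) (t1 : R) : Prop :=
  Determined {
  det_itv : 0 < t1 < tauP;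
  det_sigma : 1 - expR (- cum_fake_rate E t1 tauP) = sigma E;
  det_accept : forall t, 0 <= t -> accept p t = 1;
  det_fake_before : forall t, 0 <= t < t1 -> strat_cdf (fake p) t = 0;
  det_fake_itv : forall t, t1 <= t <= tauP ->
    strat_cdf (fake p) t = (sigma E)^-1 * (1 - expR (- cum_fake_rate E t1 t));
  det_fake_after : forall t, tauP <= t -> strat_cdf (fake p) t = 1;
  det_stop_before : forall t, 0 <= t < t1 -> strat_cdf (stop p) t = 0;
  det_stop_itv : forall t, t1 <= t < tauP ->
    strat_cdf (stop p) t = 1 - expR (- cum_stop_rate E t1 t);
  det_stop_after : forall t, tauP <= t -> strat_cdf (stop p) t = 1;
  det_fake_inactive : forall t, 0 <= t < t1 -> ~ active (fake p) t%:E;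
  det_fake_inactive_after : forall t : \bar R, (tauP%:E < t)%E -> ~ active (fake p) t;
  det_stop_inactive : forall t, 0 <= t < t1 -> ~ active (stop p) t%:E;
  det_stop_inactive_after : forall t : \bar R, (tauP%:E < t)%E -> ~ active (stop p) t
}.

(** * Shape of an equilibrium with beneficial search *)

Section Necessity.
Context {R : realType} (E : game R) (tauP : R) (CP : regular_cutoff E tauP).
Local Notation leb := (@lebesgue_measure R).
Let EP := rc_game CP.
Variable p : profile R.
Hypotheses (eqA : AIC E p) (eqa : PICa E p) (eqt : PICt E p).
Variables (VA VP : R).
Hypothesis VA_ge : forall t, 0 <= t -> agent_payoff E p t <= VA.
Hypothesis VA_eq : forall t, 0 <= t -> active (fake p) t%:E -> agent_payoff E p t = VA.
Hypothesis VA_oo : active (fake p) +oo%E -> VA = value_A E p tauP.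
Hypothesis VP_att : exists2 r, 0 <= r <= tauP & value_P E p r = VP.
Hypothesis VP_ge : forall t, 0 <= t -> value_P E p t <= VP.
Hypothesis VP_eq : forall t, 0 <= t -> active (stop p) t%:E -> value_P E p t = VP.
Hypothesis VP_gt : theta E < VP.
Implicit Types s t x : R.

(** The first maximiser of u_P. It is positive because u_P(0) = theta while VP > theta, which is
    where beneficial search enters. *)
Lemma exists_first_stop : exists t1, [/\ 0 < t1 <= tauP, value_P E p t1 = VP &
  forall x, 0 <= x < t1 -> value_P E p x < VP].
Proof.
have [r /andP[r0 rT] rV] := VP_att.
have [||t1 [/andP[t10 t1r] V1 H]] := first_ge r0 (@value_P_continuous _ _ EP p) (m := VP).
- by rewrite value_P0.
- by rewrite rV.
exists t1; split => //; first by rewrite t10 (le_trans t1r).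
by apply/eqP; rewrite eq_le V1 VP_ge// ltW.
Qed.

Variable t1 : R.
Hypothesis t1_gt0 : 0 < t1.
Hypothesis t1_le : t1 <= tauP.
Hypothesis t1_VP : value_P E p t1 = VP.
Hypothesis t1_first : forall x, 0 <= x < t1 -> value_P E p x < VP.

Lemma stop_inactive x : 0 <= x -> value_P E p x < VP -> ~ active (stop p) x%:E.
Proof. by move=> x0 xV /(VP_eq x0) e; move: xV; rewrite e ltxx. Qed.

Lemma stop_before x : 0 <= x < t1 -> strat_cdf (stop p) x = 0.
Proof.
move=> /andP[x0 xt]; apply: strat_cdf_inactive0 => t /andP[t0 tx].
by apply: stop_inactive => //; apply: t1_first; rewrite t0 (le_lt_trans tx).
Qed.

Lemma survP_before x : 0 <= x < t1 -> survP p x = 1.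
Proof. by move=> /stop_before; rewrite /survP => ->; rewrite subr0. Qed.

Lemma value_before x : 0 < x < t1 -> value_P E p x <= value_P E p t1.
Proof. by move=> /andP[x0 _]; rewrite t1_VP VP_ge// ltW. Qed.

Lemma payoff_before x : 0 <= x < t1 -> accepted_payoff E p x < VA.
Proof.
exact: (gap_accepted_lt CP eqa VA_ge VA_eq (lexx 0) t1_le ltr01 survP_before value_before).
Qed.

Lemma fake_inactive_before x : 0 <= x < t1 -> ~ active (fake p) x%:E.
Proof.
exact: (gap_inactive CP eqa VA_ge VA_eq (lexx 0) t1_le ltr01 survP_before value_before).
Qed.

(** The left limit of B at t1: Y is replaced by its left limit 1, since an atom of F_P at t1 is not
    yet excluded. *)
Lemma payoff_limit : value_A E p t1 + disc_surv E t1 * (mu E - beta E) <= VA.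
Proof.
apply: (@continuous_le_left _
  (fun x => value_A E p x + disc_surv E x * (mu E - beta E)) 0) => //.
  move=> x; apply: cvgD; first exact: value_A_continuous.
  by apply: cvgM; [exact: disc_surv_continuous|exact: cvg_cst].
move=> x /andP[x0 xt]; have xI : 0 <= x < t1 by rewrite ltW.
by have := ltW (payoff_before xI); rewrite /accepted_payoff survP_before// mulr1.
Qed.

(** Suppose u_P is below its maximum at x although the principal stops after x with positive
    probability. The last maximiser c before x and the first one d after x then bound an interval
    without stopping, on which [gap_value_P_lt] makes u_P(d) exceed the maximum attained at c. *)
Lemma stop_value x : t1 <= x -> strat_cdf (stop p) x < 1 -> value_P E p x = VP.
Proof.
move=> tx Fx; have x0 := le_trans (ltW t1_gt0) tx.
apply/eqP; rewrite eq_le VP_ge//= leNgt; apply/negP => xV.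
have [t xt at_] : exists2 t : \bar R, (x%:E < t)%E & active (stop p) t.
  apply: contrapT => na; move: Fx; rewrite (strat_cdf_inactive1 x0) ?ltxx//.
  by move=> t xt at_; apply: na; exists t.
have t0 : (0 <= t)%E by apply: le_trans (ltW xt); rewrite lee_fin.
have [y yE /andP[y0 yT]] := active_stop_le CP eqa eqt t0 at_.
rewrite {}yE lte_fin in xt at_ t0 *.
have Vy : VP <= value_P E p y by rewrite VP_eq.
have V1 : VP <= value_P E p t1 by rewrite t1_VP.
have cV := @value_P_continuous _ _ EP p.
have [c [/andP[tc cx] Vc Hc]] := last_ge tx cV V1 xV.
have [d [/andP[xd dy] Vd Hd]] := first_ge (ltW xt) cV xV Vy.
have c0 := le_trans (ltW t1_gt0) tc.
have cd := lt_trans cx xd.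
have na s : c < s < d -> ~ active (stop p) s%:E.
  move=> /andP[cs sd]; apply: stop_inactive; first exact: le_trans (ltW cs).
  have [sx|sx] := leP s x; first by apply: Hc; rewrite cs.
  by apply: Hd; rewrite (ltW sx).
have Fc s : c <= s < d -> strat_cdf (stop p) s = strat_cdf (stop p) c.
  move=> /andP[cs sd]; apply: strat_cdf_inactive => // u /andP[cu us].
  by apply: na; rewrite cu (le_lt_trans us).
have Y0 : 0 < survP p c.
  by rewrite subr_gt0 -(Fc x)// xd ltW.
have Yc s : c <= s < d -> survP p s = survP p c by move=> /Fc; rewrite /survP => ->.
have dmax s : c < s < d -> value_P E p s <= value_P E p d.
  by move=> /andP[cs _]; apply: le_trans Vd; rewrite VP_ge// (le_trans c0)// ltW.
have := gap_value_P_lt CP eqa VA_ge VA_eq c0 cd (le_trans dy yT) Y0 Yc dmax.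
rewrite ltNge (le_trans _ Vc)// VP_ge//; exact: le_trans (ltW cd).
Qed.

(** T of the overview. Whether F_P equals 1 at T itself is open until [last_stopE]. *)
Definition last_stop := sup [set x | 0 <= x /\ strat_cdf (stop p) x < 1].
Let T := last_stop.
Let S := [set x : R | 0 <= x /\ strat_cdf (stop p) x < 1].

Let S_ub x : S x -> x <= tauP.
Proof.
move=> [x0 Fx]; rewrite leNgt; apply/negP => /ltW xT.
have := survP_after CP eqa eqt xT; rewrite /survP => /eqP.
by rewrite subr_eq0 => /eqP e; move: Fx; rewrite -e ltxx.
Qed.

Let S_before x : 0 <= x < t1 -> S x.
Proof. by move=> /[dup] /andP[x0 _] /stop_before F0; split; rewrite ?F0. Qed.

Let S_sup : has_sup S.
Proof.
split; last by exists tauP => x /S_ub.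
by exists 0; apply: S_before; rewrite lexx.
Qed.

Lemma last_stop_le : T <= tauP.
Proof. by apply: ge_sup; [case: S_sup|move=> x /S_ub]. Qed.

Lemma last_stop_lt x : 0 <= x < T -> strat_cdf (stop p) x < 1.
Proof.
move=> /andP[x0 xT]; have d0 : 0 < T - x by rewrite subr_gt0.
have [y [y0 Fy]] := sup_adherent d0 S_sup; rewrite subKr => xy.
by apply: le_lt_trans Fy; apply: strat_cdf_nondecreasing; exact: ltW.
Qed.

Lemma last_stop_gt x : 0 <= x -> T < x -> strat_cdf (stop p) x = 1.
Proof.
move=> x0 Tx; apply/eqP; rewrite eq_le strat_cdf_le1/= leNgt; apply/negP => Fx.
have : x <= T by apply: ub_le_sup; [case: S_sup|split].
by rewrite leNgt Tx.
Qed.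

Lemma first_le_last : t1 <= T.
Proof.
rewrite leNgt; apply/negP => Tt.
have T0 : 0 <= T by apply: ub_le_sup; [case: S_sup|apply: S_before; rewrite lexx].
pose x := (T + t1) / 2.
have Tx : T < x by rewrite /x; lra.
have xt : x < t1 by rewrite /x; lra.
have : x <= T.
  apply: ub_le_sup; first by case: S_sup.
  by apply: S_before; rewrite xt (le_trans T0)// ltW.
by rewrite leNgt Tx.
Qed.

Let t1T := first_le_last.
Let T0 : 0 < T := lt_le_trans t1_gt0 t1T.

Let survP_gt0 x : 0 <= x < T -> 0 < survP p x.
Proof. by move=> /last_stop_lt; rewrite subr_gt0. Qed.

Let survP_T x : T < x -> survP p x = 0.
Proof.
by move=> Tx; rewrite /survP last_stop_gt ?subrr// ltW// (lt_trans T0).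
Qed.

(** At T the cdf may already be 1, so [stop_value] does not apply; the value there comes by
    continuity from the left. *)
Lemma stop_value_itv x : t1 <= x <= T -> value_P E p x = VP.
Proof.
have lt y : t1 <= y -> y < T -> value_P E p y = VP.
  move=> ty yT; apply: stop_value => //; apply: last_stop_lt.
  by rewrite yT (le_trans (ltW t1_gt0)).
move=> /andP[tx]; rewrite le_eqVlt => /predU1P[->|xT]; last exact: lt.
have := t1T; rewrite -/T le_eqVlt => /predU1P[<-//|tT].
apply/eqP; rewrite eq_le VP_ge ?(ltW T0)//=.
rewrite -lerN2; apply: (@continuous_le_left _ (fun x => - value_P E p x) t1) => //.
  by move=> y; apply: cvgN; exact: value_P_continuous.
by move=> y /andP[ty yT]; rewrite lerN2 lt// ltW.
Qed.

Lemma drift_P_ae0 : {ae leb, forall x, t1 < x < T -> drift_P E p x = 0}.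
Proof.
apply: (const_Rintegral_ae0 (c := VP - theta E) (ltW t1_gt0)).
  exact: drift_P_loc_integrable.
move=> t /andP[tt tT]; have := @stop_value_itv t; rewrite !ltW//= => /(_ isT) <-.
by rewrite /value_P addrAC subrr add0r.
Qed.

(** Zero drift equates a N with a positive delay cost, so [rejected_gain] excludes any rejection.
    With a = 1 the equation determines the density of F_A, which is positive before [tauP]; the
    agent is then active at s, hence indifferent. *)
Lemma drift_P0 s : t1 < s < T -> drift_P E p s = 0 ->
  [/\ accept p s = 1, sigma E * dens (fake p) s = fake_rate E s * survA E p s &
      accepted_payoff E p s = VA].
Proof.
move=> /andP[ts sT] d0; have s0 : 0 < s := lt_trans t1_gt0 ts.
have s0' := ltW s0.
have sTT : s < tauP := lt_le_trans sT last_stop_le.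
have X0 := survA_gt0 EP p s.
have W0 : 0 < (1 - G E s) * survA E p s by rewrite mulr_gt0// (survival_gt0 EP).
have e : accept p s * news_gain E p s = rho E * theta E * (1 - G E s) * survA E p s.
  move/eqP: d0; rewrite mulf_eq0 gt_eqF ?expR_gt0//= subr_eq0 => /eqP//.
have aN0 : 0 < accept p s * news_gain E p s.
  by rewrite e -mulrA mulr_gt0// mulr_gt0 ?(rg_rho EP) ?(theta_gt0 CP).
have a1 : accept p s = 1.
  have [_] := andP (accept01 p s0'); rewrite le_eqVlt => /predU1P[//|a1].
  by have := rejected_gain CP eqa s0' a1; rewrite leNgt aN0.
have tm0 : 0 < theta E - mu E by rewrite subr_gt0 (mu_lt_theta CP).
have de : sigma E * dens (fake p) s = fake_rate E s * survA E p s.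
  move: e; rewrite a1 mul1r /news_gain (gE EP s0') => e.
  have fr : (theta E - mu E) * fake_rate E s =
      mu E * (1 - theta E) * HR E s - rho E * theta E.
    by rewrite /fake_rate mulrC divfK// gt_eqF.
  apply: (mulfI (lt0r_neq0 tm0)); apply: (mulIf (lt0r_neq0 (survival_gt0 EP s0'))).
  rewrite [in RHS]mulrA fr.
  transitivity (mu E * (1 - theta E) * (HR E s * (1 - G E s)) * survA E p s
    - rho E * theta E * (1 - G E s) * survA E p s); last by ring.
  rewrite -e; ring.
have act : active (fake p) s%:E.
  left; have /andP[sg0 _] := rg_sigma EP.
  rewrite -(pmulr_rgt0 _ sg0) de mulr_gt0// divr_gt0// (principal_margin_gt0 CP)//.
split => //.
by rewrite -(VA_eq s0' act) /agent_payoff a1 mulr1.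
Qed.

Lemma ae_accepted_eq s t : t1 <= s -> s < t -> t <= T ->
  exists2 x, s < x < t & accepted_payoff E p x = VA.
Proof.
move=> ts st tT; have [x /andP[sx xt] dx] := ae_in_itv st drift_P_ae0.
exists x; first by rewrite sx.
have xI : t1 < x < T by rewrite (le_lt_trans ts sx) (lt_le_trans xt tT).
by have [] := drift_P0 xI (dx xI).
Qed.

(** B with Y frozen at z: continuous in x and monotone in z. *)
Let b z x := value_A E p x + disc_surv E x * (z * (mu E - beta E)).

Let b_continuous z : continuous (b z).
Proof.
move=> x; apply: cvgD; first exact: value_A_continuous.
by apply: cvgM; [exact: disc_surv_continuous|exact: cvg_cst].
Qed.

Let bE x : accepted_payoff E p x = b (survP p x) x.
Proof. by rewrite /accepted_payoff /b mulrA. Qed.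

Let b_le z z' x : 0 <= x -> z <= z' -> b z x <= b z' x.
Proof.
move=> x0 zz; rewrite lerD2l ler_wpM2l ?(ltW (disc_surv_gt0 EP x0))//.
by rewrite ler_wpM2r// subr_ge0 ltW// (mu_gt_beta CP).
Qed.

Let survP_mono x y : x <= y -> survP p y <= survP p x.
Proof. by move=> xy; rewrite lerD2l lerN2 strat_cdf_nondecreasing. Qed.

(* The payoff equals VA only almost everywhere; monotonicity of the stopping
   probability transfers the equality to every point. *)
Lemma accepted_eq t : t1 <= t < T -> accepted_payoff E p t = VA.
Proof.
move=> /andP[tt tT]; have t0 := le_trans (ltW t1_gt0) tt.
apply/eqP; rewrite eq_le; apply/andP; split; rewrite leNgt; apply/negP.
  (* At t1 there are no points of [[t1, T]] on the left to compare with; the limit from before t1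
     takes their place. *)
  have [->|tne] := eqVneq t t1.
    rewrite ltNge bE => /negP[]; apply: le_trans payoff_limit.
    rewrite -[mu E - beta E]mul1r; apply: (b_le (z' := 1)); [exact: ltW|exact: survP_le1].
  have {tne}t1t : t1 < t by rewrite lt_neqAle eq_sym tne.
  (* To the left of t the function Y is at least [survP p t], so an excess of B at t persists there.
     A deficit persists to the right, where Y is at most [survP p t]. *)
  rewrite bE => /(continuous_nbhd_gt (@b_continuous _))[e e0 He].
  pose u := Num.max t1 (t - e).
  have ut : u < t by rewrite gt_max t1t ltrBlDr ltrDl.
  have t1u : t1 <= u by rewrite le_max lexx.
  have eu : t - e <= u by rewrite le_max lexx orbT.
  have [x /andP[ux xt] xV] := ae_accepted_eq t1u ut (ltW tT).
  have x0 : 0 <= x by rewrite (le_trans (ltW t1_gt0))// (le_trans t1u)// ltW.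
  have : VA < b (survP p t) x.
    by apply: He; rewrite distrC ger0_norm ?subr_ge0 ?(ltW xt)//; lra.
  by rewrite ltNge -xV bE b_le// survP_mono// ltW.
rewrite bE => /(continuous_nbhd_lt (@b_continuous _))[e e0 He].
pose u := Num.min T (t + e).
have tu : t < u by rewrite lt_min tT ltrDl.
have uT : u <= T by rewrite ge_min lexx.
have eu : u <= t + e by rewrite ge_min lexx orbT.
have [x /andP[tx xu] xV] := ae_accepted_eq tt tu uT.
have x0 : 0 <= x by rewrite (le_trans t0)// ltW.
have : b (survP p t) x < VA.
  by apply: He; rewrite ger0_norm ?subr_ge0 ?(ltW tx)//; lra.
by rewrite ltNge -xV bE b_le// survP_mono// ltW.
Qed.

Lemma accept_before_last x : 0 <= x < T -> accept p x = 1.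
Proof.
move=> /[dup] xI /andP[x0 xT].
apply: (accept_of_payoff_le CP eqa VA_eq x0 (survP_gt0 xI)).
have [xt|tx] := ltP x t1; first by rewrite ltW// payoff_before// x0.
by rewrite accepted_eq// tx.
Qed.

Lemma no_atom_before_last x : 0 <= x < T -> atom (fake p) x = 0.
Proof.
move=> /[dup] xI /andP[x0 xT]; apply/eqP; rewrite eq_le atom_ge0// andbT leNgt.
apply/negP => /(atom_rejected CP eqa x0) /eqP.
by rewrite accept_before_last// oner_eq0.
Qed.

(** Indifference identifies q with (1 - G) Y (mu - beta) e^{-rho x} on [[t1, T[], which makes -K'
    equal to - [cq] q. Being continuous, q is controlled up to T included, although Y jumps
    there. *)
Let q x := VA - value_A E p x.
Let cq x := (mu E * (1 - beta E) * HR E x - rho E * beta E) / (mu E - beta E).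

Let q_continuous : continuous q.
Proof. by move=> x; apply: cvgB; [exact: cvg_cst|exact: value_A_continuous]. Qed.

Let qE x : t1 <= x < T -> q x = disc_surv E x * survP p x * (mu E - beta E).
Proof. by move=> /accepted_eq e; rewrite /q -e /accepted_payoff; ring. Qed.

Lemma agent_ode t : t1 <= t <= T ->
  q t = q t1 * expR (- \int[leb]_(x in `[t1, t]) cq x).
Proof.
apply: (linear_ode (ltW t1_gt0)) => //; first exact: (affine_HR_continuous EP).
move=> {}t /andP[tt tT]; have t0 := ltW t1_gt0.
rewrite {1}/q (value_AB EP p t0 tt) opprD addrA; congr (_ - _).
apply: ae_eq_Rintegral.
- exact: loc_integrableW (drift_A_loc_integrable EP p).
- have : {within `[0, +oo[, continuous (fun x => cq x * q x)}.
    apply: within_continuousM; first exact: (affine_HR_continuous EP).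
    exact: continuous_subspaceT.
  move=> /(within_continuous_integrable t t0)/integrableP[/measurable_EFinP].
  by [].
- apply: aeW => x /andP[tx xt]; have xT := lt_le_trans xt tT.
  have x0 : 0 <= x by rewrite (le_trans t0)// ltW.
  rewrite qE ?(ltW tx)// /drift_A accept_before_last ?x0// (gE EP x0) /cq /disc_surv.
  by field; rewrite subr_eq0 gt_eqF// (mu_gt_beta CP).
Qed.

Let q1_gt0 : 0 < q t1.
Proof.
have := payoff_limit; rewrite addrC -lerBrDr; apply: lt_le_trans.
by rewrite mulr_gt0 ?subr_gt0 ?(mu_gt_beta CP)// (disc_surv_gt0 EP)// ltW.
Qed.

(** The solution q starts positive and is multiplied by an exponential, so it is still positive at
    T: an agent who waits beyond T forgoes a fixed amount. *)
Lemma value_A_last : value_A E p T < VA.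
Proof.
rewrite -subr_gt0 -/(q T) agent_ode ?t1T ?lexx//.
by rewrite mulr_gt0 ?expR_gt0.
Qed.

Let value_A_after t : T <= t -> value_A E p t = value_A E p T.
Proof.
move=> Tt; apply: (value_A_const CP) => //; first exact: ltW.
by move=> x /andP[Tx _]; exact: survP_T.
Qed.

Lemma fake_inactive_after (t : \bar R) : (T%:E < t)%E -> ~ active (fake p) t.
Proof.
case: t => [t||//].
  rewrite lte_fin => Tt /VA_eq e; move: value_A_last.
  rewrite -e; last by rewrite ltW// (lt_trans T0).
  by rewrite /agent_payoff survP_T// mulr0 !mul0r addr0 value_A_after ?ltxx// ltW.
move=> _ /VA_oo e; move: value_A_last.
by rewrite e value_A_after ?ltxx// last_stop_le.
Qed.

Lemma no_atom_last : atom (fake p) T = 0.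
Proof.
apply/eqP; rewrite eq_le atom_ge0 ?(ltW T0)// andbT leNgt; apply/negP => aT.
have := VA_eq (ltW T0) (or_intror aT).
rewrite /agent_payoff (atom_rejected CP eqa (ltW T0) aT) mulr0 addr0 => e.
by move: value_A_last; rewrite e ltxx.
Qed.

Lemma fake_last : strat_cdf (fake p) T = 1.
Proof. by apply: strat_cdf_inactive1; [exact: ltW|exact: fake_inactive_after]. Qed.

(** F_A has no atom on [[0, T]], so there [survA] equals this function, which is continuous on the
    whole line as [linear_ode] requires. *)
Let X x := 1 - sigma E * \int[leb]_(s in `[0, x]) dens (fake p) s.

Let XE x : 0 <= x <= T -> survA E p x = X x.
Proof.
move=> /andP[x0 xT]; rewrite /survA strat_cdf_no_atom// => s /andP[s0 sx].
have := le_trans sx xT; rewrite le_eqVlt => /predU1P[->|sT].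
  exact: no_atom_last.
by apply: no_atom_before_last; rewrite s0.
Qed.

Lemma survA_formula t : t1 <= t <= T ->
  survA E p t = expR (- cum_fake_rate E t1 t).
Proof.
have t0 := ltW t1_gt0; have ld := @dens_loc_integrable _ (fake p).
move=> tI; rewrite XE; last first.
  by have /andP[tt ->] := tI; rewrite (le_trans t0 tt).
have X1 : X t1 = 1.
  rewrite /X (@ae_eq_Rintegral _ _ (fun=> 0)).
  - by rewrite Rintegral_cst// mul0r mulr0 subr0.
  - exact: ld.
  - exact: measurable_cst.
  - apply: aeW => x /andP[x0 xt]; have x0' := ltW x0.
    by case: (inactive_dens0 x0' (@fake_inactive_before x _)) => //; rewrite x0'.
rewrite -[RHS]mul1r -X1.
have cX : continuous X.
  move=> x; apply: cvgB; first exact: cvg_cst.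
  apply: cvgM; first exact: cvg_cst.
  exact: (continuous_Rintegral0 ld).
have cfr : {within `[0, +oo[, continuous (fake_rate E)} by exact: (affine_HR_continuous EP).
apply: (linear_ode t0 cfr cX) tI => {}t /andP[tt tT].
have iX : X t = X t1 - \int[leb]_(x in `[t1, t]) (sigma E * dens (fake p) x).
  rewrite RintegralZl//; last exact: loc_integrableW.
  by rewrite /X (Rintegral0_itv_cat t0 tt ld); ring.
rewrite iX; congr (_ - _); apply: ae_eq_Rintegral.
- exact: loc_integrableW (loc_integrableZ _ ld).
- have : {within `[0, +oo[, continuous (fun x => fake_rate E x * X x)}.
    apply: within_continuousM => //; exact: continuous_subspaceT.
  move=> /(within_continuous_integrable t t0)/integrableP[/measurable_EFinP].
  by [].
- move: drift_P_ae0; apply: filterS; first exact: (ae_filter_ringOfSetsType leb).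
  move=> x H /andP[tx xt]; have xT := lt_le_trans xt tT.
  have xI : t1 < x < T by rewrite tx.
  have [_ -> _] := drift_P0 xI (H xI).
  by rewrite XE// (ltW xT) ltW// (lt_trans t1_gt0).
Qed.

Lemma last_stopE : T = tauP.
Proof.
apply/eqP; rewrite eq_le last_stop_le/= leNgt; apply/negP => TT.
have : value_P E p T < value_P E p tauP.
  apply: (value_P_lt CP) => //; first exact: ltW.
  move=> x /andP[Tx xT]; apply: (inactive_drift_P_gt0 CP eqa) => //.
    by rewrite ltW// (lt_trans T0).
  by apply: fake_inactive_after; rewrite lte_fin.
rewrite stop_value_itv ?t1T ?lexx// ltNge VP_ge// ltW//.
exact: (rc_gt0 CP).
Qed.

Lemma survA_last : 1 - expR (- cum_fake_rate E t1 tauP) = sigma E.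
Proof.
rewrite -last_stopE -survA_formula ?t1T ?lexx//.
by rewrite /survA fake_last; ring.
Qed.

Lemma first_lt_cutoff : t1 < tauP.
Proof.
rewrite lt_neqAle t1_le andbT; apply/eqP => e.
have /andP[sg0 _] := rg_sigma EP.
move: survA_last; rewrite -e /cum_fake_rate set_itv1 Rintegral_set1 oppr0 expR0 subrr.
by move=> s0; move: sg0; rewrite -s0 ltxx.
Qed.

(** An atom of F_P at t1 would make B jump down there, but B(t1) = VA is at least the left limit. *)
Lemma survP_first : survP p t1 = 1.
Proof.
have t0 := ltW t1_gt0.
have t1I : t1 <= t1 < T by rewrite lexx last_stopE first_lt_cutoff.
apply/eqP; rewrite eq_le survP_le1/=.
have := payoff_limit; rewrite -(accepted_eq t1I) /accepted_payoff lerD2l.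
rewrite [X in _ <= X]mulrAC ler_pMr//.
by rewrite mulr_gt0 ?subr_gt0 ?(mu_gt_beta CP)// (disc_surv_gt0 EP).
Qed.

(** q = e^{-rho t} (1 - G) Y (mu - beta) decays at rate [cq] and e^{-rho t} (1 - G) at rate
    [rho E + HR E]; Y decays at the difference, which is [stop_rate E]. *)
Lemma survP_formula t : t1 <= t < tauP ->
  survP p t = expR (- cum_stop_rate E t1 t).
Proof.
move=> tI; have t0 := ltW t1_gt0; have /andP[tt tTT] := tI.
have mb : mu E - beta E != 0 by rewrite subr_eq0 gt_eqF// (mu_gt_beta CP).
have t1I : t1 <= t1 < T by rewrite lexx last_stopE first_lt_cutoff.
have Y1 := survP_first.
have tT : t1 <= t < T by rewrite tt last_stopE.
have ch := hazard_rate_continuous EP.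
have hode := disc_surv_expE EP t0 tt.
have := @agent_ode t; rewrite (ltW (lt_le_trans tTT _)) ?last_stopE// tt => /(_ isT).
rewrite (qE tT) (qE t1I) Y1 hode mulr1 => e.
have h1 : disc_surv E t1 * (mu E - beta E) != 0.
  by rewrite mulf_neq0// gt_eqF// (disc_surv_gt0 EP).
have i1 := within_continuous_integrable t t0 ch.
have i2 : leb.-integrable `[t1, t] (EFin \o cq).
  by apply: (within_continuous_integrable t t0); exact: (affine_HR_continuous EP).
have -> : cum_stop_rate E t1 t = \int[leb]_(x in `[t1, t]) cq x
    - \int[leb]_(x in `[t1, t]) (rho E + HR E x).
  rewrite -RintegralB//; apply: eq_Rintegral => x _.
  by rewrite /stop_rate /cq; field.
rewrite opprB expRD; apply: (mulfI h1); move: e.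
set Ih := \int[leb]_(x in _) (rho E + HR E x); set Iq := \int[leb]_(x in _) cq x => e.
have ee : expR Ih * expR (- Ih) = 1 by rewrite -expRD subrr expR0.
transitivity (disc_surv E t1 * (mu E - beta E) * survP p t * (expR Ih * expR (- Ih))).
  by rewrite ee mulr1.
transitivity (expR Ih * (disc_surv E t1 * expR (- Ih) * survP p t * (mu E - beta E))).
  by ring.
rewrite e; ring.
Qed.

Lemma stop_cutoff x : tauP <= x -> strat_cdf (stop p) x = 1.
Proof.
move=> /(survP_after CP eqa eqt)/eqP; rewrite /survP subr_eq0 => /eqP.
by [].
Qed.

Lemma fake_before x : 0 <= x < t1 -> strat_cdf (fake p) x = 0.
Proof.
move=> /andP[x0 xt]; apply: strat_cdf_inactive0 => t /andP[t0 tx].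
by apply: fake_inactive_before; rewrite t0 (le_lt_trans tx).
Qed.

Lemma fake_cutoff x : tauP <= x -> strat_cdf (fake p) x = 1.
Proof.
move=> tx; apply/eqP; rewrite eq_le strat_cdf_le1/= -fake_last last_stopE.
exact: strat_cdf_nondecreasing.
Qed.

Lemma accept_everywhere x : 0 <= x -> accept p x = 1.
Proof.
move=> x0; have [xT|Tx] := ltP x T; first by rewrite accept_before_last// x0.
apply: (inactive_accept CP eqa x0).
move: Tx; rewrite le_eqVlt => /predU1P[<-|Tx]; last exact: fake_inactive_after.
move=> /(VA_eq (ltW T0)).
rewrite /agent_payoff (survP_after CP eqa eqt) ?last_stopE//.
rewrite mulr0 !mul0r addr0 -last_stopE => e.
by move: value_A_last; rewrite e ltxx.
Qed.

Let survA_before x : 0 <= x < t1 -> survA E p x = 1.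
Proof. by move=> /fake_before; rewrite /survA => ->; rewrite mulr0 subr0. Qed.

Let int_disc (c : R) :
  c * disc_surv E t1 = c - \int[leb]_(x in `[0, t1]) (c * disc_hazard E x).
Proof.
rewrite RintegralZl//; last exact: disc_hazard_loc_integrable.
by rewrite (disc_survE EP (ltW t1_gt0)); ring.
Qed.

(** VA is B(t1). Up to t1 the principal does not stop and accepts all type-1 news, as in the first
    best, whose terminal payoff mu is that of an accepted fake. *)
Lemma VA_uFB : VA = uFB_A E t1.
Proof.
have t0 := ltW t1_gt0.
have t1I : t1 <= t1 < T by rewrite lexx last_stopE first_lt_cutoff.
have ld := drift_A_loc_integrable EP p.
have lk := loc_integrableZ (beta E) (disc_hazard_loc_integrable EP).
rewrite -(accepted_eq t1I) /accepted_payoff survP_first mulr1 mulrBr.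
rewrite -[disc_surv E t1 * beta E]mulrC int_disc /value_A /uFB_A.
have -> : \int[leb]_(x in `[0, t1]) (expR (- (rho E * x)) * g E x * (mu E + (1 - mu E) * beta E))
    = \int[leb]_(x in `[0, t1]) drift_A E p x
      + \int[leb]_(x in `[0, t1]) (beta E * disc_hazard E x).
  rewrite -RintegralD//; apply: eq_Rintegral => x; rewrite inE/= in_itv/= => /andP[x0 xt].
  rewrite /drift_A /disc_hazard accept_everywhere//.
  have -> : survP p x = 1.
    move: xt; rewrite le_eqVlt => /predU1P[->|xt]; first exact: survP_first.
    by rewrite survP_before// x0.
  by ring.
by rewrite /disc_surv; ring.
Qed.

Lemma VP_uFB : VP = uFB_P E t1.
Proof.
have t0 := ltW t1_gt0.
have ld := drift_P_loc_integrable EP p.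
have lk := loc_integrableZ (theta E) (disc_hazard_loc_integrable EP).
rewrite -t1_VP /value_P /uFB_P.
have -> : \int[leb]_(x in `[0, t1]) (expR (- (rho E * x)) * g E x * (mu E + (1 - mu E) * theta E))
    = \int[leb]_(x in `[0, t1]) drift_P E p x
      + \int[leb]_(x in `[0, t1]) (theta E * disc_hazard E x).
  (* The value of the density of F_A at t1 itself is not determined, so the integrands are compared
     only inside the interval. *)
  rewrite -RintegralD//; apply/esym; apply: ae_eq_Rintegral.
  - exact: loc_integrableD ld lk t1.
  - apply: measurable_funM; last exact: measurable_cst.
    apply: measurable_funM; first exact: discount_measurable.
    exact: loc_integrable_measurable (g_loc_integrable EP).
  - apply: aeW => x /andP[/ltW x0 xt]; have xI : 0 <= x < t1 by rewrite x0.
    have [d0 _] := inactive_dens0 x0 (fake_inactive_before xI).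
    rewrite /drift_P /news_gain d0 survA_before// accept_everywhere// /disc_hazard.
    by ring.
rewrite -addrA; have := int_disc (theta E); rewrite /disc_surv => e.
by rewrite [_ * theta E]mulrC e; ring.
Qed.

Lemma first_stop_determined : determined E tauP p t1.
Proof.
have sg0 : sigma E != 0 by have /andP[/gt_eqF->] := rg_sigma EP.
split.
- by rewrite t1_gt0 first_lt_cutoff.
- exact: survA_last.
- exact: accept_everywhere.
- exact: fake_before.
- move=> t tI; have := @survA_formula t; rewrite -/T last_stopE => /(_ tI) <-.
  by rewrite /survA subKr mulrA mulVf// mul1r.
- exact: fake_cutoff.
- exact: stop_before.
- by move=> t /survP_formula <-; rewrite /survP subKr.
- exact: stop_cutoff.
- exact: fake_inactive_before.
- by move=> t; rewrite -last_stopE; exact: fake_inactive_after.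
- move=> t tI; have /andP[t0 _] := tI.
  by apply: stop_inactive => //; exact: t1_first.
- move=> t Tt at_.
  have t0 : (0 <= t)%E.
    by apply: le_trans (ltW Tt); rewrite lee_fin ltW// (rc_gt0 CP).
  have [r tE /andP[_ rT]] := active_stop_le CP eqa eqt t0 at_.
  by move: Tt; rewrite tE lte_fin ltNge rT.
Qed.

End Necessity.

Lemma beneficial_determined (R : realType) (E : game R) (tauP : R) (p : profile R) :
  regular_cutoff E tauP -> beneficial_equilibrium E p ->
  exists t1, [/\ determined E tauP p t1, payoffA E p = (uFB_A E t1)%:E &
    payoffP E p = (uFB_P E t1)%:E].
Proof.
move=> CP [[eqA eqa eqt]].
have [VP [VP_att VP_ge VP_eq ->]] := exists_principal_value CP eqa eqt.
have [VA [VA_ge VA_eq VA_oo ->]] := exists_agent_value CP eqA eqa eqt.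
rewrite lte_fin => VP_gt.
have [t1 [/andP[t1_gt0 t1_le] t1_VP t1_first]] := exists_first_stop CP VP_att VP_ge VP_gt.
exists t1; split; first exact: (first_stop_determined CP eqa eqt VA_ge VA_eq VA_oo VP_ge VP_eq t1_gt0 t1_le t1_VP t1_first).
- by congr EFin; exact: (VA_uFB CP eqa eqt VA_ge VA_eq VA_oo VP_ge VP_eq t1_gt0 t1_le t1_VP t1_first).
- by congr EFin; exact: (VP_uFB CP eqa eqt VA_ge VA_eq VA_oo VP_ge VP_eq t1_gt0 t1_le t1_VP t1_first).
Qed.

(** * Supports of mixed strategies *)

Section Support.
Context {R : realType}.
Implicit Types (S : strategy R) (a b x y : R).

Lemma open_preimage_EFin (U : set (\bar R)) : open U -> open [set t : R | U t%:E].
Proof.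
move=> oU; rewrite openE => r Ur.
have : nbhs r%:E U by exact: open_nbhs_nbhs.
by [].
Qed.

Lemma strat_support_itv S a b : 0 <= a -> a < b ->
  (forall x, 0 <= x < a -> ~ active S x%:E) ->
  (forall t : \bar R, (b%:E < t)%E -> ~ active S t) ->
  (forall x y, a <= x -> x < y -> y <= b -> strat_cdf S x < strat_cdf S y) ->
  strat_support S = [set t%:E | t in `[a, b]].
Proof.
move=> a0 ab na nb lt_cdf.
have n0 : mass_never S = 0.
  apply/eqP; rewrite eq_le mass_never_ge0 andbT leNgt; apply/negP => n0.
  exact: (nb +oo%E (ltry _) n0).
apply/seteqP; split=> [t tS|_ [r /= rI <-] U [oU Ur]].
  apply: contrapT => tI.
  (* The open complement of the interval in the extended line, which also covers [+oo] and negative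
     times. *)
  pose U : set (\bar R) := [set s | (s < a%:E)%E] `|` [set s | (b%:E < s)%E].
  have oU : open U.
    by apply: openU; [exact: open_ereal_lt_ereal|exact: open_ereal_gt_ereal].
  have Ut : U t.
    case: t tI {tS} => [r|_|_]; [|by right; rewrite /= ltry|by left; rewrite /= ltNyr].
    move=> rI; have [ra|ar] := ltP r a; first by left; rewrite /= lte_fin.
    have [rb|br] := leP r b; last by right; rewrite /= lte_fin.
    by exfalso; apply: rI; exists r => //=; rewrite in_itv/= ar.
  have := tS U (conj oU Ut).
  rewrite /law n0 mulr0 adde0 mass_inactive0 ?ltxx//.
  move=> x [/=]; rewrite timelineE => x0 [/=|/=]; rewrite lte_fin => xI.
    by apply: na; rewrite x0.
  by apply: (nb x%:E); rewrite lte_fin.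
rewrite /law n0 mulr0 adde0.
have oV := open_preimage_EFin oU.
have /nbhs_ballP[e /= e0 He] : nbhs r [set t : R | U t%:E] by exact: open_nbhs_nbhs.
have /andP[ar rb] : a <= r <= b by move: rI; rewrite in_itv.
(* The increment of the cdf is the mass of an interval []c, d]]: one to the right of r, or one to
   the left when r is b and may carry an atom. *)
have [c [d [ac cd db cdU]]] : exists c d : R,
    [/\ a <= c, c < d, d <= b & forall x, c < x <= d -> U x%:E].
  have [rltb|rgeb] := ltP r b.
    exists r, (Num.min b (r + e / 2)); split => //.
    - by rewrite lt_min rltb ltrDl divr_gt0.
    - by rewrite ge_min lexx.
    move=> x /andP[rx]; rewrite le_min => /andP[_ xe]; apply: He.
    by rewrite /ball/= distrC ger0_norm ?subr_ge0 ?(ltW rx)//; lra.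
  exists (Num.max a (r - e / 2)), b; split => //.
  - by rewrite le_max lexx.
  - by rewrite gt_max ab/=; lra.
  move=> x /andP[]; rewrite gt_max => /andP[_ ex] xb; apply: He.
  by rewrite /ball/= ger0_norm ?subr_ge0 ?(le_trans xb)//; lra.
have sub : `]c, d]%classic `<=` @timeline R `&` [set t | U t%:E].
  move=> x /=; rewrite in_itv/= => xI; split; last exact: cdU.
  by case/andP: xI => /ltW cx _; rewrite timelineE (le_trans a0)// (le_trans ac).
have c0 := le_trans a0 ac.
have : (0 < mass S `]c, d])%E.
  have := strat_cdfB S c0 (ltW cd).
  rewrite -(@fineK _ (mass S `]c, d])); last first.
    by apply: mass_fin_num => // x /sub[].
  by rewrite -EFinD lte_fin => -[e1]; have := lt_cdf _ _ ac cd db; rewrite e1 ltrDl.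
move=> /lt_le_trans; apply; apply: le_mass => //.
apply: measurableI; first exact: measurable_timeline.
exact: open_measurable.
Qed.

End Support.

(** * Existence *)

Section HazardStrategy.
Context {R : realType}.
Local Notation leb := (@lebesgue_measure R).
Variables (c : R -> R) (k m a b : R).
Hypotheses (c_cont : {within `[0, +oo[, continuous c}) (a0 : 0 <= a) (ab : a < b)
  (c0 : forall x, a <= x < b -> 0 <= c x) (k0 : 0 <= k) (m0 : 0 <= m).

Let W x := expR (- \int[leb]_(y in `[a, x]) c y).

Hypothesis mass1 : k * (1 - W b) + m <= 1.

(** One construction serves both players: hazard rate c on [[a, b[], scale k, and an atom m at b.
    Faking takes k = 1/sigma and m = 0; stopping takes k = 1 and puts the residual mass into m. *)
Definition hazard_dens : R -> R := (fun x => k * (c x * W x)) \_ `[a, b[.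
Definition hazard_atom (x : R) : R := if x == b then m else 0.

Let dens0 t : 0 <= t -> 0 <= hazard_dens t.
Proof.
move=> _; rewrite /hazard_dens patchE; case: ifPn => //.
by rewrite mem_setE in_itv/= => tI; rewrite !mulr_ge0 ?expR_ge0 ?c0.
Qed.

(* [W] restarted from 0, so that it is continuous on the whole line *)
Let W0 x := expR (\int[leb]_(y in `[0, a]) c y - \int[leb]_(y in `[0, x]) c y).

Let lc := within_continuous_loc_integrable c_cont.

Let WE x : a <= x -> W x = W0 x.
Proof.
move=> ax; rewrite /W /W0 (Rintegral0_itv_cat a0 ax lc); congr expR; ring.
Qed.

Let W0_cont : continuous W0.
Proof.
move=> x; apply: (@continuous_comp _ _ _ (fun x => _ - _) expR); last exact: continuous_expR.
by apply: cvgB; [exact: cvg_cst|exact: continuous_Rintegral0].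
Qed.

Let f x := k * (c x * W0 x).

Let lf : loc_integrable f.
Proof.
apply: loc_integrableZ; apply: within_continuous_loc_integrable.
exact: within_continuousM c_cont (continuous_subspaceT W0_cont).
Qed.

Let densE : hazard_dens = f \_ `[a, b[.
Proof.
apply/funext => x; rewrite /hazard_dens !patchE; case: ifPn => //.
by rewrite mem_setE in_itv/= => /andP[ax _]; rewrite WE.
Qed.

Let dens_meas : measurable_fun (@timeline R) hazard_dens.
Proof.
apply: (@measurable_funS _ _ _ _ setT) => //.
rewrite densE; apply/(measurable_restrictT _ _).1 => //.
have := loc_integrable_measurable (t := b) lf.
apply: measurable_funS => // x /=; rewrite !in_itv/= => /andP[/(le_trans a0)-> /ltW//].
Qed.

Let atom0 t : 0 <= t -> 0 <= hazard_atom t.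
Proof. by move=> _; rewrite /hazard_atom; case: eqP. Qed.

Let atom_count : countable [set t | 0 <= t /\ 0 < hazard_atom t].
Proof.
apply: sub_countable (countable1 b); apply: subset_card_le => x [_].
by rewrite /hazard_atom; case: eqP => // _; rewrite ltxx.
Qed.

Let int_f x : a <= x ->
  (\int[leb]_(y in `[a, x[) (f y)%:E = (k * (1 - W x))%:E)%E.
Proof.
move=> ax.
rewrite integral_itv_bndo_bndc; last first.
  apply/measurable_EFinP; apply: measurable_funS (loc_integrable_measurable (t := x) lf) => //.
  by move=> y /=; rewrite !in_itv/= => /andP[/(le_trans a0)-> /ltW].
rewrite -[LHS]fineK; last first.
  by apply: integrable_fin_num => //; exact: loc_integrableW lf.
congr EFin; rewrite -(one_sub_expR_Rintegral a0 ax c_cont).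
transitivity (\int[leb]_(y in `[a, x]) (k * (c y * W0 y))); first by [].
rewrite RintegralZl//; last first.
  apply: within_continuous_integrable => //.
  exact: within_continuousM c_cont (continuous_subspaceT W0_cont).
congr (_ * _); apply: eq_Rintegral => y; rewrite inE/= in_itv/= => /andP[ay _].
by rewrite -WE.
Qed.

Let dens_int (D : set R) :
  (\int[leb]_(y in D) (hazard_dens y)%:E = \int[leb]_(y in D `&` `[a, b[) (f y)%:E)%E.
Proof.
rewrite densE integral_mkcondr; apply: eq_integral => y _.
by rewrite !patchE; case: ifPn.
Qed.

Let atom_sum (D : set R) :
  (\esum_(y in D) (hazard_atom y)%:E = (if b \in D then m else 0)%:E)%E.
Proof.
rewrite (esum_restrict (P := [set b])); last first.
  by move=> y _ /= /eqP yb; rewrite /hazard_atom (negbTE yb).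
case: ifPn => bD.
  have -> : D `&` [set b] = [set b].
    by apply/seteqP; split => x [] //; move=> ->; split => //; rewrite inE in bD.
  by rewrite esum_set1 /hazard_atom eqxx ?lee_fin.
have -> : D `&` [set b] = set0; last by rewrite esum_set0.
apply/seteqP; split => x // [Dx xb]; move: bD; rewrite notin_setE; apply.
by rewrite -xb.
Qed.

Let mass_total : (\int[leb]_(t in @timeline R) (hazard_dens t)%:E
   + \esum_(t in @timeline R) (hazard_atom t)%:E <= 1)%E.
Proof.
rewrite dens_int atom_sum mem_set; last by rewrite timelineE (le_trans a0)// ltW.
have -> : @timeline R `&` `[a, b[ = `[a, b[%classic.
  apply/seteqP; split => x; first by case.
  by move=> xI; split => //; move: xI; rewrite /= in_itv/= timelineE => /andP[/(le_trans a0)].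
by rewrite int_f ?(ltW ab)// -EFinD lee_fin.
Qed.

Definition hazard_strategy : strategy R :=
  Strategy dens0 dens_meas atom0 atom_count mass_total.

Lemma hazard_cdf_before t : t < a -> strat_cdf hazard_strategy t = 0.
Proof.
move=> ta; rewrite /strat_cdf /mass /= dens_int atom_sum memNset; last first.
  by rewrite /= in_itv/= => /andP[_]; rewrite leNgt (lt_trans ta).
have -> : `[0, t] `&` `[a, b[ = set0 :> set R.
  apply/seteqP; split => x // [] /=; rewrite !in_itv/= => /andP[_ xt] /andP[ax _].
  by have := lt_le_trans ta (le_trans ax xt); rewrite ltxx.
by rewrite integral_set0 adde0.
Qed.

Lemma hazard_cdf_itv t : a <= t < b -> strat_cdf hazard_strategy t = k * (1 - W t).
Proof.
move=> /andP[at_ tb]; rewrite /strat_cdf /mass /= dens_int atom_sum memNset; last first.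
  by rewrite /= in_itv/= => /andP[_]; rewrite leNgt tb.
have -> : `[0, t] `&` `[a, b[ = `[a, t]%classic :> set R.
  apply/seteqP; split => x /=; rewrite !in_itv/=.
    by move=> [/andP[_ ->] /andP[->]].
  move=> /andP[ax xt]; rewrite (le_trans a0 ax) ax xt; split => //.
  exact: le_lt_trans tb.
rewrite -integral_itv_bndo_bndc; last first.
  apply/measurable_EFinP; apply: measurable_funS (loc_integrable_measurable (t := t) lf) => //.
  by move=> y /=; rewrite !in_itv/= => /andP[/(le_trans a0)-> /ltW].
by rewrite int_f// adde0.
Qed.

Lemma hazard_cdf_after t : b <= t -> strat_cdf hazard_strategy t = k * (1 - W b) + m.
Proof.
move=> bt; have b0 := le_trans a0 (ltW ab).
rewrite /strat_cdf /mass /= dens_int atom_sum mem_set; last by rewrite /= in_itv/= b0.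
have -> : `[0, t] `&` `[a, b[ = `[a, b[%classic :> set R.
  apply/seteqP; split => x /=; rewrite !in_itv/=; first by case.
  move=> /andP[ax xb]; split; last by rewrite ax.
  by rewrite (le_trans a0 ax) (le_trans (ltW xb)).
by rewrite int_f ?(ltW ab)// -EFinD.
Qed.

End HazardStrategy.

Lemma Rintegral_itv_lt (R : realType) (c : R -> R) (s x y : R) :
  {within `[0, +oo[, continuous c} -> 0 <= s -> s <= x -> x < y ->
  (forall z, x < z < y -> 0 < c z) ->
  \int[@lebesgue_measure R]_(z in `[s, x]) c z <
  \int[@lebesgue_measure R]_(z in `[s, y]) c z.
Proof.
move=> cc s0 sx xy c0; rewrite (Rintegral_itv_cat sx (ltW xy)); last first.
  exact: within_continuous_integrable.
rewrite ltrDl; apply: Rintegral_itv_gt0 => //.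
by apply: within_continuous_integrable => //; exact: le_trans sx.
Qed.

(** * Positive rates, the equation for the cutoff, and uniqueness *)

Section Rates.
Context {R : realType} (E : game R) (tauP : R) (CP : regular_cutoff E tauP).
Local Notation leb := (@lebesgue_measure R).
Let EP := rc_game CP.
Implicit Types s t x y : R.

Lemma fake_rate_gt0 x : 0 <= x -> x < tauP -> 0 < fake_rate E x.
Proof.
move=> x0 xT; rewrite divr_gt0 ?(principal_margin_gt0 CP)//.
by rewrite subr_gt0 (mu_lt_theta CP).
Qed.

Lemma stop_rate_gt0 x : 0 <= x -> x <= tauP -> 0 < stop_rate E x.
Proof.
move=> x0 xT; rewrite divr_gt0 ?subr_gt0 ?(mu_gt_beta CP)// -subr_gt0.
exact: lt_le_trans (agent_margin_gt0 CP) (agent_margin_le CP x0 xT).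
Qed.

Lemma fake_rate_continuous : {within `[0, +oo[, continuous (fake_rate E)}.
Proof. exact: affine_HR_continuous. Qed.

Lemma stop_rate_continuous : {within `[0, +oo[, continuous (stop_rate E)}.
Proof. exact: affine_HR_continuous. Qed.

Lemma cum_fake_rate_lt s x y : 0 <= s -> s <= x -> x < y -> y <= tauP ->
  cum_fake_rate E s x < cum_fake_rate E s y.
Proof.
move=> s0 sx xy yT; apply: Rintegral_itv_lt => //; first exact: fake_rate_continuous.
move=> z /andP[xz zy]; apply: fake_rate_gt0; last exact: lt_le_trans yT.
by rewrite (le_trans s0)// (le_trans sx)// ltW.
Qed.

Lemma cum_stop_rate_lt s x y : 0 <= s -> s <= x -> x < y -> y <= tauP ->
  cum_stop_rate E s x < cum_stop_rate E s y.
Proof.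
move=> s0 sx xy yT; apply: Rintegral_itv_lt => //; first exact: stop_rate_continuous.
move=> z /andP[xz zy]; apply: stop_rate_gt0; last by rewrite ltW// (lt_le_trans zy).
by rewrite (le_trans s0)// (le_trans sx)// ltW.
Qed.

Lemma cum_fake_rate_anti s t : 0 <= s -> s < t -> t <= tauP ->
  cum_fake_rate E t tauP < cum_fake_rate E s tauP.
Proof.
move=> s0 st tT; have t0 := le_trans s0 (ltW st).
rewrite /cum_fake_rate (Rintegral_itv_cat (ltW st) tT); last first.
  exact: within_continuous_integrable fake_rate_continuous.
rewrite ltrDr; have := cum_fake_rate_lt s0 (lexx s) st tT.
by rewrite {1}/cum_fake_rate set_itv1 Rintegral_set1.
Qed.

Lemma cutoff_unique s t : 0 < s < tauP -> 0 < t < tauP ->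
  1 - expR (- cum_fake_rate E s tauP) = sigma E ->
  1 - expR (- cum_fake_rate E t tauP) = sigma E -> s = t.
Proof.
move=> /andP[s0 sT] /andP[t0 tT] <- /addrI/oppr_inj/expR_inj/oppr_inj e.
have [st|ts|//] := ltgtP s t.
- by have := cum_fake_rate_anti (ltW s0) st (ltW tT); rewrite e ltxx.
- by have := cum_fake_rate_anti (ltW t0) ts (ltW sT); rewrite e ltxx.
Qed.

(** Intermediate values: [F] goes from [sigma_bar E tauP] at 0 to 0 at [tauP], and [sigma E] lies
    strictly between the two. *)
Lemma exists_cutoff : sigma E < sigma_bar E tauP ->
  exists2 tM, 0 < tM < tauP & 1 - expR (- cum_fake_rate E tM tauP) = sigma E.
Proof.
move=> sb; have T0 := rc_gt0 CP; have /andP[sg0 _] := rg_sigma EP.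
have lf := within_continuous_loc_integrable fake_rate_continuous.
pose C t := \int[leb]_(x in `[0, t]) fake_rate E x.
pose F t := 1 - expR (- (C tauP - C t)).
have FE t : 0 <= t <= tauP -> F t = 1 - expR (- cum_fake_rate E t tauP).
  move=> /andP[t0 tT]; rewrite /F /C (Rintegral0_itv_cat t0 tT lf).
  by congr (1 - expR (- _)); rewrite addrAC subrr add0r.
have cF : continuous F.
  move=> t; apply: cvgB; first exact: cvg_cst.
  apply: (@continuous_comp _ _ _ (fun t => - (C tauP - C t)) expR); last exact: continuous_expR.
  apply: cvgN; apply: cvgB; first exact: cvg_cst.
  exact: (continuous_Rintegral0 lf).
have FT : F tauP = 0 by rewrite /F subrr oppr0 expR0 subrr.
have F0 : sigma E < F 0 by rewrite FE ?lexx ?(ltW T0).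
have [||t tI Ft] := @IVT R F 0 tauP (sigma E) (ltW T0).
- exact: continuous_subspaceT.
- by rewrite FT ge_min (ltW sg0) orbT le_max (ltW F0).
move: tI; rewrite in_itv/= => tI; exists t; last by rewrite -FE.
have /andP[t0 tT] := tI; rewrite !lt_neqAle t0 tT !andbT; apply/andP; split.
  by apply: contraTneq F0 => ->; rewrite Ft ltxx.
by apply: contraTneq sg0 => e; rewrite -Ft e FT ltxx.
Qed.

Lemma fake_support p t1 : determined E tauP p t1 ->
  strat_support (fake p) = [set t%:E | t in `[t1, tauP]].
Proof.
move=> D; have /andP[t0 tT] := det_itv D; have /andP[sg0 _] := rg_sigma EP.
apply: strat_support_itv (ltW t0) tT (det_fake_inactive D) (det_fake_inactive_after D) _.
move=> x y tx xy yT.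
rewrite !(det_fake_itv D); last 2 first.
- by rewrite (le_trans tx (ltW xy)) yT.
- by rewrite tx (le_trans (ltW xy)).
rewrite ltr_pM2l ?invr_gt0// ltrD2l ltrN2 ltr_expR ltrN2.
exact: cum_fake_rate_lt (ltW t0) _ _ _.
Qed.

Lemma stop_support p t1 : determined E tauP p t1 ->
  strat_support (stop p) = [set t%:E | t in `[t1, tauP]].
Proof.
move=> D; have /andP[t0 tT] := det_itv D.
apply: strat_support_itv (ltW t0) tT (det_stop_inactive D) (det_stop_inactive_after D) _.
move=> x y tx xy yT; have xT := lt_le_trans xy yT.
rewrite (det_stop_itv D) ?tx//.
have [{}yT|Ty] := ltP y tauP.
  rewrite (det_stop_itv D) ?yT ?(le_trans tx (ltW xy))//.
  rewrite ltrD2l ltrN2 ltr_expR ltrN2.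
  exact: cum_stop_rate_lt (ltW t0) _ _ (ltW _).
(* At [tauP] the jump of F_P gives the strict inequality. *)
by rewrite (det_stop_after D)// gtrBl expR_gt0.
Qed.

Lemma determined_same_profile p q s t :
  determined E tauP p s -> determined E tauP q t -> same_profile p q.
Proof.
move=> Dp Dq.
have e := cutoff_unique (det_itv Dp) (det_itv Dq) (det_sigma Dp) (det_sigma Dq).
rewrite -{}e in Dq => x x0; have /andP[s0 sT] := det_itv Dp.
split; first by rewrite (det_accept Dp) ?(det_accept Dq).
- have [xs|sx] := ltP x s; first by rewrite (det_stop_before Dp) ?(det_stop_before Dq) ?x0.
  have [xT|Tx] := ltP x tauP; first by rewrite (det_stop_itv Dp) ?(det_stop_itv Dq) ?sx.
  by rewrite (det_stop_after Dp) ?(det_stop_after Dq).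
- have [xs|sx] := ltP x s; first by rewrite (det_fake_before Dp) ?(det_fake_before Dq) ?x0.
  have [xT|Tx] := ltP x tauP; first by rewrite (det_fake_itv Dp) ?(det_fake_itv Dq) ?sx ?ltW.
  by rewrite (det_fake_after Dp) ?(det_fake_after Dq).
Qed.

End Rates.

(** * Optimality of the strategies with the prescribed rates *)

Section Existence.
Context {R : realType} (E : game R) (tauP : R) (CP : regular_cutoff E tauP).
Local Notation leb := (@lebesgue_measure R).
Let EP := rc_game CP.
Variable tM : R.
Hypothesis tM_itv : 0 < tM < tauP.
Hypothesis tM_sigma : 1 - expR (- cum_fake_rate E tM tauP) = sigma E.
Implicit Types s t x y : R.

Let tM_gt0 : 0 < tM. Proof. by case/andP: tM_itv. Qed.
Let tM0 := ltW tM_gt0.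
Let tM_lt : tM < tauP. Proof. by case/andP: tM_itv. Qed.
Let T0 := ltW (rc_gt0 CP).
Let sg0 : 0 < sigma E. Proof. by case/andP: (rg_sigma EP). Qed.

Let fr_ge0 x : tM <= x < tauP -> 0 <= fake_rate E x.
Proof. by move=> /andP[/(le_trans tM0) x0 xT]; rewrite ltW// (fake_rate_gt0 CP). Qed.

Let sr_ge0 x : tM <= x < tauP -> 0 <= stop_rate E x.
Proof. by move=> /andP[/(le_trans tM0) x0 xT]; rewrite ltW// (stop_rate_gt0 CP)// ltW. Qed.

Let fake_mass :
  (sigma E)^-1 * (1 - expR (- \int[leb]_(y in `[tM, tauP]) fake_rate E y)) + 0 <= 1.
Proof. by rewrite addr0 tM_sigma mulVf// gt_eqF. Qed.

Let stop_mass :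
  1 * (1 - expR (- cum_stop_rate E tM tauP)) + expR (- cum_stop_rate E tM tauP) <= 1.
Proof. by rewrite mul1r subrK. Qed.

Let sgV0 : 0 <= (sigma E)^-1. Proof. by rewrite invr_ge0 ltW. Qed.

Definition faking := hazard_strategy (fake_rate_continuous CP) tM0 tM_lt
  fr_ge0 sgV0 (lexx 0) fake_mass.

Definition stopping := hazard_strategy (stop_rate_continuous CP) tM0 tM_lt
  sr_ge0 ler01 (expR_ge0 _) stop_mass.

Let accept1 (t : R) : 0 <= t -> 0 <= (fun=> 1 : R) t <= 1.
Proof. by move=> _; rewrite ler01 lexx. Qed.

Definition candidate : profile R :=
  @Profile R (fun=> 1) stopping faking accept1 (measurable_cst _).

Let p := candidate.

Lemma candidate_survA x : tM <= x < tauP -> survA E p x = expR (- cum_fake_rate E tM x).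
Proof.
move=> xI; rewrite /survA [strat_cdf _ _]hazard_cdf_itv// mulrA mulfV ?gt_eqF//.
by rewrite mul1r subKr.
Qed.

Lemma candidate_survP_before x : x < tM -> survP p x = 1.
Proof. by move=> xt; rewrite /survP [strat_cdf _ _]hazard_cdf_before// subr0. Qed.

Lemma candidate_survP x : tM <= x < tauP -> survP p x = expR (- cum_stop_rate E tM x).
Proof. by move=> xI; rewrite /survP [strat_cdf _ _]hazard_cdf_itv// mul1r subKr. Qed.

Lemma candidate_survP_after x : tauP <= x -> survP p x = 0.
Proof. by move=> Tx; rewrite /survP [strat_cdf _ _]hazard_cdf_after// mul1r subrK subrr. Qed.

Lemma candidate_atom x : atom (fake p) x = 0.
Proof. by rewrite /= /hazard_atom; case: ifP. Qed.

Lemma candidate_dens_out x : ~~ (tM <= x < tauP) -> dens (fake p) x = 0.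
Proof. by move=> xI; rewrite /= /hazard_dens patchE memNset//= in_itv/=; exact/negP. Qed.

Lemma candidate_dens x : tM <= x < tauP ->
  sigma E * dens (fake p) x = fake_rate E x * survA E p x.
Proof.
move=> xI; rewrite candidate_survA//= /hazard_dens patchE mem_set/= ?in_itv//.
by rewrite mulrA mulfV ?gt_eqF// mul1r.
Qed.

(** The rate of faking is the one at which the gain from accepted news exactly covers the cost of
    delay, so the principal's drift vanishes. *)
Lemma candidate_gain_itv x : tM <= x < tauP ->
  news_gain E p x = rho E * theta E * (1 - G E x) * survA E p x.
Proof.
move=> xI; have /andP[tx xT] := xI; have x0 := le_trans tM0 tx.
rewrite /news_gain -mulrA -[_ * dens _ _ * _]mulrA [dens _ _ * _]mulrC.
rewrite (_ : _ - _ = mu E * (1 - theta E) * g E x * survA E p x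
  - (theta E - mu E) * (sigma E * dens (fake p) x) * (1 - G E x)); last by ring.
rewrite candidate_dens// (gE EP x0) /fake_rate.
by field; rewrite subr_eq0 gt_eqF// (mu_lt_theta CP).
Qed.

Lemma candidate_gain_out x : ~~ (tM <= x < tauP) ->
  news_gain E p x = mu E * (1 - theta E) * g E x * survA E p x.
Proof. by move=> xI; rewrite /news_gain candidate_dens_out// mulr0 mul0r subr0. Qed.

Lemma candidate_gain_gt0 x : 0 <= x -> 0 < news_gain E p x.
Proof.
move=> x0; have X0 := survA_gt0 EP p x.
have [xI|xI] := boolP (tM <= x < tauP).
  rewrite candidate_gain_itv// !mulr_gt0 ?(rg_rho EP) ?(theta_gt0 CP)//.
  exact: survival_gt0.
rewrite candidate_gain_out// !mulr_gt0 ?(mu_gt0 CP) ?(g_gt0 EP)//.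
by rewrite subr_gt0 (theta_lt1 CP).
Qed.

Lemma candidate_PICa : PICa E p.
Proof.
move=> t t0; split => // mt.
have := candidate_gain_gt0 t0.
rewrite -(mu1_no_atom EP t0) ?candidate_atom// pmulr_rgt0 ?(w1P_d_gt0 EP)//.
by rewrite subr_gt0 ltNge (ltW mt).
Qed.

Let aat s : 0 <= s -> 0 < atom (fake p) s -> accept p s = 0.
Proof. by move=> _; rewrite candidate_atom ltxx. Qed.

Lemma candidate_value_P_before x : 0 <= x -> x < tM -> value_P E p x < value_P E p tM.
Proof.
move=> x0 xt; apply: (value_P_lt CP) => // s /andP[xs st].
have s0 := le_trans x0 (ltW xs).
apply: (inactive_drift_P_gt0 CP candidate_PICa) => //; first exact: lt_trans tM_lt.
by rewrite /active candidate_atom candidate_dens_out ?ltxx; [case|rewrite leNgt st].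
Qed.

Lemma candidate_value_P_itv x : tM <= x <= tauP -> value_P E p x = value_P E p tM.
Proof.
move=> /andP[tx xT]; rewrite (value_PB EP p tM0 tx).
rewrite (@ae_eq_Rintegral _ _ (fun=> 0)) ?Rintegral_cst ?mul0r ?addr0//.
- exact: loc_integrableW (drift_P_loc_integrable EP p).
- apply: aeW => s /andP[ts sx]; rewrite /drift_P candidate_gain_itv; last first.
    by rewrite (ltW ts) (lt_le_trans sx).
  by rewrite mul1r subrr mulr0.
Qed.

Lemma candidate_value_P_le x : 0 <= x -> value_P E p x <= value_P E p tM.
Proof.
move=> x0; have [/(candidate_value_P_before x0)/ltW//|tx] := ltP x tM.
have [xT|Tx] := leP x tauP; first by rewrite candidate_value_P_itv ?tx.
rewrite -(@candidate_value_P_itv tauP) ?lexx ?(ltW tM_lt)//.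
exact/ltW/(value_P_after CP).
Qed.

Lemma candidate_never S : strat_cdf S tauP = 1 -> ~ active S +oo%E.
Proof. by move=> /(strat_cdf1_never T0) /= ->; rewrite ltxx. Qed.

Lemma candidate_stop_active (t : \bar R) : (0 <= t)%E -> active (stop p) t ->
  uP E p t = (value_P E p tM)%:E.
Proof.
have never : ~ active (stop p) +oo%E.
  by apply: candidate_never; rewrite [LHS]hazard_cdf_after// mul1r subrK.
case: t => [t|_ /never//|//]; rewrite lee_fin => t0 at_.
rewrite (uP_fin EP aat t0) candidate_value_P_itv//; case: at_ => /=.
  rewrite /hazard_dens patchE; case: ifPn; last by rewrite ltxx.
  by rewrite mem_setE in_itv/= => /andP[-> /ltW->].
rewrite /hazard_atom; case: eqP => [->|]; last by rewrite ltxx.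
by rewrite lexx (ltW tM_lt).
Qed.

Lemma candidate_PICt : PICt E p.
Proof.
move=> t t' t0 t'0 at_; rewrite (candidate_stop_active t0 at_).
case: t' t'0 => [t'|_|//].
  by rewrite lee_fin => t'0; rewrite (uP_fin EP aat t'0) lee_fin candidate_value_P_le.
apply: (uP_pinfty_le EP aat (n0 := 0%N)) => n _.
by rewrite (uP_fin EP aat)// lee_fin candidate_value_P_le.
Qed.

Let V := accepted_payoff E p tM.
Let mb0 : 0 < mu E - beta E.
Proof. by rewrite subr_gt0 (mu_gt_beta CP). Qed.

(** Before tM the derivative of B is [disc_surv] times beta (1 - mu) H_R - rho mu, which is
    nonnegative up to [tauP] by [agent_margin_le]. *)
Lemma candidate_payoff_before x : 0 <= x -> x < tM -> accepted_payoff E p x <= V.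
Proof.
move=> x0 xt; rewrite /V /accepted_payoff candidate_survP_before//.
rewrite candidate_survP ?lexx// /cum_stop_rate set_itv1 Rintegral_set1 oppr0 expR0.
rewrite !mulr1 (value_AB EP p x0 (ltW xt)) (disc_survB EP x0 (ltW xt)) mulrDl.
rewrite -[X in _ <= X]addrA lerD2l [X in X <= _]addrC lerD2r.
rewrite mulrC -RintegralZl//; last exact: loc_integrableW (disc_hazard_loc_integrable EP).
rewrite -subr_ge0 -RintegralB//; last 2 first.
- exact: loc_integrableW (drift_A_loc_integrable EP p).
- exact: loc_integrableW (loc_integrableZ _ (disc_hazard_loc_integrable EP)).
have i := loc_integrableW tM x0 (loc_integrableB (drift_A_loc_integrable EP p)
  (loc_integrableZ (mu E - beta E) (disc_hazard_loc_integrable EP))).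
rewrite -Rintegral_itv_bndo_bndc; last first.
  apply: integrableS i => // s /=.
  by rewrite !in_itv/= => /andP[-> /ltW].
apply: Rintegral_ge0 => s; rewrite /= in_itv/= => /andP[xs st].
have s0 := le_trans x0 xs.
rewrite (_ : _ - _ = disc_surv E s * (beta E * (1 - mu E) * HR E s - rho E * mu E)).
  rewrite mulr_ge0 ?(ltW (disc_surv_gt0 EP s0))//.
  by apply: le_trans (ltW (agent_margin_gt0 CP)) (agent_margin_le CP s0 _);
    rewrite ltW// (lt_trans st).
rewrite /drift_A /disc_hazard /disc_surv candidate_survP_before// (gE EP s0) /=; ring.
Qed.

(** [disc_surv] times [survP] decays at the rate c for which the drift of K is c times (mu - beta)
    [disc_surv] [survP]. What K gains is therefore exactly what the terminal payoff loses. *)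
Lemma candidate_payoff_itv x : tM <= x < tauP -> accepted_payoff E p x = V.
Proof.
move=> xI; have /andP[tx xT] := xI.
pose c s := (mu E * (1 - beta E) * HR E s - rho E * beta E) / (mu E - beta E).
have cc : {within `[0, +oo[, continuous c} by exact: affine_HR_continuous.
have mbn0 : mu E - beta E != 0 by rewrite gt_eqF.
have ZE s : tM <= s < tauP -> disc_surv E s * survP p s =
    disc_surv E tM * expR (- \int[leb]_(y in `[tM, s]) c y).
  move=> sI; have /andP[ts sT] := sI.
  rewrite (candidate_survP sI) (disc_surv_expE EP tM0 ts) -mulrA -expRD -opprD.
  congr (_ * expR (- _)); rewrite /cum_stop_rate -RintegralD//.
  - by apply: eq_Rintegral => y _; rewrite /c /stop_rate; field.
  - exact: within_continuous_integrable (hazard_rate_continuous EP).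
  - exact: within_continuous_integrable (stop_rate_continuous CP).
have tMI : tM <= tM < tauP by rewrite lexx.
rewrite /V /accepted_payoff (ZE x xI) (ZE tM tMI) set_itv1 Rintegral_set1 oppr0 expR0 mulr1.
rewrite (value_AB EP p tM0 tx).
have -> : \int[leb]_(s in `[tM, x]) drift_A E p s =
    (mu E - beta E) * disc_surv E tM * (1 - expR (- \int[leb]_(y in `[tM, x]) c y)).
  rewrite -(one_sub_expR_Rintegral tM0 tx cc).
  have k0 : (mu E - beta E) * disc_surv E tM != 0.
    by rewrite mulf_neq0// gt_eqF// (disc_surv_gt0 EP).
  apply: (mulfI (invr_neq0 k0)); rewrite [RHS]mulrA mulVf// mul1r -RintegralZl//; last first.
    exact: loc_integrableW (drift_A_loc_integrable EP p).
  apply: eq_Rintegral => s; rewrite inE/= in_itv/= => /andP[ts sx].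
  have sI : tM <= s < tauP by rewrite ts (le_lt_trans sx).
  have s0 := le_trans tM0 ts.
  have -> : drift_A E p s = disc_surv E s * survP p s *
      (mu E * (1 - beta E) * HR E s - rho E * beta E).
    by rewrite /drift_A (gE EP s0) /disc_surv /=; ring.
  rewrite ZE// /c; field; apply/andP; split => //.
  by rewrite gt_eqF// (disc_surv_gt0 EP).
ring.
Qed.


(** After [tauP] the agent is left with K(tauP), the left limit of K(s), and K(s) <= B(s) = V on the
    interval. *)
Lemma candidate_payoff_after x : tauP <= x -> agent_payoff E p x <= V.
Proof.
move=> Tx.
rewrite /agent_payoff candidate_survP_after// mulr0 !mul0r addr0.
rewrite (value_A_const CP T0 Tx) => [|s /andP[/ltW/candidate_survP_after]//].
apply: (@continuous_le_left _ (value_A E p) tM) => //; first exact: value_A_continuous.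
move=> s /andP[/ltW ts sT]; have sI : tM <= s < tauP by rewrite ts.
rewrite -(candidate_payoff_itv sI) /accepted_payoff lerDl.
apply: mulr_ge0; last exact: ltW.
apply: mulr_ge0; last exact: survP_ge0.
by rewrite ltW// (disc_surv_gt0 EP)// (le_trans tM0).
Qed.

Lemma candidate_payoff_le x : 0 <= x -> agent_payoff E p x <= V.
Proof.
move=> x0; have [xT|] := ltP x tauP; last exact: candidate_payoff_after.
have -> : agent_payoff E p x = accepted_payoff E p x.
  by rewrite /agent_payoff mulr1.
have [xt|tx] := ltP x tM; first exact: candidate_payoff_before.
by rewrite candidate_payoff_itv ?tx.
Qed.

Lemma candidate_AIC : AIC E p.
Proof.
have never : ~ active (fake p) +oo%E.
  apply: candidate_never; rewrite [LHS]hazard_cdf_after//.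
  by rewrite [X in _ * X]tM_sigma mulVf ?gt_eqF// addr0.
move=> t t' + t'0; case: t => [t|_ /never//|//].
rewrite lee_fin => t0; rewrite /active candidate_atom => -[|]; last by rewrite ltxx.
have [tI _|/candidate_dens_out->] := boolP (tM <= t < tauP); last by rewrite ltxx.
have -> : uA E p t%:E = V%:E.
  by rewrite (uA_fin EP p t0) -(candidate_payoff_itv tI) /accepted_payoff mulr1.
case: t' t'0 => [t'|_|//].
  by rewrite lee_fin => t'0; rewrite (uA_fin EP p t'0) lee_fin candidate_payoff_le.
apply: (uA_pinfty_le EP (n0 := 0%N)) => n _.
have n0 : 0 <= n%:R :> R by [].
by rewrite (uA_fin EP p n0) lee_fin candidate_payoff_le.
Qed.

Lemma candidate_beneficial : beneficial_equilibrium E p.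
Proof.
split; first by split; [exact: candidate_AIC|exact: candidate_PICa|exact: candidate_PICt].
have t_lt : theta E < value_P E p tM.
  by rewrite -(value_P0 E p) candidate_value_P_before.
rewrite /payoffP (expectation_active_value (v := value_P E p tM)) ?lte_fin//.
  by rewrite ltW// (lt_trans (theta_gt0 CP)).
exact: candidate_stop_active.
Qed.

End Existence.

Theorem proposition2 (R : realType) (E : game R) (tauP : R)
  (theta01 : 0 < theta E < 1)
  (beta_bounds : 0 < beta E < theta E)
  (mu_bounds : beta E < mu E < theta E)
  (rho_gt0 : 0 < rho E)
  (sigma01 : 0 < sigma E < 1)
  (g_ge0 : forall t : R, 0 <= t -> 0 <= g E t)
  (g_continuous : {within `[0, +oo[, continuous (g E)})
  (g_mass1 : (\int[@lebesgue_measure R]_(t in `[0%R, +oo[) (g E t)%:E = 1)%E)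
  (G_lt1 : forall t : R, 0 <= t -> G E t < 1)
  (HR_decreasing : forall s t : R, 0 <= s -> s < t -> HR E t < HR E s)
  (A1 : HR_oo E < phiP E < HR E 0)
  (A2 : phiA E < phiP E)
  (tauP_gt0 : 0 < tauP)
  (tauP_def : HR E tauP = phiP E) :
  [/\ (exists p : profile R, beneficial_equilibrium E p) <-> sigma E < sigma_bar E tauP,
      forall p : profile R, beneficial_equilibrium E p ->
        exists tauM : R,
          [/\ unique (fun t : R => 0 < t < tauP /\
                        1 - expR (- cum_fake_rate E t tauP) = sigma E) tauM,
              forall t : R, tauM <= t <= tauP ->
                strat_cdf (fake p) t =
                  (sigma E)^-1 * (1 - expR (- cum_fake_rate E tauM t)),
              (forall t : R, tauM <= t < tauP ->
                strat_cdf (stop p) t = 1 - expR (- cum_stop_rate E tauM t))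
              /\ strat_cdf (stop p) tauP = 1,
              strat_support (fake p) = [set t%:E | t in `[tauM, tauP]]
              /\ strat_support (stop p) = [set t%:E | t in `[tauM, tauP]] &
              payoffA E p = (uFB_A E tauM)%:E
              /\ payoffP E p = (uFB_P E tauM)%:E] &
      forall p q : profile R, beneficial_equilibrium E p -> beneficial_equilibrium E q ->
        same_profile p q].
Proof.
have CP : regular_cutoff E tauP by split => //; split.
split; first split.
- move=> [p /(beneficial_determined CP)[t1 [D _ _]]].
  (* [sigma_bar] is the left side of the equation for the cutoff at starting time 0, and that side
     strictly decreases in the starting time. *)
  have /andP[t0 tT] := det_itv D.
  rewrite -(det_sigma D) /sigma_bar ltrD2l ltrN2 ltr_expR ltrN2.
  exact: (cum_fake_rate_anti CP (lexx 0) t0 (ltW tT)).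
- move=> /(exists_cutoff CP)[tM tM_itv tM_sigma].
  by exists (candidate CP tM_itv tM_sigma); exact: candidate_beneficial.
- move=> p /(beneficial_determined CP)[t1 [D PA PP]]; exists t1; split.
  + split; first by split; [exact: det_itv D|exact: det_sigma D].
    by move=> t [tI ts]; exact: (cutoff_unique CP (det_itv D) tI (det_sigma D) ts).
  + exact: det_fake_itv D.
  + by split; [exact: det_stop_itv D|exact: (det_stop_after D (lexx tauP))].
  + by split; [exact: (fake_support CP)|exact: (stop_support CP)].
  + by [].
- move=> p q /(beneficial_determined CP)[s [Dp _ _]] /(beneficial_determined CP)[t [Dq _ _]].
  exact: (determined_same_profile CP Dp Dq).
Qed.
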